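(* Let $N\in\mathbb N$, $\kappa,k\in\mathbb Z_+$, and let $\mathbf s=\{s_i\}_{i=0}^{2n_N-2}$ be a regular sequence of real numbers with set of normal indices $\mathcal N(\mathbf s)=\{n_j\}_{j=1}^N$ ($n_1<\dots<n_N$). Let $m_j(z)$ $(1\le j\le N)$ and $l_j$ $(1\le j\le N-1)$ be defined by the Schur recursion described in the context, and let the polynomials $P_j^+(z)$, $Q_j^+(z)$ $(-1\le j\le 2N-1)$ be defined by $P_{-1}^+\equiv0$, $P_0^+\equiv1$, $Q_{-1}^+\equiv1$, $Q_0^+\equiv0$ and $$P^+_{2i-1}=-zm_iP^+_{2i-2}+P^+_{2i-3},\quad Q^+_{2i-1}=-zm_iQ^+_{2i-2}+Q^+_{2i-3}\quad(1\le i\le N),$$ $$P^+_{2i}=l_iP^+_{2i-1}+P^+_{2i-2},\quad Q^+_{2i}=l_iQ^+_{2i-1}+Q^+_{2i-2}\quad(1\le i\le N-1).$$ Then: (1) The (nondegenerate odd) moment problem $MP_\kappa^k(\mathbf s,2n_N-2)$ is solvable (i.e. $\mathcal M_\kappa^k(\mathbf s,2n_N-2)\ne\emptyset$) if and only if $$\kappa_N:=\nu_-(S_{n_N})\le\kappa\quad\text{and}\quad k_N:=\nu_-(S^+_{n_N-1})\le k .$$ (2) $f\in\mathcal M_\kappa^k(\mathbf s,2n_N-2)$ if and only if $f$ admits the representation $$f(z)=\frac{Q^+_{2N-1}(z)\tau(z)+Q^+_{2N-2}(z)}{P^+_{2N-1}(z)\tau(z)+P^+_{2N-2}(z)},$$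 where $$\tau\in\mathbf N_{\kappa-\kappa_N}^{k-k_N}\quad\text{and}\quad\frac1{\tau(z)}=o(z),\quad z\widehat\to\infty .$$
   Context: Classes. A function $f$, meromorphic on $\mathbb C\setminus\mathbb R$ with $f(\bar z)=\overline{f(z)}$ and domain of holomorphy $\mathfrak h_f$, belongs to $\mathbf N_\kappa$ ($\kappa\in\mathbb Z_+=\mathbb N\cup\{0\}$) if for all finite sets $z_1,\dots,z_n\in\mathbb C_+\cap\mathfrak h_f$ the form $\sum_{i,j}\frac{f(z_i)-\overline{f(z_j)}}{z_i-\bar z_j}\xi_i\bar\xi_j$ has at most $\kappa$ negative squares, and for some choice exactly $\kappa$. $\mathbf N_\kappa^k$ is the set of $f\in\mathbf N_\kappa$ with $zf(z)\in\mathbf N_k$ (classes with a negative index are empty). Convention: $\tau\equiv\infty$ is admitted as an element of $\mathbf N_0^0$, with $1/\tau=0$; in that case the fraction in (2) means $Q^+_{2N-1}/P^+_{2N-1}$. $z\widehat\to\infty$ means $z\to\infty$ nontangentially, i.e. inside sectors $\varepsilon<\arg z<\pi-\varepsilon$, $\varepsilon>0$. Problem. For a real sequence $\mathbf s=\{s_j\}_{j=0}^\ell$, $\mathcal M_\kappa^k(\mathbf s,\ell)$, the solution set of $MP_\kappa^k(\mathbf s,\ell)$, is the set of $f\in\mathbf N_\kappa^k$ with $f(z)=-\frac{s_0}{z}-\cdots-\frac{s_\ell}{z^{\ell+1}}+o\left(\frac1{z^{\ell+1}}\right)$ for $z=iy$, $y\uparrow\infty$. Matrices. $S_n=(s_{i+j})_{i,j=0}^{n-1}$,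 $S_n^+=(s_{i+j+1})_{i,j=0}^{n-1}$, $D_n=\det S_n$, $D_n^+=\det S_n^+$, $D_0^+=1$; $\nu_-(S)$ is the number of negative eigenvalues of $S$ (zero for an empty matrix). $n\ge1$ is a normal index of $\mathbf s$ if $D_n\ne0$. The sequence $\mathbf s=\{s_i\}_{i=0}^{2n_N-2}$ is regular if $D^+_{n_j-1}\ne0$ for all $j=1,\dots,N$ (equivalently $D_{n_j}^+\ne0$ for $j=1,\dots,N-1$). The odd problem is nondegenerate if $D_{n_N}\ne0$ and $D^+_{n_N-1}\ne0$. Toeplitz notation. $T(c_0,\dots,c_n)$ is the upper triangular $(n+1)\times(n+1)$ matrix with entries $c_{j-i}$ for $i\le j$ and $0$ for $i>j$. Schur recursion (here $\ell=2n_N-2$). Put $n_0=0$, $\mathbf s^{(0)}=\mathbf s$. Given $\mathbf s^{(j-1)}=\{s_i^{(j-1)}\}_{i=0}^{\ell-2n_{j-1}}$, let $\nu=n_j-n_{j-1}$ (then $s^{(j-1)}_0=\dots=s^{(j-1)}_{\nu-2}=0$, $s^{(j-1)}_{\nu-1}\ne0$), $D_\nu^{(j-1)}=\det(s^{(j-1)}_{i+p})_{i,p=0}^{\nu-1}$, $(D_\nu^{(j-1)})^+=\det(s^{(j-1)}_{i+p+1})_{i,p=0}^{\nu-1}$. Then $$m_j(z)=\frac{(-1)^{\nu+1}}{D_\nu^{(j-1)}}\Delta_j(z)=\sum_{i=0}^{\nu-1}m_i^{(j)}z^i\quad(1\le j\le N),$$ where $\Delta_j(z)$ is the determinant of the $\nu\times\nu$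 matrix whose first $\nu-1$ rows are $(s^{(j-1)}_{i+1},s^{(j-1)}_{i+2},\dots,s^{(j-1)}_{i+\nu})$, $i=0,\dots,\nu-2$, and whose last row is $(1,z,\dots,z^{\nu-1})$; and, for $1\le j\le N-1$, $$l_j=(-1)^{\nu+1}s^{(j-1)}_{\nu-1}\frac{D_\nu^{(j-1)}}{(D_\nu^{(j-1)})^+}.$$ For $1\le j\le N-1$ the sequences $\{\mathfrak s_i^{(j)}\}_{i=-1}^{\ell-2n_j}$ and $\mathbf s^{(j)}=\{s_i^{(j)}\}_{i=0}^{\ell-2n_j}$ are determined by $$T(m^{(j)}_{\nu-1},\dots,m^{(j)}_0,-\mathfrak s^{(j)}_{-1},\dots,-\mathfrak s^{(j)}_{\ell-2n_j})\,T(s^{(j-1)}_{\nu-1},\dots,s^{(j-1)}_{\ell-2n_{j-1}})=I,$$ $$T(l_j,-s_0^{(j)},\dots,-s^{(j)}_{\ell-2n_j})\,T(\mathfrak s^{(j)}_{-1},\dots,\mathfrak s^{(j)}_{\ell-2n_j})=I .$$ *)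

(* Defs.v *)
(* MathComp, MathComp-Analysis and real-closed; R[i] is the field of complex
   numbers over R : realType. *)
From mathcomp Require Import all_boot all_order all_algebra.
From mathcomp Require Import polyrcf complex.
From mathcomp Require Import all_classical all_reals all_analysis.

Set Implicit Arguments.
Unset Strict Implicit.
Unset Printing Implicit Defensive.

Import Order.TTheory GRing.Theory Num.Theory.
Import numFieldNormedType.Exports.
Import Normc.

Local Open Scope classical_set_scope.
Local Open Scope ring_scope.
Local Open Scope complex_scope.

(* A meromorphic function on C \ R is represented by a map f : R[i] -> option
   R[i] into the Riemann sphere, None being the point at infinity (the value at
   a pole). The values of f on the real axis are never used. *)

Definition nonreal (R : realType) : set R[i] := [set z | complex.Im z != 0].

Definition upper (R : realType) : set R[i] := [set z | 0 < complex.Im z].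

Definition fin (R : realType) (f : R[i] -> option R[i]) : R[i]^o -> R[i]^o :=
  fun z => odflt 0 (f z).

Definition holomorphic_at (R : realType) (f : R[i] -> option R[i])
    (z0 : R[i]^o) : Prop :=
  \forall z \near z0, f z != None /\ derivable (fin f) z 1.

Definition pole_at (R : realType) (f : R[i] -> option R[i])
    (z0 : R[i]^o) : Prop :=
  [/\ f z0 = None,
      \forall z \near z0^', holomorphic_at f z &
      (normc (fin f z) : R) @[z --> z0^'] --> +oo].

Definition meromorphic_nonreal (R : realType) (f : R[i] -> option R[i]) : Prop :=
  forall z, nonreal z -> holomorphic_at f z \/ pole_at f z.

Definition real_symmetric (R : realType) (f : R[i] -> option R[i]) : Prop :=
  forall z, nonreal z -> f (z^*) = omap (fun w => w^*) (f z).

(* The form \sum_(i, j) A i j xi_i (xi_j)^* has exactly m negative squares: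
   it is a real linear combination of squared moduli of n linearly independent
   linear forms in xi, in which exactly m coefficients are negative. *)
Definition neg_squares (R : realType) (n : nat) (A : 'M[R[i]]_n) (m : nat) : Prop :=
  exists (L : 'M[R[i]]_n) (d : 'I_n -> R),
    [/\ L \in unitmx,
        forall xi : 'I_n -> R[i],
          \sum_i \sum_j A i j * xi i * (xi j)^* =
          \sum_p (d p * normc (\sum_i L p i * xi i) ^+ 2)%:C &
        #|[set p | d p < 0]%SET| = m].

Definition nevanlinna_kernel (R : realType) (f : R[i] -> option R[i])
    (n : nat) (z : 'I_n -> R[i]) : 'M[R[i]]_n :=
  \matrix_(i, j) ((fin f (z i) - (fin f (z j))^*) / (z i - (z j)^*)).

(* The class N_kappa. *)
Definition nevanlinna (R : realType) (kappa : nat) (f : R[i] -> option R[i]) : Prop :=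
  [/\ meromorphic_nonreal f,
      real_symmetric f,
      forall (n : nat) (z : 'I_n -> R[i]),
        (forall i, upper (z i) /\ holomorphic_at f (z i)) ->
        exists2 m, (m <= kappa)%N & neg_squares (nevanlinna_kernel f z) m &
      exists (n : nat) (z : 'I_n -> R[i]),
        (forall i, upper (z i) /\ holomorphic_at f (z i)) /\
        neg_squares (nevanlinna_kernel f z) kappa].

Definition mulz (R : realType) (f : R[i] -> option R[i]) : R[i] -> option R[i] :=
  fun z => omap (fun w => z * w) (f z).

(* The class N_kappa^k; empty if an index is negative, and with the constant
   infinity adjoined if kappa = k = 0. *)
Definition nevanlinna2 (R : realType) (kappa k : int)
    (f : R[i] -> option R[i]) : Prop :=
  match kappa, k with
  | Posz a, Posz b =>
      (nevanlinna a f /\ nevanlinna b (mulz f)) \/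
      [/\ a = 0%N, b = 0%N & forall z, nonreal z -> f z = None]
  | _, _ => False
  end.

(* The solution set of the problem MP_kappa^k(s, ell), where size s = ell.+1.
   The limit is taken along z = iy, y -> +oo. *)
Definition moment_solution (R : realType) (kappa k : int) (s : seq R)
    (f : R[i] -> option R[i]) : Prop :=
  [/\ nevanlinna2 kappa k f,
      \forall y \near +oo%R, f (0 +i* y) != None &
      ((0 +i* y) ^+ size s *
         (fin f (0 +i* y) +
          \sum_(j < size s) (s`_j)%:C / (0 +i* y) ^+ j.+1) : R[i]^o)
        @[y --> +oo%R] --> (0 : R[i]^o)].

Definition hankel (R : realType) (s : seq R) (n : nat) : 'M[R]_n :=
  \matrix_(i < n, j < n) s`_(i + j).

Definition hankel_plus (R : realType) (s : seq R) (n : nat) : 'M[R]_n :=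
  \matrix_(i < n, j < n) s`_(i + j).+1.

(* Negative eigenvalues, counted with multiplicity. *)
Definition nu_minus (R : realType) (n : nat) (S : 'M[R]_n) : nat :=
  (\sum_(x <- rootsR (char_poly S) | (x < 0)%R) mup x (char_poly S))%N.

(* The bound says that s contains all the entries s_0, ..., s_(2n-2) of S_n. *)
Definition normal_index (R : realType) (s : seq R) (n : nat) : bool :=
  [&& (0 < n)%N, (2 * n - 1 <= size s)%N & \det (hankel s n) != 0].

(* n_j, for ns = [:: n_1; ...; n_N], with n_0 = 0. *)
Definition nidx (ns : seq nat) (j : nat) : nat := nth 0%N (0%N :: ns) j.

Definition regular (R : realType) (s : seq R) (ns : seq nat) : Prop :=
  forall j, (1 <= j <= size ns)%N -> \det (hankel_plus s (nidx ns j - 1)) != 0.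

Definition toeplitz (R : realType) (n : nat) (c : seq R) : 'M[R]_n :=
  \matrix_(i < n, j < n) if (i <= j)%N then c`_(j - i) else 0.

Definition schur_delta (R : realType) (s : seq R) (nu : nat) : {poly R} :=
  \det (\matrix_(i < nu, p < nu)
          if (i.+1 < nu)%N then (s`_(i + p).+1)%:P else 'X^p).

Definition schur_m (R : realType) (s : seq R) (nu : nat) : {poly R} :=
  ((-1) ^+ nu.+1 / \det (hankel s nu)) *: schur_delta s nu.

Definition schur_l (R : realType) (s : seq R) (nu : nat) : R :=
  (-1) ^+ nu.+1 * s`_nu.-1 * (\det (hankel s nu) / \det (hankel_plus s nu)).

(* ss j is the sequence s^(j), and fs j is the auxiliary sequence
   (frak s)^(j), whose numbering starts at -1: (fs j)`_i = (frak s)^(j)_(i-1). *)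
Definition schur_recursion (R : realType) (s : seq R) (ns : seq nat)
    (ss fs : nat -> seq R) (m : nat -> {poly R}) (l : nat -> R) : Prop :=
  let N := size ns in
  let nu j := (nidx ns j - nidx ns j.-1)%N in
  [/\ ss 0%N = s,
      forall j, (1 <= j <= N)%N -> m j = schur_m (ss j.-1) (nu j),
      forall j, (1 <= j <= N.-1)%N -> l j = schur_l (ss j.-1) (nu j) &
      forall j, (1 <= j <= N.-1)%N ->
        let c := rev (mkseq (fun i => (m j)`_i) (nu j)) ++ map -%R (fs j) in
        let c' := l j :: map -%R (ss j) in
        [/\ size (ss j) = (size s - 2 * nidx ns j)%N,
            size (fs j) = (size (ss j)).+1,
            toeplitz (size c) c *m
              toeplitz (size c) (drop (nu j).-1 (ss j.-1)) = 1%:M &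
            toeplitz (size c') c' *m toeplitz (size c') (fs j) = 1%:M]].

(* The pair (X_(j-1), X_j) of the solution of X_(2i-1) = - z m_i X_(2i-2) +
   X_(2i-3), X_(2i) = l_i X_(2i-1) + X_(2i-2) with X_(-1) = x, X_0 = y. *)
Fixpoint stieltjes_pair (R : realType) (m : nat -> {poly R}) (l : nat -> R)
    (x y : {poly R}) (j : nat) : {poly R} * {poly R} :=
  if j is j'.+1 then
    let uv := stieltjes_pair m l x y j' in
    (uv.2, (if odd j then - 'X * m (uphalf j) else (l j./2)%:P) * uv.2 + uv.1)
  else (x, y).

Definition Pplus (R : realType) (m : nat -> {poly R}) (l : nat -> R) (j : nat) :
  {poly R} := (stieltjes_pair m l 0 1 j).2.

Definition Qplus (R : realType) (m : nat -> {poly R}) (l : nat -> R) (j : nat) :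
  {poly R} := (stieltjes_pair m l 1 0 j).2.

Definition evalC (R : realType) (p : {poly R}) (z : R[i]) : R[i] :=
  (map_poly (real_complex R) p).[z].

(* (a t + b) / (c t + d) on the Riemann sphere, for a d - b c != 0. *)
Definition moebius (R : realType) (a b c d : R[i]) (t : option R[i]) : option R[i] :=
  match t with
  | Some w => if c * w + d == 0 then None else Some ((a * w + b) / (c * w + d))
  | None => if c == 0 then None else Some (a / c)
  end.

Definition sphere_inv (R : realType) (t : option R[i]) : option R[i] :=
  match t with
  | Some w => if w == 0 then None else Some w^-1
  | None => Some 0
  end.

(* g(z) = o(z) as z -> infinity inside every sector eps < arg z < pi - eps,
   with z = r (cos theta + i sin theta); in particular g(z) is finite there
   for all large |z|. *)
Definition nontangential_o_z (R : realType) (g : R[i] -> option R[i]) : Prop :=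
  forall eps delta : R, 0 < eps -> 0 < delta ->
  exists rho : R, forall r theta : R,
    0 < r -> rho < r -> eps < theta < pi - eps ->
    exists2 w, g ((r * cos theta) +i* (r * sin theta)) = Some w &
               normc w <= delta * r.

(* Main.v *)
Require Import Defs.
From mathcomp Require Import all_boot all_order all_algebra.
From mathcomp Require Import fingroup perm.
From mathcomp Require Import polyrcf complex spectral sesquilinear.
From mathcomp Require Import all_classical all_reals all_analysis.
From mathcomp Require Import ring lra zify.

(** The functions f = Q tau + Q' over P tau + P' are the continued fractions

      f = 1 / (- z m_1 + 1 / (l_1 + 1 / (- z m_2 + ... + 1 / tau))),

    and the theorem says that the indices (kappa, k) of f are those of tau,
    increased by constants, while the moment condition on f is the growth
    condition on 1 / tau.

    Indices.  A function is given by homogeneous coordinates X = (u, v) in the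
    upper half-plane, f = u / v, and its index is the number of negative
    squares of the kernel (u_z v_w^* - v_z u_w^* ) / (z - w^* ), taken at all
    points, poles included.  Each step of the continued fraction is a shear: it
    adds a real polynomial p to 1 / f or to f, and to the kernel it adds the
    Bezoutian of p, a form of finite rank given by the Hankel matrix of the
    coefficients of p.  So the index grows by at most the number of negative
    eigenvalues of that matrix (shear_le).  If the function to which p is added
    is o(y) at iy, the bound is attained (shear_ge): combinations of kernel
    functions at points i y, 2 i y, ... recover the Hankel form in the limit and
    decouple from the rest.  Multiplication by z turns the chain for f into one
    for z f, with shears by m_j and by z l_j.  Hence both indices of f are
    those of tau plus sums over the coefficients (levels_is_idx,
    levels_zmul_is_idx).

    The constants.  For tau = infinity these sums are upper bounds for the
    indices, and the moment condition makes the inertia of S_n and S_n^+ lower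
    bounds (hankel_index_ge).  The same holds for the opposite function.  Since
    the matrices are nonsingular and the Hankel matrices of the coefficients
    have the same total size, all the bounds are attained (index_by_opposite,
    mass_hankel, massp_hankel).

    Moments.  The Toeplitz identities of the recursion are identities between
    truncated power series in 1 / z: they say that two reciprocals carry the
    expansion of a fraction to that of its tail (asym_step).  For this the
    normal indices of the successive sequences have to be known; the vanishing
    of a Hankel determinant is the existence of an exceptional Pade
    approximant, which the recursion transports (hankel_pade, hankel_transfer).

    Analysis.  The class N_kappa consists of meromorphic functions, and the
    growth condition is imposed in sectors.  Complex integration is avoided:
    what is needed follows from the finite number of negative squares.  If 1 / f
    were not differentiable at a pole, a limit of divided differences of kernel
    functions would span a hyperbolic plane with the kernel function at the pole
    and raise the index (removable).  Points where f is infinite cannot cluster unless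
    f is the constant infinity (few_infinite).  And if 1 / f = o(z) held on the
    imaginary axis but failed in a sector, points of the sector would provide
    arbitrarily many almost orthogonal vectors of negative square
    (slow_nontangential). *)

Set Implicit Arguments.
Unset Strict Implicit.
Unset Printing Implicit Defensive.

Import Order.TTheory GRing.Theory Num.Theory.
Import numFieldNormedType.Exports.
Import Normc.

Local Open Scope classical_set_scope.
Local Open Scope complex_scope.
Local Open Scope ring_scope.

(** * Complex numbers *)

Section ComplexBasics.
Variable R : realType.
Local Notation C := R[i].
Implicit Types x y : C.

Lemma cReD x y : complex.Re (x + y) = complex.Re x + complex.Re y.
Proof. by case: x; case: y. Qed.
Lemma cReN x : complex.Re (- x) = - complex.Re x. Proof. by case: x. Qed.
Lemma cImD x y : complex.Im (x + y) = complex.Im x + complex.Im y.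
Proof. by case: x; case: y. Qed.
Lemma cImN x : complex.Im (- x) = - complex.Im x. Proof. by case: x. Qed.
Lemma cRe_conj x : complex.Re x^* = complex.Re x. Proof. by case: x. Qed.
Lemma cIm_conj x : complex.Im x^* = - complex.Im x. Proof. by case: x. Qed.
Lemma Re_sum (I : Type) (r : seq I) (P : pred I) (F : I -> C) :
  complex.Re (\sum_(i <- r | P i) F i) = \sum_(i <- r | P i) complex.Re (F i).
Proof. by elim/big_rec2: _ => // i a b _ <-; rewrite cReD. Qed.
Lemma Re_realM (a : R) x : complex.Re (a%:C * x) = a * complex.Re x.
Proof. by case: x => b c /=; rewrite mul0r subr0. Qed.
Lemma normc_ge0 x : 0 <= normc x. Proof. by case: x => a b; exact: sqrtr_ge0. Qed.
Lemma normc_eq0 x : (normc x == 0) = (x == 0).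
Proof. by apply/eqP/eqP => [/eq0_normc//|->]; rewrite normc0. Qed.
Lemma normc_gt0 x : (0 < normc x) = (x != 0).
Proof. by rewrite lt_def normc_eq0 normc_ge0 andbT. Qed.
Lemma mulcJ x : x * x^* = (normc x ^+ 2)%:C.
Proof. by rewrite -normCK rmorphXn. Qed.
Lemma normcJR x : normc x^* = normc x.
Proof. by have := normcJ x => -[]. Qed.
Lemma cconjV x : (x^-1)^* = (x^*)^-1.
Proof. exact: fmorphV. Qed.
Lemma cconj_real (a : R) : (a%:C)^* = a%:C :> C.
Proof. exact: conjc_real. Qed.
Lemma Re_le_normc x : `|complex.Re x| <= normc x.
Proof. by have := normc_ge_Re x; rewrite lecR. Qed.
Lemma normc_real (a : R) : normc a%:C = `|a|.
Proof. by rewrite /= expr0n addr0 sqrtr_sqr. Qed.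
Lemma normc_sum (I : Type) (r : seq I) (P : pred I) (F : I -> C) :
  normc (\sum_(i <- r | P i) F i) <= \sum_(i <- r | P i) normc (F i).
Proof.
elim/big_rec2: _ => [|i a b _ h]; first by rewrite normc0.
by apply: le_trans (le_normcD _ _) _; rewrite lerD2l.
Qed.
End ComplexBasics.

(** * Hermitian forms and their negative squares *)

Section Forms.
Variable R : realType.
Local Notation C := R[i].

Definition sform (T : finType) (A : T -> T -> C) (x y : T -> C) : C :=
  \sum_s \sum_t A s t * x s * (y t)^*.

Definition quad (T : finType) (A : T -> T -> C) (x : T -> C) : R :=
  complex.Re (sform A x x).

Definition comb (k : nat) (T : Type) (c : 'I_k -> C) (V : 'I_k -> T -> C) : T -> C :=
  fun t => \sum_i c i * V i t.

Definition nonzero (k : nat) (c : 'I_k -> C) : Prop := exists i, c i != 0.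

(** The form is nonnegative on a subspace of codimension at most k. Inertia is
    bounded from above by linear conditions and from below by vectors, so that
    no diagonal form is involved: such bounds pass at once through linear
    maps, sums and restrictions of the set of points. *)
Definition neg_le (T : finType) (A : T -> T -> C) (k : nat) : Prop :=
  exists L : 'I_k -> T -> C,
    forall x, (forall i, \sum_t L i t * x t = 0) -> 0 <= quad A x.

Definition neg_ge (T : finType) (A : T -> T -> C) (k : nat) : Prop :=
  exists V : 'I_k -> T -> C, forall c, nonzero c -> quad A (comb c V) < 0.

Definition herm (T : Type) (A : T -> T -> C) : Prop :=
  forall s t, A t s = (A s t)^*.

Lemma lin_dep (k j : nat) (M : 'I_k -> 'I_j -> C) : (j < k)%N ->
  exists2 c, nonzero c & forall q, \sum_i c i * M i q = 0.
Proof.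
move=> ltjk; pose A := \matrix_(i, q) M i q.
have kn0 : kermx A != 0.
  rewrite kermx_eq0 /row_free; apply/negP => /eqP e.
  by have := rank_leq_col A; rewrite e leqNgt ltjk.
have [v vA v0] := rowV0Pn kn0.
exists (fun i => v 0 i).
  case/rV0Pn: v0 => i vi; by exists i.
move=> q; have /sub_kermxP /matrixP /(_ 0 q) := vA; rewrite !mxE => e.
by rewrite -[RHS]e; apply: eq_bigr => i _; rewrite !mxE.
Qed.

Lemma eq_quad (T : finType) (A B : T -> T -> C) x y :
  (forall s t, A s t = B s t) -> x =1 y -> quad A x = quad B y.
Proof.
move=> AB xy; rewrite /quad /sform; congr complex.Re.
by apply: eq_bigr => s _; apply: eq_bigr => t _; rewrite AB !xy.
Qed.

Lemma quadD (T : finType) (A B : T -> T -> C) x :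
  quad (fun s t => A s t + B s t) x = quad A x + quad B x.
Proof.
rewrite /quad -cReD /sform -big_split; congr complex.Re.
apply: eq_bigr => s _; rewrite -big_split; apply: eq_bigr => t _.
by rewrite !mulrDl.
Qed.

Lemma quadN (T : finType) (A : T -> T -> C) x :
  quad (fun s t => - A s t) x = - quad A x.
Proof.
rewrite /quad -cReN /sform -sumrN; congr complex.Re; apply: eq_bigr => s _.
by rewrite -sumrN; apply: eq_bigr => t _; rewrite !mulNr.
Qed.

Lemma sum_comb (T : finType) k (c : 'I_k -> C) (V : 'I_k -> T -> C) (L : T -> C) :
  \sum_t L t * comb c V t = \sum_i c i * (\sum_t L t * V i t).
Proof.
under eq_bigr do rewrite /comb mulr_sumr.
rewrite exchange_big; apply: eq_bigr => i _; rewrite mulr_sumr.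
by apply: eq_bigr => t _; rewrite mulrCA.
Qed.

Lemma neg_ge_le (T : finType) (A : T -> T -> C) k j :
  neg_ge A k -> neg_le A j -> (k <= j)%N.
Proof.
case=> V hV [L hL]; rewrite leqNgt; apply/negP => ltjk.
have [c c0 hc] := lin_dep (fun i q => \sum_t L q t * V i t) ltjk.
have := hV c c0; rewrite ltNge hL // => q.
by rewrite sum_comb hc.
Qed.

Lemma neg_le_mono (T : finType) (A : T -> T -> C) k j :
  (k <= j)%N -> neg_le A k -> neg_le A j.
Proof.
move=> le [L hL].
exists (fun i t => if insub (val i) is Some i' then L i' t else 0) => x hx.
apply: hL => i; rewrite -[RHS](hx (widen_ord le i)).
by apply: eq_bigr => t _; rewrite /= insubT //= => hi; congr (L _ _ * _); apply: val_inj.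
Qed.

Lemma neg_leD (T : finType) (A B : T -> T -> C) a b :
  neg_le A a -> neg_le B b -> neg_le (fun s t => A s t + B s t) (a + b).
Proof.
move=> [L hL] [M hM].
exists (fun i : 'I_(a + b) => match fintype.split i with inl i => L i | inr i => M i end) => x hx.
rewrite quadD addr_ge0 //.
  by apply: hL => i; have := hx (unsplit (inl i)); rewrite unsplitK.
by apply: hM => i; have := hx (unsplit (inr i)); rewrite unsplitK.
Qed.

Lemma eq_neg_le (T : finType) (A B : T -> T -> C) k :
  (forall s t, A s t = B s t) -> neg_le A k -> neg_le B k.
Proof.
move=> AB [L hL]; exists L => x hx.
by rewrite -(@eq_quad _ A _ x) //; apply: hL.
Qed.

Lemma eq_neg_ge (T : finType) (A B : T -> T -> C) k :
  (forall s t, A s t = B s t) -> neg_ge A k -> neg_ge B k.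
Proof.
move=> AB [V hV]; exists V => c hc.
by rewrite -(@eq_quad _ A _ (comb c V)) //; apply: hV.
Qed.

Definition cong (S T : finType) (X : S -> T -> C) (A : T -> T -> C) : S -> S -> C :=
  fun s s' => sform A (X s) (X s').

Definition pull (S T : finType) (X : S -> T -> C) (x : S -> C) : T -> C :=
  fun t => \sum_s x s * X s t.

Lemma form_suml (S T : finType) (A : T -> T -> C) (x : S -> C) (X : S -> T -> C) y :
  sform A (pull X x) y = \sum_s x s * sform A (X s) y.
Proof.
rewrite /sform /pull; under [RHS]eq_bigr => s _ do rewrite mulr_sumr.
rewrite [RHS]exchange_big; apply: eq_bigr => t _ /=.
under [RHS]eq_bigr => s _ do rewrite mulr_sumr.
rewrite [RHS]exchange_big; apply: eq_bigr => t' _ /=.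
rewrite mulr_sumr mulr_suml; apply: eq_bigr => s _.
by rewrite mulrCA !mulrA.
Qed.

Lemma form_sumr (S T : finType) (A : T -> T -> C) (y : S -> C) (Y : S -> T -> C) x :
  sform A x (pull Y y) = \sum_s (y s)^* * sform A x (Y s).
Proof.
rewrite /sform /pull; under [RHS]eq_bigr => s _ do rewrite mulr_sumr.
rewrite [RHS]exchange_big; apply: eq_bigr => t _ /=.
under [RHS]eq_bigr => s _ do rewrite mulr_sumr.
rewrite [RHS]exchange_big; apply: eq_bigr => t' _ /=.
rewrite rmorph_sum mulr_sumr; apply: eq_bigr => s _.
by rewrite rmorphM mulrCA.
Qed.

Lemma form_cong (S T : finType) (X : S -> T -> C) A x y :
  sform (cong X A) x y = sform A (pull X x) (pull X y).
Proof.
rewrite form_suml; apply: eq_bigr => s _; rewrite form_sumr mulr_sumr /=.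
by apply: eq_bigr => s' _; rewrite /cong; ring.
Qed.

Lemma quad_cong (S T : finType) (X : S -> T -> C) A x :
  quad (cong X A) x = quad A (pull X x).
Proof. by rewrite /quad form_cong. Qed.

Lemma neg_le_cong (S T : finType) (X : S -> T -> C) A k :
  neg_le A k -> neg_le (cong X A) k.
Proof.
case=> L hL; exists (fun i s => \sum_t L i t * X s t) => x hx.
rewrite quad_cong; apply: hL => i; rewrite -[RHS](hx i) /pull.
under eq_bigr do rewrite mulr_sumr.
rewrite exchange_big; apply: eq_bigr => s _; rewrite mulr_suml.
by apply: eq_bigr => t _; rewrite mulrCA mulrC.
Qed.

Lemma neg_ge_cong (S T : finType) (X : S -> T -> C) A k :
  neg_ge (cong X A) k -> neg_ge A k.
Proof.
case=> V hV; exists (fun i => pull X (V i)) => c c0.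
have := hV c c0; rewrite quad_cong; congr (_ < _); apply: eq_quad => // t.
rewrite /pull /comb; under eq_bigr do rewrite mulr_suml.
rewrite exchange_big; apply: eq_bigr => i _; rewrite mulr_sumr.
by apply: eq_bigr => s _; rewrite mulrA.
Qed.

Lemma herm_cong (S T : finType) (X : S -> T -> C) A : herm A -> herm (cong X A).
Proof.
move=> hA s t; rewrite /cong /sform rmorph_sum exchange_big; apply: eq_bigr => a _ /=.
rewrite rmorph_sum; apply: eq_bigr => b _ /=; rewrite !rmorphM /= conjCK -hA.
by rewrite -!mulrA [X t b * _]mulrC.
Qed.

Lemma herm_form_real (T : finType) (A : T -> T -> C) x :
  herm A -> sform A x x = (quad A x)%:C.
Proof.
move=> hA; have : (sform A x x)^* = sform A x x.
  rewrite /sform rmorph_sum [RHS]exchange_big; apply: eq_bigr => a _ /=.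
  rewrite [LHS]rmorph_sum; apply: eq_bigr => b _ /=; rewrite !rmorphM /= conjCK -hA.
  by rewrite -!mulrA [x b * _]mulrC.
rewrite /quad; case: (sform A x x) => a b [] /= e.
by rewrite (_ : b = 0) //; lra.
Qed.

Definition dform (n : nat) (P : 'M[C]_n) (d : 'I_n -> R) (x : 'I_n -> C) : R :=
  \sum_p d p * normc (\sum_i P p i * x i) ^+ 2.

Lemma card_enum_ord (n k : nat) (D : pred 'I_n) : #|D| = k ->
  exists2 e : 'I_k -> 'I_n, injective e & forall i, D i <-> exists j, e j = i.
Proof.
move=> <-; exists enum_val; first exact: enum_val_inj.
move=> i; split=> [Di|[j <-]]; last exact: enum_valP.
by exists (enum_rank_in Di i); rewrite enum_rankK_in.
Qed.

Lemma dform_neg_le n (P : 'M[C]_n) d (A : 'I_n -> 'I_n -> C) :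
  (forall x, quad A x = dform P d x) -> neg_le A #|[pred p | d p < 0]|.
Proof.
move=> hA; have [e einj he] := card_enum_ord (erefl #|[pred p | d p < 0]|).
exists (fun j i => P (e j) i) => x hx; rewrite hA; apply: sumr_ge0 => p _.
have [dp|dp] := ltP (d p) 0; last by rewrite mulr_ge0 // exprn_ge0 // normc_ge0.
by have [j <-] := (he p).1 dp; rewrite hx normc0 expr0n mulr0.
Qed.

Lemma dform_neg_ge n (P : 'M[C]_n) d (A : 'I_n -> 'I_n -> C) : P \in unitmx ->
  (forall x, quad A x = dform P d x) ->
  exists (V : 'I_(#|[pred p | d p < 0]|) -> 'I_n -> C) (delta : R),
   0 < delta /\ forall c, quad A (comb c V) <= - delta * \sum_i normc (c i) ^+ 2.
Proof.
move=> uP hA; have [e einj he] := card_enum_ord (erefl #|[pred p | d p < 0]|).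
exists (fun j i => invmx P i (e j)).
pose delta : R := \big[Order.min/1]_(p | d p < 0) (- d p).
exists delta; split.
  by apply/bigmin_gtP; split=> // p dp; rewrite oppr_gt0.
move=> c; rewrite hA /dform.
have eqPp p : \sum_i P p i * comb c (fun j i => invmx P i (e j)) i
    = \sum_j c j * (p == e j)%:R.
  rewrite sum_comb; apply: eq_bigr => j _; congr (_ * _).
  by have /matrixP /(_ p (e j)) := mulmxV uP; rewrite !mxE.
under eq_bigr do rewrite eqPp.
rewrite (bigID (fun p => d p < 0)) /= [X in _ + X]big1 ?addr0; last first.
  move=> p dp; rewrite big1 ?normc0 ?expr0n ?mulr0 // => j _.
  case: eqVneq => [pe|]; last by rewrite mulr0.
  by case/negP: dp; rewrite pe; apply/(he _).2; exists j.
rewrite mulr_sumr (reindex_omap e (fun p => [pick j | e j == p])) /=; last first.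
  move=> p dp; case: pickP => [j /eqP <- //|no].
  by have [j hj] := (he p).1 dp; have := no j; rewrite hj eqxx.
rewrite [leLHS](_ : _ = \sum_j d (e j) * normc (c j) ^+ 2); last first.
  apply: eq_big => [j|j _].
    rewrite (_ : d (e j) < 0) /=; last by apply/(he _).2; exists j.
    by case: pickP => [j' /eqP/einj ->|/(_ j)]; rewrite eqxx.
  rewrite (bigD1 j) //= eqxx mulr1 big1 ?addr0 // => j' jj'.
  by rewrite (inj_eq einj) eq_sym (negPf jj') mulr0.
apply: ler_sum => j _; rewrite ler_wpM2r ?exprn_ge0 ?normc_ge0 // lerNr.
apply: bigmin_le_cond; apply/(he _).2; by exists j.
Qed.

(** One diagonalization serves both descriptions of the inertia that are
    needed, by squares and by negative roots of the characteristic polynomial.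
    *)
Lemma spectral n (A : 'M[C]_n) : herm (fun i j => A i j) ->
  exists (P : 'M[C]_n) (d : 'I_n -> R), [/\ P \in unitmx,
    forall x, sform (fun i j => A i j) x x = (dform P d x)%:C,
    char_poly A = \prod_p ('X - (d p)%:C%:P) & \det A = \prod_p (d p)%:C].
Proof.
move=> hA.
have Ah : A \is hermsymmx.
  apply/is_hermitianmxP; rewrite expr0 scale1r; apply/matrixP => i j.
  by rewrite !mxE [LHS]hA.
have /mxOverP dR := hermitian_spectral_diag_real Ah.
have /hermitian_normalmx /orthomx_spectralP := Ah.
set P := spectralmx A; set sp := spectral_diag A in dR *; move=> eA.
have uP : P \is unitarymx := spectral_unitarymx A.
have PU := unitarymx_unit uP.
pose d p := complex.Re (sp 0 p).
have dE p : sp 0 p = (d p)%:C by rewrite RRe_real.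
exists (map_mx Num.conj P), d; split.
- by rewrite map_unitmx.
- move=> x; rewrite /sform {1}eA invmx_unitary //.
  rewrite rmorph_sum /=.
  have E i j : (P^t* *m diag_mx sp *m P)%sesqui i j
     = \sum_p (d p)%:C * (P p i)^* * P p j.
    rewrite mxE; apply: eq_bigr => p _; rewrite mul_mx_diag !mxE dE.
    by rewrite [_ * (d p)%:C]mulrC.
  under eq_bigr => i _ do under eq_bigr => j _ do rewrite E !mulr_suml.
  under eq_bigr => i _ do rewrite exchange_big.
  rewrite exchange_big; apply: eq_bigr => p _ /=.
  rewrite rmorphM /= -mulcJ rmorph_sum big_distrlr mulr_sumr; apply: eq_bigr => i _.
  rewrite mulr_sumr; apply: eq_bigr => j _.
  by rewrite !mxE /= rmorphM /= conjCK; ring.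
- rewrite eA /char_poly /char_poly_mx.
  have -> : map_mx polyC (invmx P *m diag_mx sp *m P) =
     map_mx polyC (invmx P) *m map_mx polyC (diag_mx sp) *m map_mx polyC P.
    by rewrite !map_mxM.
  have e1 : map_mx polyC (invmx P) *m map_mx polyC P = 1%:M.
    by rewrite -map_mxM mulVmx // map_mx1.
  rewrite -[X in X - _](_ : map_mx polyC (invmx P) *m 'X%:M *m map_mx polyC P = _); last first.
    by rewrite scalar_mxC -mulmxA e1 mulmx1.
  rewrite -mulmxBl -mulmxBr !det_mulmx mulrC mulrA -det_mulmx -map_mxM mulmxV //.
  rewrite map_mx1 det1 mul1r -[RHS](_ : \det (diag_mx (\row_p ('X - (d p)%:C%:P))) = _).
    congr (\det _); apply/matrixP => i j; rewrite !mxE.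
    by case: eqVneq => [->|_]; rewrite ?mulr0n ?subr0 ?mulr1n ?dE.
  by rewrite det_diag; apply: eq_bigr => p _; rewrite mxE.
- rewrite eA !det_mulmx det_diag mulrC mulrA -det_mulmx mulmxV // det1 mul1r.
  by apply: eq_bigr => p _; rewrite dE.
Qed.

Lemma sum_sqr_gt0 k (c : 'I_k -> C) : nonzero c -> 0 < \sum_i normc (c i) ^+ 2.
Proof.
case=> i ci; rewrite (bigD1 i) //= ltr_wpDr ?sumr_ge0 //.
  by move=> j _; rewrite exprn_ge0 ?normc_ge0.
by rewrite exprn_gt0 ?normc_gt0.
Qed.

(** Negativity with a margin, which survives small perturbations of the form.
    *)
Definition strong_neg (T : finType) (A : T -> T -> C) k :=
  exists (V : 'I_k -> T -> C) (delta : R), 0 < delta /\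
    forall c, quad A (comb c V) <= - delta * \sum_i normc (c i) ^+ 2.

Lemma strong_neg_ge (T : finType) (A : T -> T -> C) k : strong_neg A k -> neg_ge A k.
Proof.
case=> V [e [e0 hV]]; exists V => c /sum_sqr_gt0 c0.
by apply: le_lt_trans (hV c) _; rewrite mulNr oppr_lt0 mulr_gt0.
Qed.

Lemma inertia_ord n (A : 'I_n -> 'I_n -> C) : herm A ->
  exists k, [/\ neg_le A k, strong_neg A k & (k <= n)%N].
Proof.
move=> hA; have hB : herm (fun i j => (\matrix_(i, j) A i j) i j).
  by move=> i j; rewrite !mxE.
have [P [d [uP hP _ _]]] := spectral hB.
have hq x : quad A x = dform P d x.
  have := hP x; rewrite herm_form_real // => -[<-].
  by apply: eq_quad => // i j; rewrite mxE.
exists #|[pred p | d p < 0]|; split.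
- exact: dform_neg_le hq.
- by have [V [e h]] := dform_neg_ge uP hq; exists V, e.
- by rewrite -[leqRHS]card_ord; exact: max_card.
Qed.

Definition rank_mx (T : finType) (t : T) : 'I_#|T| -> C := fun i => (enum_rank t == i)%:R.

Lemma form_delta (T : finType) (A : T -> T -> C) s t :
  sform A (fun i => (s == i)%:R) (fun i => (t == i)%:R) = A s t.
Proof.
rewrite /sform (bigD1 s) //= (bigD1 t) //= !eqxx !mulr1 rmorph1 mulr1.
rewrite big1 ?addr0; last by move=> j /negPf; rewrite eq_sym => ->; rewrite rmorph0 mulr0.
rewrite big1 ?addr0 // => j /negPf; rewrite eq_sym => ->.
by rewrite big1 // => i _; rewrite mulr0 mul0r.
Qed.

Lemma inertia (T : finType) (A : T -> T -> C) : herm A ->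
  exists2 k, neg_le A k & neg_ge A k.
Proof.
move=> hA; pose B (i j : 'I_#|T|) := A (enum_val i) (enum_val j).
have hB : herm B by move=> i j; rewrite /B hA.
have [k [h1 h2 _]] := inertia_ord hB.
exists k.
  apply: (eq_neg_le (A := cong (@rank_mx T) B)); last exact: neg_le_cong.
  by move=> s t; rewrite /cong form_delta /B !enum_rankK.
apply: (@neg_ge_cong _ _ (fun (i : 'I_#|T|) t => (enum_val i == t)%:R)).
apply: (eq_neg_ge (A := B)); last exact: strong_neg_ge.
by move=> i j; rewrite /cong form_delta.
Qed.

(** The form induced on k coefficients has inertia exactly k, so the margin
    comes from its eigenvalues. *)
Lemma neg_ge_strong (T : finType) (A : T -> T -> C) k : herm A ->
  neg_ge A k -> strong_neg A k.
Proof.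
move=> hA [V hV]; have hG := herm_cong V hA.
have [j [h1 [W [e [e0 h2]]] jk]] := inertia_ord hG.
have gG : neg_ge (cong V A) k.
  exists (fun i t => (i == t)%:R) => c c0; rewrite quad_cong.
  rewrite (@eq_quad _ _ A _ (comb c V)) ?hV // => t; rewrite /pull /comb.
  apply: eq_bigr => i _; congr (_ * _).
  rewrite (bigD1 i) //= eqxx mulr1 big1 ?addr0 // => i' /negPf.
  by move=> ->; rewrite mulr0.
have ej : j = k by apply/eqP; rewrite eqn_leq jk (neg_ge_le gG h1).
move: W h2; rewrite ej => W h2.
exists (fun i => pull V (W i)), e; split=> // c.
have -> : quad A (comb c (fun i => pull V (W i))) = quad (cong V A) (comb c W);
  last exact: h2.
rewrite quad_cong; apply: eq_quad => // t.
rewrite /pull /comb; under [RHS]eq_bigr do rewrite mulr_suml.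
rewrite [RHS]exchange_big; apply: eq_bigr => i _; rewrite mulr_sumr.
by apply: eq_bigr => s _; rewrite mulrA.
Qed.

Lemma cvg_sumC (U : Type) (F : set_system U) {FF : Filter F} (T : finType)
    (f : T -> U -> C) (a : T -> C) :
  (forall t, f t y @[y --> F] --> (a t : C^o)) ->
  (\sum_t f t y : C^o) @[y --> F] --> (\sum_t a t : C^o).
Proof. by move=> h; apply: cvg_big => // -[x y]; exact: add_continuous. Qed.

Lemma cvg_form (U : Type) (F : set_system U) {FF : Filter F} (T : finType)
    (B : U -> T -> T -> C) A x y :
  (forall s t, B u s t @[u --> F] --> (A s t : C^o)) ->
  (sform (B u) x y : C^o) @[u --> F] --> (sform A x y : C^o).
Proof.
move=> h; apply: cvg_sumC => s; apply: cvg_sumC => t.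
apply: cvgM; last exact: cvg_cst.
apply: cvgM; last exact: cvg_cst.
exact: h.
Qed.

Lemma quad_bound k (G : 'I_k -> 'I_k -> C) (e : R) c :
  (forall i j, normc (G i j) <= e) ->
  quad G c <= e * k%:R * \sum_i normc (c i) ^+ 2.
Proof.
move=> hG; rewrite /quad; apply: le_trans (ler_norm _) _.
apply: le_trans (Re_le_normc _) _; rewrite /sform.
apply: le_trans (normc_sum _ _ _) _.
have h : forall i j, normc (G i j * c i * (c j)^*) <=
   e * (normc (c i) ^+ 2 / 2 + normc (c j) ^+ 2 / 2).
  move=> i j; rewrite !normcM normcJR -mulrA.
  have e0 : 0 <= e := le_trans (normc_ge0 _) (hG i j).
  apply: ler_pM => //; rewrite ?mulr_ge0 ?normc_ge0 //.
  have := sqr_ge0 (normc (c i) - normc (c j)); rewrite sqrrB; lra.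
apply: (@le_trans _ _ (\sum_i \sum_j e * (normc (c i) ^+ 2 / 2 + normc (c j) ^+ 2 / 2))).
  apply: ler_sum => i _; apply: le_trans (normc_sum _ _ _) _.
  by apply: ler_sum => j _; exact: h.
under eq_bigr => i _ do (rewrite -mulr_sumr big_split /= sumr_const card_ord).
rewrite -mulr_sumr big_split /= sumr_const card_ord sumrMnl -mulr_suml.
set S := \sum_(i < k) _; rewrite -(mulr_natr (S / 2) k); lra.
Qed.

(** The number of negative squares is lower semicontinuous. Every lower bound
    for an index below is found by exhibiting a limit of Gram matrices. *)
Lemma neg_ge_near (U : Type) (F : set_system U) {FF : Filter F} (T : finType)
    (B : U -> T -> T -> C) A k : herm A ->
  (forall s t, B u s t @[u --> F] --> (A s t : C^o)) ->
  neg_ge A k -> \forall u \near F, neg_ge (B u) k.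
Proof.
move=> hA hB /(neg_ge_strong hA) [V [e [e0 hV]]].
pose G := cong V A.
have e1 : 0 < e / (k%:R + 1) by rewrite divr_gt0 // ltr_wpDl.
have : \forall u \near F, forall ij : 'I_k * 'I_k,
    normc (cong V (B u) ij.1 ij.2 - G ij.1 ij.2) < e / (k%:R + 1).
  apply: filter_forall => -[i j] /=.
  have /cvgrPdist_lt /(_ (e / (k%:R + 1))%:C) := @cvg_form _ _ FF T B A (V i) (V j) hB.
  rewrite ltcR => /(_ e1); apply: filterS => u.
  by rewrite distrC -[`|_|]/((normc _)%:C) ltcR.
apply: filterS => u hu; exists V => c c0.
have -> : quad (B u) (comb c V) = quad A (comb c V) +
     quad (fun i j => cong V (B u) i j - G i j) c.
  rewrite (quadD _ (fun i j => - G i j)) quadN !quad_cong addrC -/(pull V c).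
  by rewrite /pull /comb subrK.
have h2 : quad (fun i j => cong V (B u) i j - G i j) c <=
    e / (k%:R + 1) * k%:R * \sum_i normc (c i) ^+ 2.
  by apply: quad_bound => i j; have /ltW := hu (i, j).
apply: le_lt_trans (lerD (hV c) h2) _.
rewrite -mulrDl pmulr_llt0 ?sum_sqr_gt0 //.
have k1 : (0 : R) < k%:R + 1 by rewrite ltr_wpDl.
have -> : - e + e / (k%:R + 1) * k%:R = - (e / (k%:R + 1)).
  by field; rewrite gt_eqF.
by rewrite oppr_lt0.
Qed.

(** A subspace on which the form is negative and one on which it is positive
    meet only in 0. *)
Lemma neg_opp_card (T : finType) (A : T -> T -> C) a b :
  neg_ge A a -> neg_ge (fun s t => - A s t) b -> (a + b <= #|T|)%N.
Proof.
case=> V hV [W hW]; rewrite leqNgt; apply/negP => lt.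
pose M (i : 'I_(a + b)) (q : 'I_#|T|) :=
  match fintype.split i with inl i => V i | inr i => W i end (enum_val q).
have [c [i0 ci0] hc] := lin_dep M lt.
pose cv i := c (lshift b i); pose cw i := c (rshift a i).
have e t : comb cv V t = - comb cw W t.
  apply/eqP; rewrite -addr_eq0; apply/eqP; have := hc (enum_rank t).
  rewrite big_split_ord /= => h; rewrite -[RHS]h /comb /M enum_rankK.
  congr (_ + _); apply: eq_bigr => i _.
    by rewrite -[lshift b i]/(unsplit (inl i)) unsplitK.
  by rewrite -[rshift a i]/(unsplit (inr i)) unsplitK.
have eq : quad A (comb cv V) = quad A (comb cw W).
  rewrite /quad /sform; congr complex.Re; apply: eq_bigr => s _; apply: eq_bigr => t _.
  by rewrite !e rmorphN /= mulrN mulrN mulNr opprK.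
have hw : nonzero cw -> 0 < quad A (comb cw W).
  by move=> /hW; rewrite quadN oppr_lt0.
have [nv|nv] := EM (nonzero cv).
  have := hV _ nv; rewrite eq ltNge => /negP; apply.
  have [/hw /ltW //|nw] := EM (nonzero cw).
  rewrite (@eq_quad _ _ A _ (fun=> 0)) //.
    by rewrite /quad /sform big1 // => s _; rewrite big1 // => t _; rewrite mulr0 mul0r.
  move=> t; rewrite /comb big1 // => i _.
  by have [->|ci] := eqVneq (cw i) 0; rewrite ?mul0r //; case: nw; exists i.
have nw : nonzero cw.
  move: ci0; rewrite -[i0]splitK; case: fintype.split => i /= ci.
    by case: nv; exists i.
  by exists i.
have := hw nw; rewrite -eq (@eq_quad _ _ A _ (fun=> 0)) //.
  by rewrite /quad /sform big1 ?ltxx // => s _; rewrite big1 // => t _; rewrite mulr0 mul0r.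
move=> t; rewrite /comb big1 // => i _.
by have [->|ci] := eqVneq (cv i) 0; rewrite ?mul0r //; case: nv; exists i.
Qed.

Lemma neg_squares_neg n (A : 'M[C]_n) m : neg_squares A m ->
  neg_le (fun i j => A i j) m /\ neg_ge (fun i j => A i j) m.
Proof.
case=> L [d [uL hL <-]].
have hq x : quad (fun i j => A i j) x = dform L d x.
  by rewrite /quad /sform hL -rmorph_sum.
have -> : #|[set p | d p < 0]%SET| = #|[pred p | d p < 0]|.
  by apply: eq_card => p; rewrite inE.
split; first exact: dform_neg_le hq.
apply: strong_neg_ge; have [V [e h]] := dform_neg_ge uL hq; by exists V, e.
Qed.

Lemma neg_squares_exists n (A : 'M[C]_n) : herm (fun i j => A i j) ->
  exists m, neg_squares A m.
Proof.
move=> /spectral [P [d [uP hP _ _]]].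
exists #|[set p | d p < 0]%SET|, P, d; split=> // x.
by rewrite -[LHS]/(sform _ x x) hP /dform rmorph_sum.
Qed.

Lemma neg_squaresP n (A : 'M[C]_n) m : herm (fun i j => A i j) ->
  neg_le (fun i j => A i j) m -> neg_ge (fun i j => A i j) m -> neg_squares A m.
Proof.
move=> /neg_squares_exists [m' h] h1 h2; have [h3 h4] := neg_squares_neg h.
by have -> : m = m' by apply/eqP; rewrite eqn_leq (neg_ge_le h2) ?(neg_ge_le h4).
Qed.

Definition mxC n (S : 'M[R]_n) : 'I_n -> 'I_n -> C := fun i j => (S i j)%:C.

Lemma nu_minus_diag n (S : 'M[R]_n) : S^T = S ->
  exists (P : 'M[C]_n) (d : 'I_n -> R), [/\ P \in unitmx,
    forall x, quad (mxC S) x = dform P d x,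
    nu_minus S = #|[pred p | d p < 0]| & \det S = \prod_p d p].
Proof.
move=> sS; pose A := map_mx (real_complex R) S.
have hA : herm (fun i j => A i j).
  by move=> i j; rewrite !mxE cconj_real -[in LHS]sS mxE.
have [P [d [uP hP hc hd]]] := spectral hA.
have ec : char_poly S = \prod_p ('X - (d p)%:P).
  apply: (map_poly_inj (real_complex R)); rewrite map_char_poly hc rmorph_prod.
  by apply: eq_bigr => p _; rewrite rmorphB /= map_polyX map_polyC.
exists P, d; split => //.
- move=> x; have := hP x; rewrite herm_form_real // => -[<-].
  by apply: eq_quad => // i j; rewrite mxE.
- have ec' : char_poly S = \prod_(y <- map d (enum 'I_n)) ('X - y%:P).
    by rewrite big_map big_enum.
  have ne0 : char_poly S != 0 by rewrite monic_neq0 // char_poly_monic.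
  rewrite /nu_minus ec'; under eq_bigr do rewrite mu_prod_XsubC.
  rewrite -ec'; have ro := roots_on_rootsR ne0.
  transitivity (\sum_(x <- rootsR (char_poly S))
     \sum_(p | (d p < 0)%R) (d p == x)%R)%N.
    rewrite big_mkcond; apply: eq_bigr => x _.
    rewrite count_map -sum1_count big_enum_cond /=.
    case: ifP => x0.
      rewrite big_mkcond [RHS]big_mkcond /=; apply: eq_bigr => p _.
      by case: eqVneq => [->|_]; rewrite ?x0 //; case: ifP.
    rewrite big1 // => p dp; case: eqVneq => // e; by rewrite -e dp in x0.
  rewrite exchange_big /= -sum1_card; apply: eq_bigr => p dp.
  transitivity (count_mem (d p) (rootsR (char_poly S))).
    rewrite -sum1_count [RHS]big_mkcond /=; apply: eq_bigr => x _.
    by rewrite eq_sym; case: eqP.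
  rewrite count_uniq_mem ?uniq_roots //.
  have := ro (d p); rewrite inE /= => <-.
  by rewrite ec' root_prod_XsubC map_f // mem_enum.
- apply: (@complexI R); rewrite rmorph_prod -hd /A det_map_mx //.
Qed.

Lemma nu_minus_neg n (S : 'M[R]_n) : S^T = S ->
  neg_le (mxC S) (nu_minus S) /\ neg_ge (mxC S) (nu_minus S).
Proof.
move=> /nu_minus_diag [P [d [uP hP -> _]]]; split; first exact: dform_neg_le hP.
by apply: strong_neg_ge; have [V [e h]] := dform_neg_ge uP hP; exists V, e.
Qed.

Lemma nu_minus_opp_le n (S : 'M[R]_n) : S^T = S ->
  (nu_minus S + nu_minus (- S) <= n)%N.
Proof.
move=> sS; have [_ h1] := nu_minus_neg sS.
have sN : (- S)^T = - S by rewrite linearN /= sS.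
have [_ h2] := nu_minus_neg sN.
rewrite -[leqRHS]card_ord; apply: neg_opp_card h1 _.
by apply: eq_neg_ge h2 => i j; rewrite /mxC mxE rmorphN.
Qed.

Lemma nu_minus_opp_ge n (S : 'M[R]_n) : S^T = S -> \det S != 0 ->
  (n <= nu_minus S + nu_minus (- S))%N.
Proof.
move=> sS d0; have sN : (- S)^T = - S by rewrite linearN /= sS.
have [_ h2] := nu_minus_neg sN.
have [h3 _] := nu_minus_neg sN.
have [P [d [uP hP hn hd]]] := nu_minus_diag sS.
have hN x : quad (mxC (- S)) x = dform P (fun p => - d p) x.
  rewrite (@eq_quad _ _ (fun i j => - mxC S i j) _ x) //; last first.
    by move=> i j; rewrite /mxC mxE rmorphN.
  by rewrite quadN hP /dform -sumrN; apply: eq_bigr => p _; rewrite mulNr.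
have [W [e h4]] := dform_neg_ge uP hN.
have h5 : neg_ge (mxC (- S)) #|[pred p | - d p < 0]| by apply: strong_neg_ge; exists W, e.
rewrite hn -{1}[n]card_ord; apply: leq_trans (leq_add (leqnn _) (neg_ge_le h5 h3)).
rewrite -cardUI; apply: leq_trans (leq_addr _ _); apply: subset_leq_card.
apply/fintype.subsetP => p _; rewrite !inE oppr_lt0.
have : d p != 0.
  by apply: contraNneq d0 => dp; rewrite hd (bigD1 p) //= dp mul0r.
by rewrite neq_lt.
Qed.

(** The form is H pulled back by (x, y) |-> x + U y, plus G on y: replacing x
    by x - U y decouples the two. *)
Lemma block_neg_ge (S T : finType) (H : S -> S -> C) (G : T -> T -> C)
    (U : T -> S -> C) h k : neg_ge H h -> neg_ge G k ->
  let L (s : S + T) := match s with inl a => fun c => (a == c)%:R | inr t => U t end in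
  neg_ge (fun s t : S + T => sform H (L s) (L t) +
     match s, t with inr s, inr t => G s t | _, _ => 0 end) (h + k).
Proof.
move=> [a ha] [b hb] L.
pose V (i : 'I_(h + k)) (s : S + T) := match fintype.split i, s with
  | inl i, inl c => a i c
  | inl i, inr t => 0
  | inr i, inl c => - \sum_t b i t * U t c
  | inr i, inr t => b i t end.
exists V => c c0; set x := comb c V.
pose c1 i := c (lshift k i); pose c2 i := c (rshift h i).
have eV1 i s : V (lshift k i) s = match s with inl c => a i c | inr t => 0 end.
  by rewrite /V -[lshift k i]/(unsplit (inl i)) unsplitK; case: s.
have eV2 i s : V (rshift h i) s =
    match s with inl c => - \sum_t b i t * U t c | inr t => b i t end.
  by rewrite /V -[rshift h i]/(unsplit (inr i)) unsplitK; case: s.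
have x1 q : x (inl q) = comb c1 a q - \sum_t comb c2 b t * U t q.
  rewrite /x /comb big_split_ord /=; congr (_ + _).
    by apply: eq_bigr => i _; rewrite eV1.
  under [in RHS]eq_bigr do rewrite mulr_suml.
  rewrite exchange_big -sumrN; apply: eq_bigr => i _; rewrite eV2 mulrN mulr_sumr.
  by congr (- _); apply: eq_bigr => t _; rewrite mulrA.
have x2 t : x (inr t) = comb c2 b t.
  rewrite /x /comb big_split_ord /= big1 ?add0r; last by move=> i _; rewrite eV1 mulr0.
  by apply: eq_bigr => i _; rewrite eV2.
have pL q : pull L x q = comb c1 a q.
  rewrite /pull big_sumType /= (bigD1 q) //= eqxx mulr1 big1 ?addr0; last first.
    by move=> i /negPf ->; rewrite mulr0.
  by under eq_bigr do rewrite x2; rewrite x1 subrK.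
rewrite quadD -[quad (fun _ _ => sform H _ _) x]/(quad (cong L H) x) quad_cong.
rewrite (eq_quad (fun _ _ => erefl) pL).
have -> : quad (fun s t : S + T => match s, t with inr s, inr t => G s t
   | _, _ => 0 end) x = quad G (comb c2 b).
  rewrite /quad /sform big_sumType /= big1 ?add0r; last first.
    by move=> i _; rewrite big1 // => j _; rewrite !mul0r.
  congr complex.Re; apply: eq_bigr => s _; rewrite big_sumType /= big1 ?add0r.
    by apply: eq_bigr => t _; rewrite !x2.
  by move=> j _; rewrite !mul0r.
have q0 (T' : finType) n (B : T' -> T' -> C) (d : 'I_n -> C) W :
    ~ nonzero d -> quad B (comb d W) = 0.
  move=> nd; rewrite (@eq_quad _ B B _ (fun=> 0)) //.
    by rewrite /quad /sform big1 // => s _; rewrite big1 // => t _; rewrite mulr0 mul0r.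
  move=> t; rewrite /comb big1 // => i _.
  by have [->|di] := eqVneq (d i) 0; rewrite ?mul0r //; case: nd; exists i.
have [n1|n1] := EM (nonzero c1); have [n2|n2] := EM (nonzero c2).
- by have := ha _ n1; have := hb _ n2; lra.
- by have := ha _ n1; rewrite (q0 _ _ G _ _ n2); lra.
- by have := hb _ n2; rewrite (q0 _ _ H _ _ n1); lra.
case: c0 => i0; rewrite -[i0]splitK; case: fintype.split => i /= ci.
  by case: n1; exists i.
by case: n2; exists i.
Qed.

Lemma cvg_near_eq (U : Type) (F : set_system U) {FF : Filter F} (f g : U -> C) (a : C) :
  (\forall u \near F, f u = g u) ->
  (f u : C^o) @[u --> F] --> (a : C^o) -> (g u : C^o) @[u --> F] --> (a : C^o).
Proof. by move=> e h A hA; have := h A hA; exact: (near_eq_cvg e). Qed.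

Lemma cvg_conj (U : Type) (F : set_system U) {FF : Filter F} (f : U -> C) (a : C) :
  (f u : C^o) @[u --> F] --> (a : C^o) -> ((f u)^* : C^o) @[u --> F] --> (a^* : C^o).
Proof.
move=> /(@cvgrPdist_lt _ C^o) h; apply/(@cvgrPdist_lt _ C^o) => e /h; apply: filterS => u.
by rewrite -rmorphB /= normcJ.
Qed.

Lemma cvg_form2 (U : Type) (F : set_system U) {FF : Filter F} (T : finType)
    (A : T -> T -> C) (x y : U -> T -> C) (x0 y0 : T -> C) :
  (forall s, (x u s : C^o) @[u --> F] --> (x0 s : C^o)) ->
  (forall s, (y u s : C^o) @[u --> F] --> (y0 s : C^o)) ->
  (sform A (x u) (y u) : C^o) @[u --> F] --> (sform A x0 y0 : C^o).
Proof.
move=> hx hy; apply: cvg_sumC => s; apply: cvg_sumC => t.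
apply: cvgM; last by apply: cvg_conj; exact: hy.
by apply: cvgM; [exact: cvg_cst|exact: hx].
Qed.

Lemma sform_sumType (S T : finType) (A : S + T -> S + T -> C) x y :
  sform A x y =
    (\sum_s \sum_s' A (inl s) (inl s') * x (inl s) * (y (inl s'))^* +
     \sum_s \sum_t A (inl s) (inr t) * x (inl s) * (y (inr t))^*) +
    (\sum_t \sum_s A (inr t) (inl s) * x (inr t) * (y (inl s))^* +
     \sum_t \sum_t' A (inr t) (inr t') * x (inr t) * (y (inr t'))^*).
Proof.
rewrite /sform big_sumType /=; congr (_ + _); rewrite -big_split /=;
  by apply: eq_bigr => s _; rewrite big_sumType.
Qed.

Lemma sform_ll (S T : finType) (A : S + T -> S + T -> C) x y :
  (forall t, x (inr t) = 0) -> (forall t, y (inr t) = 0) ->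
  sform A x y = \sum_s \sum_s' A (inl s) (inl s') * x (inl s) * (y (inl s'))^*.
Proof.
move=> hx hy; rewrite sform_sumType [X in _ + X]addrC -!addrA -[RHS]addr0.
congr (_ + _); rewrite big1 ?add0r; last first.
  by move=> s _; rewrite big1 // => t _; rewrite hy rmorph0 mulr0.
rewrite big1 ?add0r; last by move=> s _; rewrite big1 // => t _; rewrite hx mulr0 mul0r.
by rewrite big1 // => s _; rewrite big1 // => t _; rewrite hx mulr0 mul0r.
Qed.

Lemma sform_lr (S T : finType) (A : S + T -> S + T -> C) x y :
  (forall t, x (inr t) = 0) -> (forall t, y (inl t) = 0) ->
  sform A x y = \sum_s \sum_t A (inl s) (inr t) * x (inl s) * (y (inr t))^*.
Proof.
move=> hx hy; rewrite sform_sumType [X in X + _]addrC -!addrA -[RHS]addr0.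
congr (_ + _); rewrite big1 ?add0r; last first.
  by move=> s _; rewrite big1 // => t _; rewrite hy rmorph0 mulr0.
rewrite big1 ?add0r; last by move=> s _; rewrite big1 // => t _; rewrite hx mulr0 mul0r.
by rewrite big1 // => s _; rewrite big1 // => t _; rewrite hx mulr0 mul0r.
Qed.

Lemma sform_rr (S T : finType) (A : S + T -> S + T -> C) x y :
  (forall t, x (inl t) = 0) -> (forall t, y (inl t) = 0) ->
  sform A x y = \sum_s \sum_t A (inr s) (inr t) * x (inr s) * (y (inr t))^*.
Proof.
move=> hx hy; rewrite sform_sumType addrA [LHS]addrC -[RHS]addr0.
congr (_ + _); rewrite big1 ?add0r; last first.
  by move=> s _; rewrite big1 // => t _; rewrite hx mulr0 mul0r.
rewrite big1 ?add0r; last by move=> s _; rewrite big1 // => t _; rewrite hx mulr0 mul0r.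
by rewrite big1 // => s _; rewrite big1 // => t _; rewrite hy rmorph0 mulr0.
Qed.

(** The coefficients are added up at coinciding points, so p need not be
    injective. *)
Definition spread (m : nat) (T : finType) (p : 'I_m -> T) (c : 'I_m -> C) : T -> C :=
  pull (fun i t => (p i == t)%:R) c.

Lemma sform_spread (T : finType) m m' (A : T -> T -> C) (p : 'I_m -> T) c
    (p' : 'I_m' -> T) c' :
  sform A (spread p c) (spread p' c') =
  \sum_i \sum_j c i * (c' j)^* * A (p i) (p' j).
Proof.
rewrite form_suml; apply: eq_bigr => i _; rewrite form_sumr mulr_sumr.
by apply: eq_bigr => j _; rewrite form_delta mulrA.
Qed.

End Forms.

(** * Real polynomials at complex points *)

Section EvalC.
Variable R : realType.
Local Notation C := R[i].
Implicit Types p q : {poly R}.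

Lemma evalC_coef p n (z : C) : (size p <= n)%N ->
  evalC p z = \sum_(i < n) (p`_i)%:C * z ^+ i.
Proof.
move=> le; rewrite /evalC (@horner_coef_wide _ n) ?size_map_poly //.
by apply: eq_bigr => i _; rewrite coef_map.
Qed.

Lemma evalCD p q (z : C) : evalC (p + q) z = evalC p z + evalC q z.
Proof. by rewrite /evalC rmorphD hornerD. Qed.
Lemma evalCN p (z : C) : evalC (- p) z = - evalC p z.
Proof. by rewrite /evalC rmorphN hornerN. Qed.
Lemma evalCM p q (z : C) : evalC (p * q) z = evalC p z * evalC q z.
Proof. by rewrite /evalC rmorphM hornerM. Qed.
Lemma evalCC (a : R) (z : C) : evalC a%:P z = a%:C.
Proof. by rewrite /evalC map_polyC hornerC. Qed.
Lemma evalCX (z : C) : evalC 'X z = z.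
Proof. by rewrite /evalC map_polyX hornerX. Qed.
Lemma evalCXn n (z : C) : evalC 'X^n z = z ^+ n.
Proof. by rewrite /evalC map_polyXn hornerXn. Qed.
Lemma evalC_conj p (z : C) : (evalC p z)^* = evalC p z^*.
Proof.
rewrite !(evalC_coef _ (leqnn _)) rmorph_sum; apply: eq_bigr => i _.
by rewrite rmorphM rmorphXn /= cconj_real.
Qed.

(** The Bezoutian of a polynomial against 1 is the Hankel form of its
    coefficients. This is how Hankel matrices enter the kernels. *)
Lemma bezout_hankel p d (z w : C) : (size p <= d.+1)%N ->
  evalC p z - evalC p w =
  (z - w) * \sum_(i < d) \sum_(j < d) (p`_(i + j).+1)%:C * z ^+ i * w ^+ j.
Proof.
move=> le; pose a i j : C := (p`_(i + j))%:C * z ^+ i * w ^+ j.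
have a0 i j : (d < i + j)%N -> a i j = 0.
  by move=> h; rewrite /a nth_default ?mul0r //; apply: leq_trans h.
transitivity (\sum_(i < d) \sum_(j < d) (a i.+1 j - a i j.+1)); last first.
  rewrite mulr_sumr; apply: eq_bigr => i _; rewrite mulr_sumr; apply: eq_bigr => j _.
  by rewrite /a addSn addnS !exprS; ring.
under eq_bigr => i _ do rewrite sumrB.
rewrite sumrB exchange_big /=.
have e1 : \sum_(j < d) \sum_(i < d) a i.+1 j = \sum_(j < d) \sum_(i < d) a i j +
    \sum_(j < d) a d j - \sum_(j < d) a 0%N j.
  rewrite -!big_split -sumrB /=; apply: eq_bigr => j _.
  by rewrite -(big_ord_recr d (fun i => a i j)) big_ord_recl /= addrAC subrr add0r.
have e2 : \sum_(j < d) \sum_(i < d) a j i.+1 = \sum_(j < d) \sum_(i < d) a j i +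
    \sum_(j < d) a j d - \sum_(j < d) a j 0%N.
  rewrite -!big_split -sumrB /=; apply: eq_bigr => j _.
  by rewrite -(big_ord_recr d (fun i => a j i)) big_ord_recl /= addrAC subrr add0r.
rewrite e1 e2 [\sum_(j < d) \sum_(i < d) a j i]exchange_big /=.
have e3 : \sum_(j < d) a d j - \sum_(j < d) a j d = a d 0%N - a 0%N d.
  case: d le a0 {e1 e2} => [|d] le a0; first by rewrite !big_ord0 /a !subrr.
  rewrite !big_ord_recl !big1 ?addr0 // => i _; apply: a0; rewrite /= /bump; lia.
have e4 (x : C) : \sum_(j < d) (p`_j)%:C * x ^+ j = evalC p x - (p`_d)%:C * x ^+ d.
  by rewrite (evalC_coef _ le) big_ord_recr /= addrK.
have e5 : \sum_(j < d) a 0%N j = evalC p w - (p`_d)%:C * w ^+ d.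
  by rewrite -e4 //; apply: eq_bigr => j _; rewrite /a expr0 mulr1.
have e6 : \sum_(j < d) a j 0%N = evalC p z - (p`_d)%:C * z ^+ d.
  by rewrite -e4 //; apply: eq_bigr => j _; rewrite /a expr0 addn0 mulr1.
rewrite e5 e6; move: e3; rewrite /a !expr0 addn0 add0n !mulr1 => e3.
by move/eqP: e3; rewrite subr_eq => /eqP ->; ring.
Qed.
End EvalC.

(** * Kernels of sphere-valued functions *)

Section Kernels.
Variable R : realType.
Local Notation C := R[i].
Local Notation V2 := (C * C)%type.

(** The Nevanlinna kernel of u / v, multiplied by v z and by the conjugate of
    v w. It is defined at poles as well, and another choice of coordinates
    only rescales it. *)
Definition ker (X : C -> V2) (z w : C) : C :=
  ((X z).1 * ((X w).2)^* - (X z).2 * ((X w).1)^*) / (z - w^*).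

Definition gram (K : C -> C -> C) (T : Type) (pts : T -> C) : T -> T -> C :=
  fun s t => K (pts s) (pts t).

(** All points of the upper half-plane are admitted, including those where the
    function is infinite. *)
Definition idx_le (K : C -> C -> C) (k : nat) : Prop :=
  forall (T : finType) (pts : T -> C), (forall t, upper (pts t)) ->
    neg_le (gram K pts) k.

Definition idx_ge (K : C -> C -> C) (k : nat) : Prop :=
  exists (T : finType) (pts : T -> C), (forall t, upper (pts t)) /\
    neg_ge (gram K pts) k.

Lemma upper_sub_neq0 (z w : C) : upper z -> upper w -> z - w^* != 0.
Proof.
rewrite /upper /= => hz hw; rewrite eq_complex /= negb_and; apply/orP; right.
rewrite cImD cImN cIm_conj opprK gt_eqF // addr_gt0 //.
Qed.

Lemma idx_ge_le K a b : idx_ge K a -> idx_le K b -> (a <= b)%N.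
Proof. by case=> T [pts [hp h]] /(_ T pts hp); exact: neg_ge_le. Qed.

Lemma idx_leD K1 K2 a b : idx_le K1 a -> idx_le K2 b ->
  idx_le (fun z w => K1 z w + K2 z w) (a + b).
Proof. by move=> h1 h2 T pts hp; apply: neg_leD; [exact: h1|exact: h2]. Qed.

Lemma eq_idx_le K1 K2 a :
  (forall z w, upper z -> upper w -> K1 z w = K2 z w) -> idx_le K1 a -> idx_le K2 a.
Proof. by move=> e h T pts hp; apply: eq_neg_le (h _ _ hp) => s t; apply: e. Qed.

Lemma eq_idx_ge K1 K2 a :
  (forall z w, upper z -> upper w -> K1 z w = K2 z w) -> idx_ge K1 a -> idx_ge K2 a.
Proof.
move=> e [T [pts [hp h]]]; exists T, pts; split=> //.
by apply: eq_neg_ge h => s t; apply: e.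
Qed.

Lemma cong_scale (T : finType) (A : T -> T -> C) (c : T -> C) s t :
  cong (fun s t => c s * (s == t)%:R) A s t = c s * (c t)^* * A s t.
Proof.
rewrite /cong /sform (bigD1 s) //= (bigD1 t) //= !eqxx !mulr1.
rewrite big1 ?addr0; last first.
  by move=> j /negPf; rewrite eq_sym => ->; rewrite mulr0 rmorph0 mulr0.
rewrite big1 ?addr0; last first.
  by move=> i /negPf; rewrite eq_sym => ->; rewrite big1 // => j _; rewrite !mulr0 mul0r.
by ring.
Qed.

Lemma idx_le_scale K (c : C -> C) a :
  idx_le K a -> idx_le (fun z w => c z * (c w)^* * K z w) a.
Proof.
move=> h T pts hp.
apply: eq_neg_le (neg_le_cong (fun s t => c (pts s) * (s == t)%:R) (h _ _ hp)).
by move=> s t; rewrite cong_scale.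
Qed.

Lemma idx_ge_scale K (c : C -> C) a : (forall z, upper z -> c z != 0) ->
  idx_ge K a -> idx_ge (fun z w => c z * (c w)^* * K z w) a.
Proof.
move=> c0 [T [pts [hp h]]]; exists T, pts; split=> //.
apply: (@neg_ge_cong _ _ _ (fun s t => (c (pts s))^-1 * (s == t)%:R)).
apply: eq_neg_ge h => s t; rewrite cong_scale /gram.
have h1 := c0 _ (hp s); have h2 : (c (pts t))^* != 0 by rewrite conjC_eq0 c0.
by rewrite [X in _ * X * _](cconjV (c (pts t))); field; rewrite h1 h2.
Qed.

Lemma herm_ker (X : C -> V2) z w : ker X w z = (ker X z w)^*.
Proof.
rewrite /ker rmorphM /= cconjV !rmorphB !rmorphM /= !conjCK.
rewrite -[w - _]opprB invrN mulrN -mulNr opprB.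
by congr (_ * _); rewrite [X in _ - X]mulrC [X in X - _]mulrC.
Qed.

Lemma herm_gram (X : C -> V2) (T : Type) (pts : T -> C) : herm (gram (ker X) pts).
Proof. by move=> s t; exact: herm_ker. Qed.

Lemma idx_le_rank (d : nat) (H : 'I_d -> 'I_d -> C) (phi : C -> 'I_d -> C) h :
  neg_le H h -> idx_le (fun z w => sform H (phi z) (phi w)) h.
Proof. by move=> hH T pts hp; exact: neg_le_cong. Qed.

Lemma idx_le0 X : (forall z, (X z).2 = 0) -> idx_le (ker X) 0.
Proof.
move=> e T pts hp; exists (fun _ _ => 0) => x _.
rewrite /quad /sform big1 // => s _; rewrite big1 // => t _.
by rewrite /gram /ker !e rmorph0 mulr0 mul0r subrr !mul0r.
Qed.

(** On u / v = f this is 1 / (- p + 1 / f). *)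
Definition shear (p : {poly R}) (X : C -> V2) : C -> V2 :=
  fun z => ((X z).1, (X z).2 - evalC p z * (X z).1).

Definition swap (X : C -> V2) : C -> V2 := fun z => ((X z).2, - (X z).1).

Lemma ker_swap X z w : ker (swap X) z w = ker X z w.
Proof. by rewrite /ker /= rmorphN /=; congr (_ / _); ring. Qed.

(** The contribution of a shear by p to the kernel, by bezout_hankel. *)
Definition bez (p : {poly R}) d (X : C -> V2) (z w : C) : C :=
  sform (mxC (hankel_plus p d)) (fun i => (X z).1 * z ^+ i) (fun i => (X w).1 * w ^+ i).

Lemma ker_shear (p : {poly R}) d X z w : (size p <= d.+1)%N -> upper z -> upper w ->
  ker (shear p X) z w = bez p d X z w + ker X z w.
Proof.
move=> le hz hw; have n0 := upper_sub_neq0 hz hw.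
have -> : bez p d X z w = (X z).1 * ((X w).1)^* * ((evalC p z - evalC p (w^*)) / (z - w^*)).
  rewrite (bezout_hankel _ _ le) [_ * _ / _]mulrC mulKf // /bez /sform mulr_sumr.
  apply: eq_bigr => i _; rewrite mulr_sumr; apply: eq_bigr => j _.
  by rewrite /mxC mxE rmorphM rmorphXn /=; ring.
by rewrite /ker /= rmorphB rmorphM /= evalC_conj; field.
Qed.

Lemma shear_le (p : {poly R}) d X h k : (size p <= d.+1)%N ->
  neg_le (mxC (hankel_plus p d)) h -> idx_le (ker X) k ->
  idx_le (ker (shear p X)) (h + k).
Proof.
move=> le hh hk.
apply: (@eq_idx_le (fun z w => bez p d X z w + ker X z w)).
  by move=> z w hz hw; rewrite (ker_shear _ le).
apply: idx_leD => //.
exact: (idx_le_rank (fun z i => (X z).1 * z ^+ i) hh).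
Qed.

(** The inverse of the Vandermonde matrix. *)
Lemma dual_monomials d (c : 'I_d -> C) : injective c ->
  exists W : 'I_d -> 'I_d -> C, forall a b : 'I_d, \sum_i W a i * c i ^+ b = (a == b)%:R.
Proof.
move=> inj; pose M := (Vandermonde d (\row_i c i))^T.
have uM : M \in unitmx.
  rewrite unitmx_tr unitmxE unitfE det_Vandermonde.
  apply/prodf_neq0 => i _; apply/prodf_neq0 => j ij; rewrite !mxE subr_eq0.
  by apply: contraTneq ij => /inj ->; rewrite ltnn.
exists (fun a i => invmx M a i) => a b.
have /matrixP /(_ a b) := mulVmx uM; rewrite !mxE => <-.
by apply: eq_bigr => i _; rewrite !mxE.
Qed.

(** The Cauchy matrix is nonsingular: cleared of denominators, a relation
    between its rows is a polynomial of degree less than k with k roots. *)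
Lemma cauchy_kernel k (z w : 'I_k -> C) (xi : 'I_k -> C) :
  injective z -> injective w -> (forall i, upper (z i)) -> (forall i, upper (w i)) ->
  (forall j, \sum_i xi i / (z i - (w j)^*) = 0) -> forall i, xi i = 0.
Proof.
move=> iz iw uz uw h i0.
pose P := \sum_i xi i *: \prod_(j | j != i) ((z j)%:P - 'X).
have sP : (size P <= k)%N.
  apply: leq_trans (size_sum _ _ _) _; apply/bigmax_leqP => i _.
  apply: leq_trans (size_scale_leq _ _) _.
  apply: leq_trans (size_prod_leq _ _) _.
  rewrite (eq_bigr (fun=> 2%N)); last first.
    by move=> j _; rewrite -opprB size_polyN size_XsubC.
  rewrite sum_nat_const cardC1 card_ord; have := ltn_ord i; lia.
have rP j : root P (w j)^*.
  apply/rootP; rewrite /P horner_sum.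
  transitivity ((\prod_i (z i - (w j)^*)) * \sum_i xi i / (z i - (w j)^*)); last by rewrite h mulr0.
  rewrite mulr_sumr; apply: eq_bigr => i _; rewrite hornerZ horner_prod.
  rewrite (bigD1 i (P := xpredT)) //= mulrCA -!mulrA; congr (_ * _).
  rewrite mulrC mulfVK ?upper_sub_neq0 //.
  by apply: eq_bigr => l _; rewrite hornerD hornerN hornerC hornerX.
have P0 : P = 0.
  apply: (@roots_geq_poly_eq0 _ _ [seq (w j)^* | j <- enum 'I_k]).
  - by apply/allP => _ /mapP [j _ ->]; exact: rP.
  - rewrite map_inj_uniq ?enum_uniq // => a b e; apply: iw.
    by rewrite -[LHS]conjCK e conjCK.
  - by rewrite size_map size_enum_ord.
have : P.[z i0] = 0 by rewrite P0 horner0.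
rewrite /P horner_sum (bigD1 i0) //= [X in _ + X]big1 ?addr0; last first.
  move=> i ii; rewrite hornerZ horner_prod (bigD1 i0) ?(eq_sym i0) //=.
  by rewrite hornerD hornerN hornerC hornerX subrr mul0r mulr0.
rewrite hornerZ => /eqP; rewrite mulf_eq0 => /orP[/eqP//|].
rewrite horner_prod => /eqP e; exfalso; move/eqP: e; apply/negP.
apply/prodf_neq0 => j ji; rewrite hornerD hornerN hornerC hornerX subr_eq0.
by rewrite (inj_eq iz).
Qed.

(** * Growth along the imaginary axis *)

Definition imag (y : R) : C := 0 +i* y.

Lemma imagM a y : imag (a * y) = imag a * y%:C.
Proof. by rewrite /imag; simpc. Qed.
Lemma imagD a y : imag (a + y) = imag a + imag y.
Proof. by rewrite /imag; simpc. Qed.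
Lemma imagMM a b : imag a * imag b = - (a * b)%:C.
Proof.
apply/eqP; rewrite eq_complex /=.
by rewrite !mul0r !mulr0 sub0r addr0 oppr0 !eqxx.
Qed.
Lemma conj_imag a : (imag a)^* = - imag a.
Proof. by rewrite /imag /=; simpc. Qed.
Lemma imag_eq0 a : (imag a == 0) = (a == 0).
Proof. by rewrite /imag eq_complex /= eqxx. Qed.

(** v / u = o(y) at iy: the growth condition on the parameter, in homogeneous
    coordinates. *)
Definition slow (X : C -> V2) : Prop :=
  (\forall y \near +oo, (X (imag y)).1 != 0) /\
  ((X (imag y)).2 / (X (imag y)).1 / y%:C : C^o) @[y --> +oo] --> (0 : C^o).

Lemma cvg_invC : ((y^-1)%:C : C^o) @[y --> +oo] --> (0 : C^o).
Proof.
apply/(@cvgrPdist_lt _ C^o) => e; case: e => e e' /=; rewrite ltcE /= => /andP[/eqP -> e0].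
near=> y.
rewrite sub0r normrN -[`|_|]/((normc _)%:C) ltcR normc_real.
have y0 : 0 < y by near: y; exact: nbhs_pinfty_gt.
rewrite ger0_norm ?invr_ge0 ?ltW // invf_plt //.
near: y; apply: nbhs_pinfty_gt; by rewrite num_real.
Unshelve. all: by end_near.
Qed.

Lemma cvg_invXC a : ((y^-1)%:C ^+ a : C^o) @[y --> +oo] --> (0 ^+ a : C^o).
Proof.
elim: a => [|a IH].
  by apply: (cvg_near_eq (f := fun=> 1)); [near=> y; rewrite expr0|exact: cvg_cst].
rewrite exprS; apply: (cvg_near_eq (f := fun y => (y^-1)%:C * (y^-1)%:C ^+ a)).
  by near=> y; rewrite exprS.
by apply: cvgM; [exact: cvg_invC|exact: IH].
Unshelve. all: by end_near.
Qed.

Lemma near_scale (c : R) (P : R -> Prop) : 0 < c ->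
  (\forall y \near +oo, P y) -> \forall y \near +oo, P (c * y).
Proof.
move=> c0 h; have := @gt0_cvgMry R (+oo) _ c id c0 cvg_id; exact.
Qed.

Lemma cvg_comp_scale (c : R) (f : R -> C) (a : C) : 0 < c ->
  (f y : C^o) @[y --> +oo] --> (a : C^o) -> (f (c * y) : C^o) @[y --> +oo] --> (a : C^o).
Proof.
move=> c0 h; apply: (cvg_comp (fun y => c * y) f (G := +oo)) => //.
by apply: gt0_cvgMry => //; exact: cvg_id.
Qed.

Lemma cvg_bound (U : Type) (F : set_system U) {FF : Filter F} (e g : U -> C) (M : R) :
  (\forall y \near F, normc (e y) <= M * normc (g y)) ->
  (g y : C^o) @[y --> F] --> (0 : C^o) -> (e y : C^o) @[y --> F] --> (0 : C^o).
Proof.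
move=> he /(@cvgrPdist_lt _ C^o) hg; apply/(@cvgrPdist_lt _ C^o) => -[d d'] /=.
rewrite ltcE /= => /andP[/eqP -> d0].
have M0 : 0 < d / (`|M| + 1) by rewrite divr_gt0 // ltr_wpDl.
have := hg (d / (`|M| + 1))%:C; rewrite ltcR => /(_ M0) hg'.
near=> y; rewrite sub0r normrN -[`|_|]/((normc _)%:C) ltcR.
have h1 : normc (e y) <= M * normc (g y) by near: y.
have h2 : normc (g y) < d / (`|M| + 1).
  by near: y; apply: filterS hg' => y; rewrite sub0r normrN -[`|_|]/((normc _)%:C) ltcR.
apply: le_lt_trans h1 _; apply: (@le_lt_trans _ _ ((`|M|) * normc (g y))).
  by rewrite ler_wpM2r ?normc_ge0 // ler_norm.
apply: (@le_lt_trans _ _ (`|M| * (d / (`|M| + 1)))).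
  by rewrite ler_wpM2l ?normr_ge0 // ltW.
rewrite mulrA ltr_pdivrMr ?ltr_wpDl // mulrDr mulr1 mulrC ltrDl //.
Unshelve. all: by end_near.
Qed.

(** * Lower bounds for the index *)

(** The kernel functions at points where X is infinite are isotropic and
    pairwise orthogonal, and a Cauchy matrix pairs them with those at points
    where X is finite. With k + 1 points of each kind this makes k + 1
    negative squares. *)
Lemma few_infinite X k : idx_le (ker X) k ->
  forall z w : 'I_k.+1 -> C, injective z -> injective w ->
  (forall i, upper (z i)) -> (forall i, upper (w i)) ->
  (forall i, (X (z i)).2 = 0) -> (forall i, (X (z i)).1 != 0) ->
  ~ (forall i, (X (w i)).2 != 0).
Proof.
move=> hk z w iz iw uz uw z2 z1 w2.
pose T := ('I_k.+1 + 'I_k.+1)%type.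
pose pts (t : T) := match t with inl i => z i | inr i => w i end.
have up t : upper (pts t) by case: t.
pose B : 'M[C]_k.+1 := \matrix_(i, j) ker X (z i) (w j).
have uB : B \in unitmx.
  rewrite -row_free_unit -kermx_eq0; apply/negPn/negP => /rowV0Pn [v vB].
  case/rV0Pn => i; apply/negP; rewrite negbK.
  have : v 0 i * (X (z i)).1 = 0.
    apply: (@cauchy_kernel _ z w (fun i => v 0 i * (X (z i)).1)) => // j.
    have /sub_kermxP /matrixP /(_ 0 j) := vB; rewrite !mxE => e.
    apply: (mulIf (x := ((X (w j)).2)^*)); first by rewrite conjC_eq0.
    rewrite mul0r -[RHS]e mulr_suml; apply: eq_bigr => l _.
    by rewrite mxE /ker z2 mul0r subr0; ring.
  by move/eqP; rewrite mulf_eq0 (negPf (z1 i)) orbF.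
pose W := invmx B.
have uWB i j : \sum_l W i l * B l j = (i == j)%:R.
  by have /matrixP /(_ i j) := mulVmx uB; rewrite !mxE.
pose Y (y : R) (i : 'I_k.+1) (t : T) : C := match t with
  | inl l => - y%:C * W i l | inr j => (y^-1)%:C * (i == j)%:R end.
(* as y tends to infinity, the Gram matrix of the vectors - y W e_z + y^-1 e_w
   tends to -2 times the identity *)
have lim i j : (cong (Y y) (gram (ker X) pts) i j : C^o) @[y --> +oo] -->
    (- 2 * (i == j)%:R : C^o).
  have e : \forall y \near +oo, - 2 * (i == j)%:R +
      (y^-1)%:C * (y^-1)%:C * ker X (w i) (w j) = cong (Y y) (gram (ker X) pts) i j.
    near=> y; have y0 : y != 0 by rewrite gt_eqF //; near: y; exact: nbhs_pinfty_gt.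
    have yC : y%:C * (y^-1)%:C = 1 :> C by rewrite -rmorphM divff.
    have zw a b : \sum_l \sum_m gram (ker X) pts (inl l) (inr m) * Y y a (inl l) * (Y y b (inr m))^* = - (a == b)%:R.
      rewrite -uWB -sumrN; apply: eq_bigr => l _; rewrite (bigD1 b) //= big1 ?addr0.
        rewrite /gram /= eqxx mulr1 cconj_real /B mxE.
        transitivity (- (y%:C * (y^-1)%:C) * (W a l * ker X (z l) (w b))); first by ring.
        by rewrite yC mulN1r.
      by move=> m /negPf mb; rewrite eq_sym mb mulr0 rmorph0 mulr0.
    rewrite /cong sform_sumType zw big1 ?add0r; last first.
      move=> l _; rewrite big1 // => m _.
      by rewrite /gram /ker /= !z2 rmorph0 mulr0 mul0r subrr !mul0r.
    rewrite /Y.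
    have -> : \sum_s \sum_l gram (ker X) pts (inr s) (inl l) * ((y^-1)%:C * (i == s)%:R) * (- y%:C * W j l)^* = - (i == j)%:R.
      rewrite exchange_big -[RHS]conjCK rmorphN rmorph_nat /= eq_sym -(zw j i) rmorph_sum.
      apply: eq_bigr => l _; rewrite rmorph_sum; apply: eq_bigr => m _ /=.
      rewrite (herm_gram X pts (inl l) (inr m)); move: (gram _ _ _ _) => G.
      by rewrite [in RHS]rmorphM [in RHS]rmorphM /= conjCK; ring.
    have -> : \sum_s \sum_t gram (ker X) pts (inr s) (inr t) * ((y^-1)%:C * (i == s)%:R) * ((y^-1)%:C * (j == t)%:R)^* = (y^-1)%:C * (y^-1)%:C * ker X (w i) (w j).
      rewrite (bigD1 i) //= (bigD1 j) //= big1 ?addr0; last first.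
        by move=> m /negPf mb; rewrite eq_sym mb mulr0 rmorph0 mulr0.
      rewrite big1 ?addr0; last first.
        move=> m /negPf mb; rewrite big1 // => l _.
        by rewrite eq_sym mb !mulr0 mul0r.
      by rewrite /gram /= !eqxx !mulr1 cconj_real; ring.
    by ring.
  apply: (cvg_near_eq e).
  rewrite -[X in _ --> X]addr0; apply: cvgD; first exact: cvg_cst.
  rewrite -[X in _ --> X](mul0r (ker X (w i) (w j))); apply: cvgM; last exact: cvg_cst.
  by rewrite -[X in _ --> X](mul0r 0); apply: cvgM; exact: cvg_invC.
have hneg : neg_ge (fun i j : 'I_k.+1 => - 2 * (i == j)%:R : C) k.+1.
  exists (fun i j => (i == j)%:R) => c c0.
  have -> : quad (fun i j : 'I_k.+1 => - 2 * (i == j)%:R) (comb c (fun i j => (i == j)%:R))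
      = - 2 * \sum_i normc (c i) ^+ 2.
    rewrite /quad /sform Re_sum mulr_sumr; apply: eq_bigr => i _.
    have ec j : comb c (fun i j : 'I_k.+1 => (i == j)%:R) j = c j.
      rewrite /comb (bigD1 j) //= eqxx mulr1 big1 ?addr0 // => l /negPf ->.
      by rewrite mulr0.
    rewrite (bigD1 i) //= big1 ?addr0; last first.
      by move=> l /negPf; rewrite eq_sym => ->; rewrite mulr0 !mul0r.
    rewrite !ec eqxx mulr1 -mulrA mulcJ.
    by rewrite -[in LHS](rmorph_nat (real_complex R)) -rmorphN Re_realM.
  by rewrite nmulr_rlt0 ?sum_sqr_gt0 // oppr_lt0.
have hh : herm (fun i j : 'I_k.+1 => - 2 * (i == j)%:R : C).
  by move=> i j; rewrite rmorphM rmorphN !rmorph_nat eq_sym.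
have [y hy] := filter_ex (neg_ge_near hh lim hneg).
by have := neg_ge_le (neg_ge_cong hy) (hk T pts up); rewrite ltnn.
Unshelve. all: by end_near.
Qed.

(** The upper bound shear_le is attained if X is slow. At the points i y, 2 i
    y, ... there are combinations of kernel functions that are dual to the
    monomials in the Bezout part, while their Gram matrix for ker X tends to 0
    as y grows. Together with fixed points they have a limit form to which
    block_neg_ge applies. *)
Lemma shear_ge (p : {poly R}) d X h k : (size p <= d.+1)%N -> slow X ->
  neg_ge (mxC (hankel_plus p d)) h -> idx_ge (ker X) k ->
  idx_ge (ker (shear p X)) (h + k).
Proof.
move=> le [X1 hX] hh [T [pts [hp hk]]].
pose ci (i : 'I_d) : C := imag i.+1%:R.
have ci_inj : injective ci.
  move=> i j /eqP; rewrite /ci eq_complex /= eqxx /= eqr_nat eqSS => /eqP.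
  exact: val_inj.
have [W hW] := dual_monomials ci_inj.
pose z (y : R) (i : 'I_d) : C := imag (i.+1%:R * y).
have zE y i : z y i = ci i * y%:C by rewrite /z imagM.
pose P y (t : 'I_d + T) := match t with inl i => z y i | inr t => pts t end.
(* column inl a is the combination dual to the monomial of degree a at the
   points z y i = y ci i, whence the power of y *)
pose E y (s : 'I_d + T) (t : 'I_d + T) : C := match s, t with
  | inl a, inl i => W a i * (y^-1)%:C ^+ a / (X (z y i)).1
  | inr s, inr t => (s == t)%:R
  | _, _ => 0 end.
pose U (t : T) (i : 'I_d) : C := (X (pts t)).1 * pts t ^+ i.
pose L (s : 'I_d + T) := match s with
  | inl a => fun c => (a == c)%:R | inr t => U t end.
pose M0 (s t : 'I_d + T) : C := match s, t with
  | inr s, inr t => gram (ker X) pts s t | _, _ => 0 end.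
pose M s t := sform (mxC (hankel_plus p d)) (L s) (L t) + M0 s t.
have gM : neg_ge M (h + k) by exact: block_neg_ge.
have hM0 : herm M0 by move=> [s|s] [t|t]; rewrite /= ?rmorph0 // herm_gram.
have hM : herm M.
  move=> s t; rewrite /M rmorphD hM0; congr (_ + _).
  apply: (herm_cong L) => i j; rewrite /mxC cconj_real !mxE.
  by rewrite addnC.
have c0 (i : 'I_d) : (0 : R) < i.+1%:R by rewrite ltr0n.
have near_u : \forall y \near +oo, forall i, (X (z y i)).1 != 0.
  by apply: filter_forall => i; exact: (near_scale (c0 i) X1).
have near_up : \forall y \near +oo, forall t, upper (P y t) /\
     forall i, (X (z y i)).1 != 0.
  near=> y => t; split; last by near: y.
  case: t => [i|t]; last exact: hp.
  rewrite /upper /= mulr_gt0 //; near: y; exact: nbhs_pinfty_gt.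
pose g y i : C := (X (z y i)).2 / (X (z y i)).1 / y%:C.
have lim_g i : (g y i : C^o) @[y --> +oo] --> (0 : C^o).
  rewrite -[X in _ --> X](mulr0 (i.+1%:R%:C : C)).
  apply: (cvg_near_eq (f := fun y => i.+1%:R%:C * ((X (imag (i.+1%:R * y))).2 /
     (X (imag (i.+1%:R * y))).1 / (i.+1%:R * y)%:C))); last first.
    apply: cvgM; [exact: cvg_cst|exact: (cvg_comp_scale (c0 i) hX)].
  near=> y.
  have y0 : y%:C != 0 :> C.
    by rewrite fmorph_eq0 gt_eqF //; near: y; exact: nbhs_pinfty_gt.
  have hu : forall i, (X (z y i)).1 != 0 by near: y.
  have i0 : (i.+1%:R)%:C != 0 :> C by rewrite fmorph_eq0 gt_eqF.
  have e (q a b : C) : q != 0 -> b != 0 -> q * (a / (q * b)) = a / b.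
    by move=> q0 b0; field; rewrite b0 q0.
  by rewrite /g /z rmorphM /= e.
have lim_p a := cvg_invXC a.
have lim_lr a t : (cong (E y) (gram (ker X) (P y)) (inl a) (inr t) : C^o)
    @[y --> +oo] --> (0 : C^o).
  have e : \forall y \near +oo, \sum_i W a i * ((y^-1)%:C ^+ a *
       ((((X (pts t)).2)^* * (y^-1)%:C - g y i * ((X (pts t)).1)^*) *
        (imag i.+1%:R - (pts t)^* * (y^-1)%:C)^-1)) =
     cong (E y) (gram (ker X) (P y)) (inl a) (inr t).
    near=> y.
    have y0 : y%:C != 0 :> C.
      by rewrite fmorph_eq0 gt_eqF //; near: y; exact: nbhs_pinfty_gt.
    have hu : forall t, upper (P y t) /\ forall i, (X (z y i)).1 != 0 by near: y.
    rewrite /cong sform_lr //=.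
    apply: eq_bigr => i _; rewrite (bigD1 t) //= eqxx big1 ?addr0; last first.
      by move=> j /negPf; rewrite eq_sym => ->; rewrite rmorph0 mulr0.
    have n0 : z y i - (pts t)^* != 0 by apply: upper_sub_neq0 => //; case: (hu (inl i)).
    have [_ u0] := hu (inl i); have := u0 i => {}u0.
    have -> : imag i.+1%:R - (pts t)^* * (y^-1)%:C = (z y i - (pts t)^*) * (y^-1)%:C.
      by rewrite zE /ci mulrBl -mulrA -rmorphM mulfV ?mulr1 // -(fmorph_eq0 (real_complex R)).
    rewrite /gram /ker /= /g rmorph1 mulr1 fmorphV /=; field.
    by rewrite n0 u0 y0.
  apply: (cvg_near_eq e); rewrite -[X in _ --> X](_ : \sum_(i < d) 0 = 0); last by rewrite big1.
  apply: cvg_sumC => i; rewrite -[X in _ --> X](mulr0 (W a i)).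
  apply: cvgM; first exact: cvg_cst.
  rewrite -[X in _ --> X](mulr0 (0 ^+ a)); apply: cvgM; first exact: lim_p.
  rewrite -[X in _ --> X](mul0r (imag i.+1%:R - (pts t)^* * 0)^-1); apply: cvgM.
    rewrite -[X in _ --> X](_ : ((X (pts t)).2)^* * 0 - 0 * ((X (pts t)).1)^* = 0);
      last by rewrite mulr0 mul0r subrr.
    apply: cvgB; apply: cvgM; try exact: cvg_cst; [exact: cvg_invC|exact: lim_g].
  apply: cvgV; first by rewrite mulr0 subr0 imag_eq0 gt_eqF.
  apply: cvgB; first exact: cvg_cst.
  by apply: cvgM; [exact: cvg_cst|exact: cvg_invC].
have lim_ll a b : (cong (E y) (gram (ker X) (P y)) (inl a) (inl b) : C^o)
    @[y --> +oo] --> (0 : C^o).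
  have e : \forall y \near +oo, \sum_i \sum_j W a i * (W b j)^* / imag (i.+1%:R + j.+1%:R) *
       ((y^-1)%:C ^+ a * (y^-1)%:C ^+ b * ((g y j)^* - g y i)) =
     cong (E y) (gram (ker X) (P y)) (inl a) (inl b).
    near=> y.
    have y0 : y%:C != 0 :> C.
      by rewrite fmorph_eq0 gt_eqF //; near: y; exact: nbhs_pinfty_gt.
    have hu : forall i, (X (z y i)).1 != 0 by near: y.
    rewrite /cong sform_ll //=.
    apply: eq_bigr => i _; apply: eq_bigr => j _; rewrite /gram /ker /=.
    have -> : z y i - (z y j)^* = imag (i.+1%:R + j.+1%:R) * y%:C.
      by rewrite /z conj_imag opprK -imagD -mulrDl imagM.
    have n0 : imag (i.+1%:R + j.+1%:R) != 0 by rewrite imag_eq0 gt_eqF // addr_gt0.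
    have hui := hu i; have huj := hu j; have huj' : ((X (z y j)).1)^* != 0 by rewrite conjC_eq0.
    rewrite /g !rmorphM /= !cconjV !rmorphXn /= !cconj_real fmorphV /=; field.
    by rewrite n0 hui huj' y0.
  apply: (cvg_near_eq e); rewrite -[X in _ --> X](_ : \sum_(i < d) \sum_(j < d) 0 = 0); last first.
    by rewrite big1 // => i _; rewrite big1.
  apply: cvg_sumC => i; apply: cvg_sumC => j.
  rewrite -[X in _ --> X](mulr0 (W a i * (W b j)^* / imag (i.+1%:R + j.+1%:R))).
  apply: cvgM; first exact: cvg_cst.
  rewrite -[X in _ --> X](mulr0 (0 ^+ a * 0 ^+ b)); apply: cvgM.
    by apply: cvgM; exact: lim_p.
  rewrite -[X in _ --> X](_ : 0^* - 0 = 0); last by rewrite rmorph0 subrr.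
  by apply: cvgB; [apply: cvg_conj|]; exact: lim_g.
have lim1 s t : (cong (E y) (gram (ker X) (P y)) s t : C^o) @[y --> +oo] --> (M0 s t : C^o).
  case: s t => [a|s] [b|t] /=; [exact: lim_ll|exact: lim_lr| |].
    rewrite -[X in _ --> X](rmorph0 Num.conj).
    apply: (cvg_near_eq (f := fun y => (cong (E y) (gram (ker X) (P y)) (inl b) (inr s))^*)).
      by near=> y; rewrite -(herm_cong (E y) (herm_gram X (P y))).
    by apply: cvg_conj; exact: lim_lr.
  apply: (cvg_near_eq (f := fun=> gram (ker X) pts s t)); last exact: cvg_cst.
  near=> y; rewrite /cong sform_rr //=.
  by rewrite -[LHS](form_delta (gram (ker X) pts)).
have lim s t : (cong (E y) (gram (ker (shear p X)) (P y)) s t : C^o) @[y --> +oo] --> (M s t : C^o).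
  have e : \forall y \near +oo, sform (mxC (hankel_plus p d)) (L s) (L t) +
      cong (E y) (gram (ker X) (P y)) s t = cong (E y) (gram (ker (shear p X)) (P y)) s t.
    near=> y.
    have hy : forall t, upper (P y t) /\ forall i, (X (z y i)).1 != 0 by near: y.
    have y0 : y != 0 by rewrite gt_eqF //; near: y; exact: nbhs_pinfty_gt.
    pose phi (t : 'I_d + T) (i : 'I_d) := (X (P y t)).1 * P y t ^+ i.
    have -> : cong (E y) (gram (ker (shear p X)) (P y)) s t =
       cong (E y) (cong phi (mxC (hankel_plus p d))) s t + cong (E y) (gram (ker X) (P y)) s t.
      rewrite /cong /sform -big_split; apply: eq_bigr => i _; rewrite -big_split.
      apply: eq_bigr => j _ /=; rewrite -!mulrDl; congr (_ * _ * _).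
      by rewrite /gram (ker_shear _ le) //; case: (hy i) (hy j) => ? _ [].
    congr (_ + _); rewrite [RHS]/cong form_cong.
    have pE u : pull phi (E y u) =1 L u.
      move=> c; rewrite /pull big_sumType /=; case: u => [a|u] /=.
        rewrite [X in _ + X]big1 ?addr0; last by move=> i _; rewrite mul0r.
        rewrite -(hW a c).
        transitivity ((y^-1)%:C ^+ a * (y%:C) ^+ c * \sum_i W a i * ci i ^+ c).
          rewrite mulr_sumr; apply: eq_bigr => i _; rewrite /phi /=.
          have ezc : z y i ^+ c = ci i ^+ c * y%:C ^+ c by rewrite zE exprMn.
          have [_ u0] := hy (inl i); have ui := u0 i.
          by rewrite ezc; field.
        rewrite hW; case: eqVneq => [<-|_]; rewrite ?mulr0 // mulr1.
        by rewrite -exprMn -rmorphM mulVf // rmorph1 expr1n.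
      rewrite big1 ?add0r; last by move=> i _; rewrite mul0r.
      rewrite (bigD1 u) //= eqxx mul1r big1 ?addr0 // => v /negPf.
      by rewrite eq_sym => ->; rewrite mul0r.
    rewrite /sform; apply: eq_bigr => i _; apply: eq_bigr => j _.
    by rewrite !pE.
  apply: (cvg_near_eq e); apply: cvgD; [exact: cvg_cst|exact: lim1].
have [y [/neg_ge_cong hy hu]] := filter_ex (filterI (neg_ge_near hM lim gM) near_up).
by exists ('I_d + T)%type, (P y); split=> // t; have [] := hu t.
Unshelve. all: by end_near.
Qed.

(** Combinations of kernel functions at the points i y, i y / 2, i y / 3, ...
    have Gram matrices that tend to the Hankel matrix: the moment polynomial
    in 1 / z contributes a Bezoutian, and the remainder is negligible since
    the Hankel matrix contains only the moments of index at most 2 n - 2. *)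
Lemma hankel_index_ge (X : C -> V2) (s : seq R) n k :
  (\forall y \near +oo, (X (imag y)).2 != 0) ->
  (((X (imag y)).1 / (X (imag y)).2 +
    \sum_(j < 2 * n - 1) (s`_j)%:C / imag y ^+ j.+1) * imag y ^+ (2 * n - 1) : C^o)
    @[y --> +oo] --> (0 : C^o) ->
  neg_ge (mxC (hankel s n)) k -> idx_ge (ker X) k.
Proof.
set d := (2 * n - 1)%N => hv heps hk.
pose q : {poly R} := \poly_(i < d.+1) (if i is j.+1 then s`_j else 0).
have sq : (size q <= d.+1)%N by exact: size_poly.
have qE (w : C) : evalC q w = \sum_(j < d) (s`_j)%:C * w ^+ j.+1.
  rewrite (evalC_coef _ sq) big_ord_recl coef_poly /= mul0r add0r.
  by apply: eq_bigr => j _; rewrite coef_poly /bump /= add1n ltnS ltn_ord.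
pose H := mxC (hankel_plus q d).
(* up to the factor y, the reciprocals of the points z y i below *)
pose t (i : 'I_n) : C := imag (- i.+1%:R).
have t0 i : t i != 0 by rewrite imag_eq0 oppr_eq0 pnatr_eq0.
have t_inj : injective t.
  move=> i j /eqP; rewrite /t eq_complex /= eqxx /= eqr_opp eqr_nat eqSS => /eqP.
  exact: val_inj.
have [W hW] := dual_monomials t_inj.
pose z (y : R) (i : 'I_n) : C := imag (i.+1%:R^-1 * y).
have c0 (i : 'I_n) : (0 : R) < i.+1%:R^-1 by rewrite invr_gt0 ltr0n.
have zt y i : z y i * t i = y%:C.
  by rewrite /z /t imagMM mulrN rmorphN opprK mulrAC mulVf ?mul1r // pnatr_eq0.
pose eps (y : R) : C := ((X (imag y)).1 / (X (imag y)).2 + evalC q (imag y)^-1) * imag y ^+ d.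
have lim_eps : (eps y : C^o) @[y --> +oo] --> (0 : C^o).
  apply: cvg_near_eq heps; near=> y; rewrite /eps qE; congr ((_ + _) * _).
  by apply: eq_bigr => j _; rewrite exprVn.
pose ep y (i : 'I_n) := eps (i.+1%:R^-1 * y).
have lim_ep i : (ep y i : C^o) @[y --> +oo] --> (0 : C^o).
  exact: (cvg_comp_scale (c0 i) lim_eps).
pose F y (a i : 'I_n) : C := W a i * y%:C ^+ a.+1 / t i.
pose E y (a i : 'I_n) : C := F y a i / (X (z y i)).2.
pose phi y (i : 'I_n) (c : 'I_d) : C := (t i * (y^-1)%:C) ^+ c.+1.
pose r (i j : 'I_n) : R := i.+1%:R^-1 + j.+1%:R^-1.
have r0 i j : imag (r i j) != 0 by rewrite imag_eq0 gt_eqF // addr_gt0.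
(* the contribution of the remainder of the expansion *)
pose err y (a b : 'I_n) : C := \sum_i \sum_j
   W a i * (W b j)^* / (t i * (t j)^* * imag (r i j)) *
   ((y^-1)%:C ^+ (d.+1 - (a + b + 2)) * (ep y i * t i ^+ d - (ep y j * t j ^+ d)^*)).
have lim_err a b : (err y a b : C^o) @[y --> +oo] --> (0 : C^o).
  rewrite -[X in _ --> X](_ : \sum_(i < n) \sum_(j < n) 0 = 0); last first.
    by rewrite big1 // => i _; rewrite big1.
  apply: cvg_sumC => i; apply: cvg_sumC => j.
  rewrite -[X in _ --> X](mulr0 (W a i * (W b j)^* / (t i * (t j)^* * imag (r i j)))).
  apply: cvgM; first exact: cvg_cst.
  rewrite -[X in _ --> X](mulr0 (0 ^+ (d.+1 - (a + b + 2)))).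
  apply: cvgM; first exact: cvg_invXC.
  rewrite -[X in _ --> X](_ : 0 * t i ^+ d - (0 * t j ^+ d)^* = 0); last first.
    by rewrite !mul0r rmorph0 subrr.
  apply: cvgB; last apply: cvg_conj; apply: cvgM; try exact: cvg_cst; exact: lim_ep.
pose Mv y (a : 'I_n) := pull (phi y) (F y a).
have lim_M a c : (Mv y a c : C^o) @[y --> +oo] --> ((a == c :> nat)%:R : C^o).
  have e : \forall y \near +oo, (y%:C ^+ a * (y^-1)%:C ^+ c) * \sum_i W a i * t i ^+ c
     = Mv y a c.
    near=> y; have y0 : y%:C != 0 :> C.
      by rewrite fmorph_eq0 gt_eqF //; near: y; exact: nbhs_pinfty_gt.
    rewrite /Mv /pull mulr_sumr; apply: eq_bigr => i _; rewrite /F /phi exprMn fmorphV /= !exprS.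
    by rewrite exprVn; field; rewrite t0 y0 expf_neq0.
  apply: (cvg_near_eq e) => {e}.
  have [cn|nc] := ltnP c n.
    have := hW a (Ordinal cn) => /= ->.
    rewrite -[(a == Ordinal cn)]/(a == c :> nat).
    apply: (cvg_near_eq (f := fun=> (a == c :> nat)%:R)); last exact: cvg_cst.
    near=> y; have y0 : y%:C != 0 :> C.
      by rewrite fmorph_eq0 gt_eqF //; near: y; exact: nbhs_pinfty_gt.
    case: eqP => [->|_]; last by rewrite mulr0.
    by rewrite mulr1 -exprMn -rmorphM mulfV ?expr1n // -(fmorph_eq0 (real_complex R)).
  have ac : (a < c)%N by apply: leq_trans nc.
  rewrite ltn_eqF // mulr0n.
  rewrite -[X in _ --> X](mul0r (\sum_i W a i * t i ^+ c)); apply: cvgM; last exact: cvg_cst.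
  apply: (cvg_near_eq (f := fun y => (y^-1)%:C ^+ (c - a).-1.+1)).
    near=> y; have y0 : y%:C != 0 :> C.
      by rewrite fmorph_eq0 gt_eqF //; near: y; exact: nbhs_pinfty_gt.
    rewrite prednK ?subn_gt0 // fmorphV /= -{2}(subnK (ltnW ac)) exprD mulrCA -exprMn mulfV //.
    by rewrite expr1n mulr1.
  by rewrite -[X in _ --> X](expr0n C (c - a).-1.+1); exact: cvg_invXC.
have lim a b : (cong (E y) (gram (ker X) (z y)) a b : C^o) @[y --> +oo] -->
    (mxC (hankel s n) a b : C^o).
  have nd : (n <= d)%N by rewrite /d; have := ltn_ord a; lia.
  have -> : mxC (hankel s n) a b = sform H (fun c => (a == c :> nat)%:R) (fun c => (b == c :> nat)%:R).
    rewrite -[RHS]/(sform H (fun c => (widen_ord nd a == c)%:R) (fun c => (widen_ord nd b == c)%:R)).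
    rewrite form_delta /H /mxC !mxE coef_poly /= ifT //.
    by have := ltn_ord a; have := ltn_ord b; rewrite /d; lia.
  have e : \forall y \near +oo, sform H (Mv y a) (Mv y b) + err y a b =
       cong (E y) (gram (ker X) (z y)) a b.
    near=> y; have yp : 0 < y by near: y; exact: nbhs_pinfty_gt.
    have y0 : y%:C != 0 :> C by rewrite fmorph_eq0 gt_eqF.
    have hu : forall i, (X (z y i)).2 != 0.
      by near: y; apply: filter_forall => i; exact: (near_scale (c0 i) hv).
    rewrite /Mv -form_cong /cong /sform /err -big_split; apply: eq_bigr => i _.
    rewrite -big_split; apply: eq_bigr => j _ /=.
    pose om i := t i * (y^-1)%:C.
    have omz i' : om i' = (z y i')^-1.
      have z0 : z y i' != 0 by rewrite imag_eq0 mulf_neq0 ?gt_eqF.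
      by apply: (mulfI z0); rewrite /om mulrA zt fmorphV !mulfV.
    have -> : \sum_c \sum_e H c e * phi y i c * (phi y j e)^* =
       - (evalC q (om i) - (evalC q (om j))^*) / (z y i - (z y j)^*).
      have om0 i' : om i' != 0.
        by rewrite /om mulf_neq0 // fmorphV invr_eq0.
      have zE i' : z y i' = (om i')^-1 by rewrite omz invrK.
      have up i' : upper (z y i') by rewrite /upper /= mulr_gt0.
      have := upper_sub_neq0 (up i) (up j); rewrite !zE cconjV.
      have b0 := om0 i; have b1 : (om j)^* != 0 by rewrite conjC_eq0 om0.
      have b2 := bezout_hankel (om i) ((om j)^*) sq.
      rewrite evalC_conj b2; set S := \sum_(i < d) _.
      have -> : \sum_c \sum_e H c e * phi y i c * (phi y j e)^* = om i * (om j)^* * S.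
        rewrite mulr_sumr; apply: eq_bigr => c _; rewrite mulr_sumr; apply: eq_bigr => e _.
        by rewrite /H /mxC mxE /phi -!/(om _) !rmorphXn /= !exprS; ring.
      have alg (w1 w2 T : C) : w1 != 0 -> w2 != 0 -> w1^-1 - w2^-1 != 0 ->
          w1 * w2 * T = - ((w1 - w2) * T) / (w1^-1 - w2^-1).
        by move=> d0 d1 d2; apply: (mulIf d2); rewrite mulfVK //; field; rewrite d0 d1.
      exact: alg.
    have eX i' : (X (z y i')).1 = (X (z y i')).2 * (ep y i' * om i' ^+ d - evalC q (om i')).
      have ui := hu i'; have z0 : z y i' != 0 by rewrite imag_eq0 mulf_neq0 ?gt_eqF.
      rewrite /ep /eps -/(z y i') -omz -mulrA -exprMn omz mulfV // expr1n mulr1.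
      by field.
    rewrite /gram /ker (eX i) (eX j) /E.
    have zz : z y i - (z y j)^* = imag (r i j) * y%:C.
      by rewrite /z conj_imag opprK -imagD -mulrDl imagM.
    rewrite zz /om !exprMn.
    have em : (y^-1)%:C ^+ d = (y^-1)%:C ^+ (d.+1 - (a + b + 2)) * (y%:C * (y^-1)%:C ^+ a.+1 * (y^-1)%:C ^+ b.+1) :> C.
      have {1}-> : d = ((d.+1 - (a + b + 2)) + (a + b.+1))%N.
        by rewrite /d; have := ltn_ord a; have := ltn_ord b; lia.
      by rewrite exprD exprD [_ ^+ a.+1]exprS fmorphV /= mulVKf.
    rewrite em /F; set m := (y^-1)%:C ^+ (d.+1 - _).
    have uj' : ((X (z y j)).2)^* != 0 by rewrite conjC_eq0 hu.
    have tj' : (t j)^* != 0 by rewrite conjC_eq0 t0.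
    have ya : y%:C ^+ a.+1 != 0 :> C by rewrite expf_neq0.
    have yb : y%:C ^+ b.+1 != 0 :> C by rewrite expf_neq0.
    have hui := hu i; have ti := t0 i; have rij := r0 i j.
    have hm : m^* = m by rewrite /m rmorphXn /= cconj_real.
    move: (ep y i) (ep y j) (X (z y i)).2 (X (z y j)).2 hui uj' => e1 e2 v1 v2 hui uj'.
    move: (evalC q _) (evalC q _) => q1 q2; clearbody m; clear em eX.
    rewrite fmorphV /= !exprVn !(rmorphM, rmorphB, fmorphV, rmorphXn) /= hm !cconj_real.
    by field; rewrite hui uj' ti tj' rij y0 ya yb.
  apply: (cvg_near_eq e); rewrite -[X in _ --> X]addr0; apply: cvgD; last exact: lim_err.
  by apply: cvg_form2 => c; exact: lim_M.
have hH : herm (mxC (hankel s n)).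
  by move=> i j; rewrite /mxC cconj_real !mxE addnC.
have [y [/neg_ge_cong hy y0]] := filter_ex (filterI (neg_ge_near hH lim hk)
   (nbhs_pinfty_gt (num_real (0 : R)))).
by exists 'I_n, (z y); split=> // i; rewrite /upper /= mulr_gt0.
Unshelve. all: by end_near.
Qed.

End Kernels.

(** * Growth in sectors *)

Section Nontangential.
Variable R : realType.
Local Notation C := R[i].
Local Notation V2 := (C * C)%type.

(** Diagonal dominance, in the manner of Gershgorin. *)
Lemma neg_ge_diag k (G : 'I_k -> 'I_k -> C) (c : R) : 0 < c ->
  (forall i, complex.Re (G i i) <= - c) ->
  (forall i j, i != j -> normc (G i j) <= c / (2 * k%:R)) -> neg_ge G k.
Proof.
move=> c0 hd ho; exists (fun i j => (i == j)%:R) => x x0.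
have ex j : comb x (fun i j : 'I_k => (i == j)%:R) j = x j.
  rewrite /comb (bigD1 j) //= eqxx mulr1 big1 ?addr0 // => l /negPf ->.
  by rewrite mulr0.
rewrite (eq_quad (fun _ _ => erefl) ex).
pose O i j : C := if i == j then 0 else G i j.
pose D i j : C := if i == j then G i j else 0.
rewrite (@eq_quad _ _ _ (fun i j => D i j + O i j) _ x) //; last first.
  by move=> i j; rewrite /D /O; case: eqP; rewrite ?addr0 ?add0r.
have k0 : (0 : R) < k%:R by case: x0 => i _; rewrite ltr0n (leq_ltn_trans _ (ltn_ord i)).
rewrite quadD; set S := \sum_i normc (x i) ^+ 2.
have S0 : 0 < S by exact: sum_sqr_gt0.
have h1 : quad D x <= - c * S.
  rewrite /quad /sform Re_sum mulr_sumr; apply: ler_sum => i _.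
  rewrite (bigD1 i) //= big1 ?addr0; last first.
    by move=> j /negPf; rewrite /D eq_sym => ->; rewrite !mul0r.
  rewrite /D eqxx -mulrA mulcJ mulrC Re_realM mulrC ler_wpM2r ?exprn_ge0 ?normc_ge0 //.
have h2 : quad O x <= c / (2 * k%:R) * k%:R * S.
  apply: quad_bound => i j; rewrite /O; case: eqP => [_|/eqP ij]; last exact: ho.
  by rewrite normc0 divr_ge0 ?mulr_ge0 ?ltW.
have e : c / (2 * k%:R) * k%:R = c / 2 by field; rewrite gt_eqF.
rewrite e in h2; have := mulr_gt0 c0 S0; lra.
Qed.

Section Bad.
Variables (X : C -> V2) (k : nat) (sigma delta : R).
Hypotheses (hk : idx_le (ker X) k) (s0 : 0 < sigma) (s1 : sigma <= 1) (d0 : 0 < delta).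

(** A point of a sector of slope sigma at which 1 / f exceeds delta |z|. If
    such points were unbounded, they would give arbitrarily many nearly
    orthogonal vectors of negative square, against the finite index. *)
Definition bad (z : C) : Prop :=
  [/\ upper z, sigma * normc z <= complex.Im z &
      delta * normc z * normc (X z).1 < normc (X z).2].

Let eps : R := delta * sigma / 12.

(** A vector of negative square is sought in the span of the kernel functions
    at z, i r and 2 i r, where r = |z|. Its coordinates (ta, tb) at the three
    points are multiples of (u, v). The ta add up to zero, which makes the
    vectors attached to points of very different moduli nearly orthogonal. *)
Definition tpt (z : C) (p : 'I_3) : C :=
  if p == 0 :> nat then z else if p == 1 :> nat then imag (normc z)
  else imag (2 * normc z).
Definition talpha (z : C) : C := (eps * normc z)%:C * (X z).1 / (X z).2.
(** This phase makes the leading cross term of the square real and negative.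
    *)
Definition tphase (z : C) : C :=
  let D := (z + imag (normc z))^-1 - (z + imag (2 * normc z))^-1 in D / (normc D)%:C.
Definition ta (z : C) (p : 'I_3) : C :=
  if p == 0 :> nat then talpha z else if p == 1 :> nat then tphase z
  else - (talpha z + tphase z).
Definition tb (z : C) (p : 'I_3) : C :=
  if p == 0 :> nat then (eps * normc z)%:C else
  ta z p * ((X (tpt z p)).2 / (X (tpt z p)).1).
Definition tcoef (z : C) (p : 'I_3) : C :=
  if p == 0 :> nat then (eps * normc z)%:C / (X z).2 else ta z p / (X (tpt z p)).1.
(** The scalar product of the vectors attached to z and to another bad point.
    *)
Definition tform (z z' : C) : C :=
  \sum_p \sum_q (ta z p * (tb z' q)^* - tb z p * (ta z' q)^*) / (tpt z p - (tpt z' q)^*).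

Lemma Im_le_normc (x : C) : complex.Im x <= normc x.
Proof.
have := Re_le_normc (- (imag 1 * x)); rewrite normcN normcM /imag /= !expr0n /= expr1n.
rewrite add0r sqrtr1 mul1r; case: x => a b /=.
by rewrite mul0r mul1r sub0r opprK; exact: le_trans (ler_norm _).
Qed.

Lemma normc_div_le (x y : C) (A B : R) :
  normc x <= A -> 0 < B -> B <= normc y -> normc (x / y) <= A / B.
Proof.
move=> hx B0 hy; rewrite normcM normcV.
have y0 : 0 < normc y by exact: lt_le_trans hy.
apply: ler_pM => //; rewrite ?normc_ge0 ?invr_ge0 ?normc_ge0 //.
by rewrite lef_pV2.
Qed.

Lemma normc_imag (y : R) : normc (imag y) = `|y|.
Proof. by rewrite /imag /= expr0n /= add0r sqrtr_sqr. Qed.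

Let e0 : 0 < eps. Proof. by rewrite /eps divr_gt0 // mulr_gt0. Qed.

Lemma bad_gt0 z : bad z -> 0 < normc z.
Proof. by case=> uz _ _; apply: lt_le_trans (Im_le_normc z). Qed.

Lemma bad_neq0 z : bad z -> (X z).2 != 0.
Proof.
case=> _ _ h; rewrite -normc_gt0; apply: le_lt_trans h.
by rewrite !mulr_ge0 ?normc_ge0 // ltW.
Qed.

Lemma tpt_Im z p : bad z -> sigma * normc z <= complex.Im (tpt z p) /\ upper (tpt z p).
Proof.
move=> bz; have r0 := bad_gt0 bz; have [uz h _] := bz.
have sr : sigma * normc z <= normc z by rewrite ger_pMl.
rewrite /tpt /upper /=; case: ifP => // _; case: ifP => _ /=; split => //; lra.
Qed.

Lemma tpt_sub z z' p q : bad z -> bad z' ->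
  sigma * normc z <= normc (tpt z p - (tpt z' q)^*).
Proof.
move=> bz bz'; apply: le_trans (Im_le_normc _); rewrite cImD cImN cIm_conj opprK.
have [h1 _] := tpt_Im p bz; have [_ /ltW h2] := tpt_Im q bz'.
by rewrite ler_wpDr.
Qed.

Lemma tpt_sub1 z p q : bad z -> (p != ord0) || (q != ord0) ->
  normc z <= normc (tpt z p - (tpt z q)^*).
Proof.
move=> bz pq; apply: le_trans (Im_le_normc _); rewrite cImD cImN cIm_conj opprK.
have [_ /ltW] := tpt_Im p bz; have [_ /ltW] := tpt_Im q bz.
have r0 := bad_gt0 bz.
have h (i : 'I_3) : i != ord0 -> normc z <= complex.Im (tpt z i).
  case: i => -[|[|[|//]]] hi //= _; rewrite /tpt //=; lra.
by case/orP: pq => /h; lra.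
Qed.

Lemma normc_talpha z : bad z -> normc (talpha z) <= sigma / 12.
Proof.
move=> bz; have r0 := bad_gt0 bz; have [_ _ h] := bz.
have v0 : 0 < normc (X z).2 by rewrite normc_gt0 bad_neq0.
rewrite /talpha normcM normcV normcM normc_real ger0_norm; last by rewrite mulr_ge0 ?ltW.
rewrite ler_pdivrMr // /eps.
have -> : delta * sigma / 12 * normc z * normc (X z).1 =
   sigma / 12 * (delta * normc z * normc (X z).1) by ring.
by apply: ler_wpM2l; [rewrite divr_ge0 // ltW|exact: ltW].
Qed.

Definition tD (z : C) : C := (z + imag (normc z))^-1 - (z + imag (2 * normc z))^-1.

Lemma bad_addi z y : bad z -> 0 < y -> y <= normc (z + imag y).
Proof.
move=> [uz _ _] y0; apply: le_trans (Im_le_normc _); rewrite cImD /=.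
by rewrite lerDr ltW.
Qed.

Lemma normc_tD z : bad z -> 1 / 6 <= normc z * normc (tD z).
Proof.
move=> bz; have r0 := bad_gt0 bz.
have r2 : 0 < 2 * normc z by lra.
have h1 := bad_addi bz r0; have h2 := bad_addi bz r2.
have n1 : z + imag (normc z) != 0 by rewrite -normc_gt0; lra.
have n2 : z + imag (2 * normc z) != 0 by rewrite -normc_gt0; lra.
have -> : tD z = imag (normc z) / ((z + imag (normc z)) * (z + imag (2 * normc z))).
  have e : imag (2 * normc z) = imag (normc z) + imag (normc z).
    by rewrite -imagD; congr imag; lra.
  rewrite /tD; move: n1 n2; rewrite e => n1 n2; field.
  by rewrite n1 n2.
rewrite normcM normc_imag normcV normcM ger0_norm ?normc_ge0 //.
have u1 : normc (z + imag (normc z)) <= 2 * normc z.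
  by apply: le_trans (le_normcD _ _) _; rewrite normc_imag ger0_norm ?normc_ge0 //; lra.
have u2 : normc (z + imag (2 * normc z)) <= 3 * normc z.
  apply: le_trans (le_normcD _ _) _; rewrite normc_imag ger0_norm ?mulr_ge0 ?normc_ge0 //; lra.
have p0 : 0 < normc (z + imag (normc z)) * normc (z + imag (2 * normc z)).
  by rewrite mulr_gt0 // normc_gt0.
rewrite mulrA ler_pdivlMr //.
have := ler_pM (normc_ge0 _) (normc_ge0 _) u1 u2; lra.
Qed.

Lemma normc_tphase z : bad z -> normc (tphase z) = 1.
Proof.
move=> bz; have := normc_tD bz; rewrite /tphase -/(tD z) => h.
have D0 : normc (tD z) != 0.
  by apply: contraTneq h => ->; rewrite mulr0 -ltNge; lra.
by rewrite normcM normcV normc_real ger0_norm ?normc_ge0 // mulfV.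
Qed.

Lemma normc_ta z p : bad z -> normc (ta z p) <= 2 :> R.
Proof.
move=> bz; have h1 := normc_talpha bz; have h2 := normc_tphase bz.
have s2 : sigma / 12 <= 2 :> R by have := s1; lra.
rewrite /ta; case: ifP => _; first exact: le_trans h1 s2.
case: ifP => _; first by rewrite h2; have := s1; lra.
by rewrite normcN; apply: le_trans (le_normcD _ _) _; rewrite h2; have := s1; lra.
Qed.

Lemma sum_ta z : \sum_p ta z p = 0.
Proof. by rewrite !big_ord_recl big_ord0 /ta /=; ring. Qed.

Definition far (eta Y : R) : Prop := 0 <= Y /\ forall y, Y < y ->
  (X (imag y)).1 != 0 /\ normc ((X (imag y)).2 / (X (imag y)).1) <= eta * y.

Lemma normc_tb eta Y z p : far eta Y -> bad z -> Y < normc z -> p != ord0 ->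
  normc (tb z p) <= 4 * eta * normc z.
Proof.
move=> [Y0 hY] bz Yz p0; have r0 := bad_gt0 bz.
have := normc_ta p bz.
case: p p0 => -[|[|[|//]]] hp //= _; rewrite /tb /tpt /= => ha; rewrite normcM.
  have [_ h] := hY _ Yz.
  have := ler_pM (normc_ge0 _) (normc_ge0 _) ha h.
  have : 0 <= eta * normc z by apply: le_trans h; exact: normc_ge0.
  lra.
have Yz2 : Y < 2 * normc z by lra.
have [_ h] := hY _ Yz2.
have := ler_pM (normc_ge0 _) (normc_ge0 _) ha h; lra.
Qed.

Lemma tcoefE eta Y z p : far eta Y -> bad z -> Y < normc z ->
  ta z p = tcoef z p * (X (tpt z p)).1 /\ tb z p = tcoef z p * (X (tpt z p)).2.
Proof.
move=> [Y0 hY] bz Yz; have r0 := bad_gt0 bz; have v0 := bad_neq0 bz.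
have Yz2 : Y < 2 * normc z by lra.
have [u1 _] := hY _ Yz; have [u2 _] := hY _ Yz2.
case: p => -[|[|[|//]]] hp; rewrite /tb /ta /tcoef /tpt /= ?divfK //;
 split=> //; rewrite /talpha ?mulrA; exact: mulrAC.
Qed.

Lemma tformE eta Y z z' : far eta Y -> bad z -> Y < normc z -> bad z' -> Y < normc z' ->
  tform z z' = \sum_p \sum_q ker X (tpt z p) (tpt z' q) * tcoef z p * (tcoef z' q)^*.
Proof.
move=> hf bz Yz bz' Yz'; apply: eq_bigr => p _; apply: eq_bigr => q _.
have [-> ->] := tcoefE p hf bz Yz; have [-> ->] := tcoefE q hf bz' Yz'.
by rewrite !rmorphM /= /ker; ring.
Qed.

(** As z grows, the only terms that do not tend to 0 carry the factor tb z p,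
    of the order of |z|; in the sum over q they cancel to leading order, since
    the ta of the fixed point add up to zero. *)
Lemma tform_cross eta Y z' (h : R) : far eta Y -> bad z' -> 0 < h ->
  exists Y', forall z, bad z -> Y < normc z -> Y' < normc z -> normc (tform z z') <= h.
Proof.
move=> hf bz' h0; have e0' := e0.
pose K1 : R := \sum_q normc (tb z' q).
pose K2 : R := \sum_q normc (ta z' q) * normc (tpt z' q).
have K10 : 0 <= K1 by apply: sumr_ge0 => q _; exact: normc_ge0.
have K20 : 0 <= K2 by apply: sumr_ge0 => q _; rewrite mulr_ge0 ?normc_ge0.
pose M : R := eps + 4 * `|eta|.
have M0 : 0 <= M by rewrite /M; have := normr_ge0 eta; lra.
pose Q := (6 * K1 + 3 * M * K2 / sigma) / sigma.
have Q0 : 0 <= Q.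
  have si : 0 <= sigma by exact: ltW.
  by rewrite /Q divr_ge0 // addr_ge0 ?divr_ge0 ?mulr_ge0.
exists (Q / h) => z bz Yz Qz; have r0 := bad_gt0 bz.
have sr : 0 < sigma * normc z by rewrite mulr_gt0.
have hb p : normc (tb z p) <= M * normc z.
  case: (eqVneq p ord0) => [->|p0].
    rewrite -[tb z ord0]/((eps * normc z)%:C) normc_real ger0_norm; last first.
      by apply: mulr_ge0; exact: ltW.
    apply: ler_wpM2r; first exact: ltW.
    by rewrite /M; have := normr_ge0 eta; lra.
  apply: le_trans (normc_tb hf bz Yz p0) _; apply: ler_wpM2r; first exact: ltW.
  by rewrite /M; have := ler_norm eta; lra.
have low p : sigma * normc z <= normc (tpt z p).
  by apply: le_trans (Im_le_normc _); have [] := tpt_Im p bz.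
have term p : normc (\sum_q (ta z p * (tb z' q)^* - tb z p * (ta z' q)^*) / (tpt z p - (tpt z' q)^*))
    <= 2 * K1 / (sigma * normc z) + M * K2 / sigma / (sigma * normc z).
  have lp := low p; have p0 : tpt z p != 0 by rewrite -normc_gt0; lra.
  have dq q : tpt z p - (tpt z' q)^* != 0.
    by rewrite -normc_gt0; have := @tpt_sub z z' p q bz bz'; lra.
  have s0' : \sum_q (ta z' q)^* = 0 by rewrite -rmorph_sum sum_ta rmorph0.
  have -> : \sum_q (ta z p * (tb z' q)^* - tb z p * (ta z' q)^*) / (tpt z p - (tpt z' q)^*)
     = \sum_q (ta z p * (tb z' q)^* / (tpt z p - (tpt z' q)^*) -
         tb z p / tpt z p * ((ta z' q)^* * (tpt z' q)^* / (tpt z p - (tpt z' q)^*))).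
    apply/eqP; rewrite -subr_eq0 -sumrB.
    rewrite (eq_bigr (fun q => - (tb z p / tpt z p) * (ta z' q)^*)); last first.
      by move=> q _; have := dq q => dq'; field; rewrite p0 dq'.
    by rewrite -mulr_sumr s0' mulr0.
  have -> : 2 * K1 / (sigma * normc z) + M * K2 / sigma / (sigma * normc z) =
      \sum_q (2 * normc (tb z' q) / (sigma * normc z) +
         M / sigma * (normc (ta z' q) * normc (tpt z' q)) / (sigma * normc z)).
    by rewrite big_split /= -!mulr_suml -!mulr_sumr -/K1 -/K2 [M / sigma * K2]mulrAC.
  apply: le_trans (normc_sum _ _ _) _; apply: ler_sum => q _.
  apply: le_trans (le_normcD _ _) _; rewrite normcN; apply: lerD.
    apply: normc_div_le sr (tpt_sub p q bz bz').
    by rewrite normcM normcJR ler_wpM2r ?normc_ge0 // normc_ta.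
  rewrite normcM -[leRHS]mulrA; apply: ler_pM; rewrite ?normc_ge0 //.
    have -> : M / sigma = M * normc z / (sigma * normc z) by field; rewrite !gt_eqF.
    exact: normc_div_le.
  by apply: normc_div_le sr (tpt_sub p q bz bz'); rewrite normcM !normcJR.
apply: le_trans (normc_sum _ _ _) _.
apply: (@le_trans _ _ (\sum_(p < 3) (2 * K1 / (sigma * normc z) + M * K2 / sigma / (sigma * normc z)))).
  by apply: ler_sum => p _; exact: term.
rewrite sumr_const card_ord.
have -> : (2 * K1 / (sigma * normc z) + M * K2 / sigma / (sigma * normc z)) *+ 3 = Q / normc z.
  by rewrite /Q -mulr_natl; field; rewrite !gt_eqF.
rewrite ler_pdivrMr // mulrC -ler_pdivrMr //; exact: ltW.
Qed.

Lemma tform_herm z z' : tform z' z = (tform z z')^*.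
Proof.
rewrite /tform rmorph_sum exchange_big; apply: eq_bigr => p _ /=.
rewrite rmorph_sum; apply: eq_bigr => q _ /=.
rewrite !(rmorphM, rmorphB, fmorphV) /= !conjCK.
rewrite -[tpt z' q - _]opprB invrN mulrN -mulNr opprB.
by congr (_ * _); rewrite [X in _ - X]mulrC [X in X - _]mulrC.
Qed.

(** The square is A + 2 Re B + T. The term A of the pair (z, z) is at most eps
    / 12 in modulus, because talpha is small; B pairs z with the two points of
    the axis, and Re B is at most - eps / 12 by the choice of tphase; the
    remaining T is of the order of mu. *)
Lemma tform_diag mu Y z : 0 <= mu -> mu <= eps / 24 / 9 / 16 -> far mu Y -> bad z -> Y < normc z ->
  complex.Re (tform z z) <= - (eps / 24).
Proof.
move=> mu0 hmu hf bz Yz; have r0 := bad_gt0 bz; set r := normc z in r0 *.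
pose b0 : C := (eps * r)%:C.
pose w1 := z + imag r; pose w2 := z + imag (2 * r).
pose B : C := - b0 * ((tphase z)^* / w1 - (talpha z + tphase z)^* / w2).
pose A : C := (talpha z * b0 - b0 * (talpha z)^*) / (z - z^*).
pose T p q : C := (if q == ord0 then 0 else ta z p * (tb z q)^* / (tpt z p - (tpt z q)^*))
  + (if p == ord0 then 0 else - tb z p * (ta z q)^* / (tpt z p - (tpt z q)^*)).
have bE : tb z ord0 = b0 by [].
have e : tform z z = A + (B + B^*) + \sum_p \sum_q T p q.
  have E p q : (ta z p * (tb z q)^* - tb z p * (ta z q)^*) / (tpt z p - (tpt z q)^*)
    = (if q == ord0 then ta z p * b0 / (tpt z p - (tpt z q)^*) else 0) +
      (if p == ord0 then - b0 * (ta z q)^* / (tpt z p - (tpt z q)^*) else 0) + T p q.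
    rewrite /T; case: eqP => [->|_]; case: eqP => [->|_]; rewrite ?bE ?cconj_real; ring.
  rewrite /tform; under eq_bigr => p _ do under eq_bigr => q _ do rewrite E.
  under eq_bigr => p _ do rewrite big_split big_split /=.
  rewrite big_split big_split /=; congr (_ + _).
  have o1 : (lift ord0 ord0 == ord0 :> 'I_3) = false by [].
  have o2 : (lift ord0 (lift ord0 ord0) == ord0 :> 'I_3) = false by [].
  rewrite !big_ord_recl !big_ord0 /= ?o1 ?o2.
  rewrite /A /B /tpt /ta /= -/r !conj_imag !opprK -/w1 -/w2.
  have h1 : imag r - z^* = - (w1^*) by rewrite /w1 rmorphD /= conj_imag; ring.
  have h2 : imag (2 * r) - z^* = - (w2^*) by rewrite /w2 rmorphD /= conj_imag; ring.
  rewrite h1 h2 !invrN.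
  have hb : b0^* = b0 by exact: cconj_real.
  move: (talpha z) (tphase z) w1 w2 (z - z^*) b0 hb {h1 h2 E T bE A B} => al ph w1 w2 zz b0 hb.
  rewrite !(rmorphM, rmorphN, rmorphB, rmorphD, fmorphV) /= !conjCK hb; ring.
have ge0r : normc z = r by [].
have hb0 : normc b0 = eps * r by rewrite normc_real ger0_norm // mulr_ge0 // ltW.
have ha := normc_talpha bz.
have es : eps * (sigma / 12) <= eps / 12 by have := ler_wpM2l (ltW e0) s1; lra.
have hA : normc A <= eps / 12.
  have h1 : normc (talpha z * b0 - b0 * (talpha z)^*) <= 2 * (sigma * r) * (eps / 12).
    apply: le_trans (le_normcD _ _) _; rewrite normcN [normc (_ * b0)]normcM [normc (b0 * _)]normcM hb0 normcJR.
    have er : 0 <= eps * r by rewrite mulr_ge0 // ltW.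
    have := ler_wpM2r er ha; lra.
  have h2 : 2 * (sigma * r) <= normc (z - z^*).
    apply: le_trans (Im_le_normc _); rewrite cImD cImN cIm_conj opprK.
    by have [_ h _] := bz; rewrite -/r in h; lra.
  have p0 : 0 < 2 * (sigma * r) by rewrite mulr_gt0 // mulr_gt0.
  apply: le_trans (normc_div_le h1 p0 h2) _.
  by rewrite mulrC mulKf // gt_eqF.
have hB : complex.Re B <= - (eps / 6) + eps / 12.
  have := e0 => e0'.
  have -> : B = - (eps * r)%:C * ((tphase z)^* * tD z) + b0 * (talpha z)^* / w2.
    rewrite /B rmorphD /= /tD -/r -/w1 -/w2 /b0; ring.
  have -> : (tphase z)^* * tD z = (normc (tD z))%:C.
    rewrite /tphase -/(tD z) rmorphM /= fmorphV /= cconj_real mulrAC [_^* * _]mulrC mulcJ.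
    have D0 : (normc (tD z))%:C != 0 :> C.
      rewrite fmorph_eq0; have := normc_tD bz; apply: contraTneq => ->; rewrite mulr0 -ltNge; lra.
    by rewrite expr2 rmorphM /= mulfK.
  rewrite cReD -rmorphN Re_realM [complex.Re _%:C]/=.
  have h1 : normc (b0 * (talpha z)^* / w2) <= eps / 12.
    have r2 : 0 < 2 * r by lra.
    have hn : normc (b0 * (talpha z)^*) <= (2 * r) * (eps / 24).
      rewrite normcM hb0 normcJR.
      have er : 0 <= eps * r by rewrite mulr_ge0 // ltW.
      have := ler_wpM2l er ha.
      have := ler_wpM2r (ltW r0) es; lra.
    apply: le_trans (normc_div_le hn r2 (bad_addi bz r2)) _.
    by rewrite mulrC mulKf ?gt_eqF //; lra.
  have h3 := Re_le_normc (b0 * (talpha z)^* / w2).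
  have h4 := ler_norm (complex.Re (b0 * (talpha z)^* / w2)).
  have h2 := ler_wpM2l (ltW e0) (normc_tD bz); rewrite -/r in h2.
  lra.
have hT p q : normc (T p q) <= eps / 24 / 9.
  have t1 : normc (if q == ord0 then 0 else ta z p * (tb z q)^* / (tpt z p - (tpt z q)^*)) <=
      8 * mu.
    case: ifP => [_|q0]; first by rewrite normc0; lra.
    have hn : normc (ta z p * (tb z q)^*) <= r * (8 * mu).
      rewrite normcM normcJR.
      have := ler_pM (normc_ge0 _) (normc_ge0 _) (normc_ta p bz) (normc_tb hf bz Yz (negbT q0)).
      rewrite -/r; lra.
    have hd := @tpt_sub1 z p q bz; rewrite q0 orbT in hd.
    apply: le_trans (normc_div_le hn r0 (hd isT)) _.
    by rewrite mulrC mulKf ?gt_eqF.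
  have t2 : normc (if p == ord0 then 0 else - tb z p * (ta z q)^* / (tpt z p - (tpt z q)^*)) <=
      8 * mu.
    case: ifP => [_|p0]; first by rewrite normc0; lra.
    have hn : normc (- tb z p * (ta z q)^*) <= r * (8 * mu).
      rewrite normcM normcJR normcN.
      have := ler_pM (normc_ge0 _) (normc_ge0 _) (normc_tb hf bz Yz (negbT p0)) (normc_ta q bz).
      rewrite -/r; lra.
    have hd := @tpt_sub1 z p q bz; rewrite p0 /= in hd.
    apply: le_trans (normc_div_le hn r0 (hd isT)) _.
    by rewrite mulrC mulKf ?gt_eqF.
  apply: le_trans (le_normcD _ _) _; lra.
have hTT : complex.Re (\sum_p \sum_q T p q) <= eps / 24.
  apply: le_trans (ler_norm _) _; apply: le_trans (Re_le_normc _) _.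
  apply: le_trans (normc_sum _ _ _) _.
  apply: (@le_trans _ _ (\sum_(p < 3) \sum_(q < 3) eps / 24 / 9)).
    apply: ler_sum => p _; apply: le_trans (normc_sum _ _ _) _.
    by apply: ler_sum => q _; exact: hT.
  by rewrite !big_ord_recl !big_ord0; lra.
rewrite e !cReD cRe_conj.
have := Re_le_normc A; have := ler_norm (complex.Re A); lra.
Qed.

(** The points are chosen one after the other, each so far away that it is
    nearly orthogonal to its predecessors. *)
Lemma bad_chain mu Y (h : R) n : far mu Y -> 0 < h ->
  (forall rho, exists z, bad z /\ rho < normc z) ->
  exists l : seq C, [/\ size l = n,
    forall z, z \in l -> bad z /\ Y < normc z &
    pairwise (fun z z' => normc (tform z z') <= h) l].
Proof.
move=> hf h0 hbad; elim: n => [|n [l [sl bl pl]]]; first by exists [::]; split.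
have [Y' hY'] : exists Y', forall z, bad z -> Y < normc z -> Y' < normc z ->
    forall z', z' \in l -> normc (tform z z') <= h.
  elim: l bl {sl pl} => [|z' l IH] bl; first by exists 0.
  have [Y1 h1] := IH (fun z hz => bl z (@mem_behead _ (z' :: l) z hz)).
  have [bz' _] := bl z' (mem_head _ _).
  have [Y2 h2] := tform_cross hf bz' h0.
  exists (Num.max Y1 Y2) => z bz Yz; rewrite gt_max => /andP [z1 z2] w.
  rewrite in_cons => /orP [/eqP ->|]; [exact: h2|exact: h1].
have [z [bz]] := hbad (Num.max Y Y'); rewrite gt_max => /andP [z1 z2].
exists (z :: l); split; first by rewrite /= sl.
  by move=> w; rewrite in_cons => /orP [/eqP ->|/bl].
by rewrite /= pl andbT; apply/allP => w wl; exact: hY'.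
Qed.

Lemma bad_bounded mu Y : 0 <= mu -> mu <= eps / 24 / 9 / 16 -> far mu Y -> exists rho, forall z, bad z -> normc z <= rho.
Proof.
move=> mu0 hmu hf; apply: contrapT => nb.
have hbad rho : exists z, bad z /\ rho < normc z.
  apply: contrapT => h; apply: nb; exists rho => z bz; rewrite leNgt; apply/negP => rz.
  by apply: h; exists z.
have c0 : 0 < eps / 24 by rewrite divr_gt0.
have h0 : 0 < eps / 24 / (2 * k.+1%:R) by rewrite divr_gt0 // mulr_gt0.
have [l [sl bl pl]] := bad_chain k.+1 hf h0 hbad.
pose z (i : 'I_k.+1) := nth 0 l i.
have zl i : z i \in l by rewrite mem_nth // sl.
have bz i : bad (z i) by have [] := bl _ (zl i).
have Yz i : Y < normc (z i) by have [] := bl _ (zl i).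
have cr (i j : 'I_k.+1) : i != j -> normc (tform (z i) (z j)) <= eps / 24 / (2 * k.+1%:R).
  have lt (a b : 'I_k.+1) : (a < b)%N -> normc (tform (z a) (z b)) <= eps / 24 / (2 * k.+1%:R).
    by move=> ab; move/(pairwiseP 0): pl; apply; rewrite // inE sl.
  rewrite neq_ltn => /orP [/lt //|/lt]; by rewrite [in X in _ -> X]tform_herm normcJR.
have hG : neg_ge (fun i j : 'I_k.+1 => tform (z i) (z j)) k.+1.
  by apply: (neg_ge_diag c0) => // i; exact: (tform_diag mu0 hmu hf).
pose pts (t : 'I_k.+1 * 'I_3) := tpt (z t.1) t.2.
have up t : upper (pts t) by have [] := tpt_Im t.2 (bz t.1).
pose Y0 (i : 'I_k.+1) (t : 'I_k.+1 * 'I_3) : C := if t.1 == i then tcoef (z i) t.2 else 0.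
have : neg_ge (cong Y0 (gram (ker X) pts)) k.+1.
  apply: eq_neg_ge hG => i j; rewrite (tformE hf) // /cong /sform.
  rewrite -(pair_bigA _ (fun a p => \sum_t gram (ker X) pts (a, p) t * Y0 i (a, p) * (Y0 j t)^*)) /=.
  rewrite (bigD1 i) //= [X in _ = _ + X]big1 ?addr0; last first.
    move=> a /negPf ai; rewrite big1 // => p _; rewrite big1 // => t _.
    by rewrite /Y0 /= ai mulr0 mul0r.
  apply: eq_bigr => p _.
  rewrite -(pair_bigA _ (fun b q => gram (ker X) pts (i, p) (b, q) * Y0 i (i, p) * (Y0 j (b, q))^*)) /=.
  rewrite (bigD1 j) //= [X in _ = _ + X]big1 ?addr0; last first.
    move=> a /negPf ai; rewrite big1 // => q _.
    by rewrite /Y0 /= ai rmorph0 mulr0.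
  by apply: eq_bigr => q _; rewrite /gram /Y0 /pts /= !eqxx.
by move/neg_ge_cong/neg_ge_le/(_ (hk up)); rewrite ltnn.
Qed.

End Bad.

(** A theorem of Phragmen-Lindelof type: the index being finite, growth along
    one ray controls the growth in every sector. *)
Lemma slow_nontangential (X : C -> V2) k (sigma delta : R) :
  idx_le (ker X) k -> slow X -> 0 < sigma -> sigma <= 1 -> 0 < delta ->
  exists rho : R, forall z, upper z -> sigma * normc z <= complex.Im z -> rho < normc z ->
    normc (X z).2 <= delta * normc z * normc (X z).1.
Proof.
move=> hk [hu hs] s0 s1 d0.
(* the largest mu allowed in tform_diag *)
pose eta := delta * sigma / 12 / 24 / 9 / 16.
have eta0 : 0 < eta by rewrite /eta; have := mulr_gt0 d0 s0; lra.
have [Y hf] : exists Y, far X eta Y.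
  have /(@cvgrPdist_lt _ C^o) /(_ eta%:C) := hs.
  rewrite ltcR => /(_ eta0) hs'.
  have [Y [_ hY]] := filterI hu hs'.
  exists (Num.max 0 Y); split; first by rewrite le_max lexx.
  move=> y; rewrite gt_max => /andP [y0 /hY [u0]].
  rewrite sub0r normrN -[`|_|]/((normc _)%:C) ltcR normcM normcV normc_real gtr0_norm //.
  by rewrite ltr_pdivrMr // => /ltW h; split.
have [rho hrho] := bad_bounded hk s0 s1 d0 (ltW eta0) (lexx _) hf.
exists rho => z uz hz rz; rewrite leNgt; apply/negP => h.
have /hrho : bad X sigma delta z by split.
by rewrite leNgt rz.
Qed.

End Nontangential.

(** * Functions of finite index near a point at infinity *)

Section Removable.
Variable R : realType.
Local Notation C := R[i].
Local Notation V2 := (C * C)%type.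

Definition ord3 (T : Type) (a b c : T) (i : 'I_3) : T :=
  if i == 0 :> nat then a else if i == 1 :> nat then b else c.

Lemma sum_ord3 (F : 'I_3 -> C) : \sum_i F i = F ord0 + F (lift ord0 ord0) + F ord_max.
Proof.
rewrite !big_ord_recl big_ord0 addr0 addrA; congr (_ + _); congr F.
exact: val_inj.
Qed.

Variables (X : C -> V2) (z0 : C).
Hypotheses (up0 : upper z0) (X0 : X z0 = (1, 0)).

(** The Cayley transform that sends z0 to 0. *)
Definition disc (z : C) : C := (z - z0) / (z - z0^*).
(** The value - 1 / f in the chart at infinity. *)
Definition hval (z : C) : C := - ((X z).2 / (X z).1).

Let y0 : C := z0 - z0^*.

(** The kernel in the disc variable, whose divided differences at z0 involve
    only hval / disc. *)
Definition kdisc (z w : C) : C :=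
  (- (X z).2 * ((X w).1)^* + (X z).1 * ((X w).2)^*) / (1 - disc z * (disc w)^*).

Lemma kdiscE z w : upper z -> upper w ->
  ker X z w * (z - z0^*) * (w - z0^*)^* = - y0 * kdisc z w /\ 1 - disc z * (disc w)^* != 0.
Proof.
move=> uz uw; have nz := upper_sub_neq0 uz up0; have nw := upper_sub_neq0 uw up0.
have nzw := upper_sub_neq0 uz uw; have n0 := upper_sub_neq0 up0 up0.
have nw' : w^* - z0 != 0.
  by rewrite -[z0]conjCK -rmorphB conjC_eq0.
have e : 1 - disc z * (disc w)^* = - y0 * (z - w^*) / ((z - z0^*) * (w^* - z0)).
  rewrite /disc /y0 rmorphM /= fmorphV /= !rmorphB /= conjCK; field.
  by rewrite nz nw'.
split; last by rewrite e !mulf_neq0 ?oppr_eq0 ?invr_eq0 ?mulf_neq0.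
rewrite /kdisc e /ker /y0 rmorphB /= conjCK; field.
by rewrite nzw n0 nz nw'.
Qed.

Lemma kdisc0r z : kdisc z z0 = - (X z).2.
Proof.
by rewrite /kdisc X0 /= /disc subrr mul0r !rmorph0 !mulr0 !subr0 divr1 rmorph1 addr0 mulr1.
Qed.

Lemma kdisc0l z : kdisc z0 z = ((X z).2)^*.
Proof. by rewrite /kdisc X0 /= /disc subrr !mul0r subr0 divr1 mul1r oppr0 mul0r add0r. Qed.

Lemma conj_y0 : y0^* = - y0.
Proof. by rewrite /y0 rmorphB /= conjCK opprB. Qed.

Lemma disc_neq0 z : upper z -> z != z0 -> disc z != 0.
Proof.
move=> uz zz; rewrite /disc mulf_neq0 ?subr_eq0 // invr_eq0 -subr_eq0 subr0.
exact: upper_sub_neq0.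
Qed.

(** The relation E = h A - B + d w E removes the factors 1 / d, which diverge
    in the limit; only the separation D of the difference quotients remains in
    the denominators. *)
Lemma divided_difference_mixed (y A B w Ea Eb ha hb da db D : C) :
  Ea = ha * A - B + da * w * Ea -> Eb = hb * A - B + db * w * Eb ->
  D = ha / da - hb / db -> da != 0 -> db != 0 -> D != 0 ->
  - y * (A + w * ((Ea - Eb) / D)) =
    - da^-1 / D * (- y * - B) + db^-1 / D * (- y * - B) + da^-1 / D * (- y * Ea) -
    db^-1 / D * (- y * Eb).
Proof.
move=> eEa eEb eD da0 db0 D0.
have eA : A = (ha / da - hb / db) / D * A by rewrite -eD divff ?mul1r.
rewrite [in X in _ = X]eEa [in X in _ = X]eEb [in X in X = _]eA.
by field; rewrite D0 da0 db0.
Qed.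

(** The same elimination in the square of a divided difference. *)
Lemma divided_difference_square (ha hb ha' hb' da db da' db' D D' Eaa Eab Eba Ebb : C) :
  Eaa = ha - ha' + da * da' * Eaa -> Eab = ha - hb' + da * db' * Eab ->
  Eba = hb - ha' + db * da' * Eba -> Ebb = hb - hb' + db * db' * Ebb ->
  da != 0 -> db != 0 -> da' != 0 -> db' != 0 -> D != 0 -> D' != 0 ->
  let al := da^-1 / D in let be := db^-1 / D in
  let al' := da'^-1 / D' in let be' := db'^-1 / D' in
  (Eaa - Eab - Eba + Ebb) / D / D' =
    - (al - be) * al' * - ha' + (al - be) * be' * - hb' - al * (al' - be') * ha
    + be * (al' - be') * hb + al * al' * Eaa - al * be' * Eab - be * al' * Eba + be * be' * Ebb.
Proof.
move=> e1 e2 e3 e4 a0 b0 a0' b0' D0 D0' al be al' be'.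
rewrite [in X in _ = X]e1 [in X in _ = X]e2 [in X in _ = X]e3 [in X in _ = X]e4 /al /be /al' /be'.
by field; rewrite D0 D0' a0 b0 a0' b0'.
Qed.

Definition nice (z : C) : Prop := [/\ upper z, z != z0 & (X z).1 != 0].

(** If the difference quotients hval / disc at a n and at b n stay apart while
    both points tend to z0, then the kernel function at z0 and the limit of
    the divided differences span a hyperbolic plane. The projections of the
    kernel functions at the points t on its orthogonal, divided by disc t,
    have again the Gram matrix of those functions. Hence there is one more
    negative square. *)
Lemma hyperbolic_plane (T : finType) (pts : T -> C) k (U : Type) (F : set_system U)
    (FF : ProperFilter F) (a b : U -> C) (eta : R) :
  (forall t, upper (pts t)) -> (forall t, pts t != z0) ->
  neg_ge (gram (ker X) pts) k -> 0 < eta ->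
  (forall n, nice (a n)) -> (forall n, nice (b n)) ->
  (a n : C^o) @[n --> F] --> (z0 : C^o) -> (b n : C^o) @[n --> F] --> (z0 : C^o) ->
  (hval (a n) : C^o) @[n --> F] --> (0 : C^o) ->
  (hval (b n) : C^o) @[n --> F] --> (0 : C^o) ->
  (forall n, eta <= normc (hval (a n) / disc (a n) - hval (b n) / disc (b n))) ->
  idx_ge (ker X) k.+1.
Proof.
move=> ut nt hk eta0 na nb la lb lha lhb hq.
pose S := (T + 'I_3)%type.
pose P n (s : S) := match s with inl t => pts t | inr i => ord3 z0 (a n) (b n) i end.
have uP n s : upper (P n s).
  have [ua _ _] := na n; have [ub _ _] := nb n.
  by case: s => [t|i] //=; rewrite /ord3; case: ifP => // _; case: ifP.
pose d n := hval (a n) / disc (a n) - hval (b n) / disc (b n).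
have d0 n : d n != 0.
  by rewrite -normc_gt0; apply: lt_le_trans (hq n).
pose cc z := z - z0^*.
pose S' := (T + 'I_2)%type.
pose idx (s : S') : 'I_3 -> S := match s with
  | inl t => fun=> inl t
  | inr i => fun j => inr j end.
pose co n (s : S') : 'I_3 -> C := match s with
  | inl t => ord3 (cc (pts t)) 0 0
  | inr i => if i == 0 :> nat then ord3 (cc z0) 0 0 else
      ord3 (- ((disc (a n))^-1 - (disc (b n))^-1) / d n * cc z0)
        (cc (a n) / (X (a n)).1 / disc (a n) / d n)
        (- (cc (b n) / (X (b n)).1 / disc (b n) / d n)) end.
pose F0 n (s : S') : S -> C := spread (idx s) (co n s).
(* F0 n consists of the kernel functions at the pts t and at z0, and of the
   divided difference of those at a n and b n; G is the limit of its Gram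
   matrices *)
pose e0 : 'I_2 := ord0.
pose at_ t := (X (pts t)).1.
pose bt_ t := - (X (pts t)).2.
pose G (s s' : S') : C := match s, s' with
  | inl t, inl t' => - y0 * kdisc (pts t) (pts t')
  | inl t, inr i => if i == 0 :> nat then - y0 * bt_ t else y0 * at_ t
  | inr i, inl t => if i == 0 :> nat then y0 * (bt_ t)^* else - y0 * (at_ t)^*
  | inr i, inr j => if i == 0 :> nat then (if j == 0 :> nat then 0 else y0)
       else (if j == 0 :> nat then - y0 else 0) end.
have kcc z w : upper z -> upper w -> cc z * (cc w)^* * ker X z w = - y0 * kdisc z w.
  by move=> uz uw; rewrite -(kdiscE uz uw).1 /cc; ring.
have hG : herm G.
  move=> [t|i] [t'|j] /=.
  - rewrite -!kcc // (herm_ker X (pts t) (pts t')); move: (ker _ _ _) => K.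
    by rewrite !rmorphM /= conjCK; ring.
  - by case: ifP => _; rewrite [RHS]rmorphM /= ?[(- y0)^*]rmorphN /= conj_y0 ?opprK.
  - by case: ifP => _; rewrite [RHS]rmorphM /= ?[(- y0)^*]rmorphN /= conj_y0 conjCK ?opprK.
  - by case: ifP => _; case: ifP => _; rewrite ?rmorph0 ?[(- y0)^*]rmorphN /= ?conj_y0 ?opprK.
have BE n s s' : cong (F0 n) (gram (ker X) (P n)) s s' =
    \sum_i \sum_j co n s i * (co n s' j)^* * ker X (P n (idx s i)) (P n (idx s' j)).
  by rewrite /cong sform_spread.
have cst s s' c : (forall n, cong (F0 n) (gram (ker X) (P n)) s s' = c) ->
    (cong (F0 n) (gram (ker X) (P n)) s s' : C^o) @[n --> F] --> (c : C^o).
  move=> e; apply: (cvg_near_eq (f := fun=> c)); last exact: cvg_cst.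
  by apply: nearW => n; rewrite e.
have sym s s' : (cong (F0 n) (gram (ker X) (P n)) s' s : C^o) @[n --> F] --> (G s' s : C^o) ->
   (cong (F0 n) (gram (ker X) (P n)) s s' : C^o) @[n --> F] --> (G s s' : C^o).
  move=> h; rewrite (hG s' s).
  apply: (cvg_near_eq (f := fun n => (cong (F0 n) (gram (ker X) (P n)) s' s)^*)).
    by apply: nearW => n; rewrite -(herm_cong (F0 n) (herm_gram X (P n))).
  exact: cvg_conj h.
have y0n : y0 != 0 by exact: upper_sub_neq0.
have lza : (disc (a n) : C^o) @[n --> F] --> (0 : C^o).
  rewrite -[X in _ --> X](_ : (z0 - z0) / (z0 - z0^*) = 0); last by rewrite subrr mul0r.
  apply: cvgM; first by apply: cvgB; [exact: la|exact: cvg_cst].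
  by apply: cvgV; [exact: y0n|apply: cvgB; [exact: la|exact: cvg_cst]].
have lzb : (disc (b n) : C^o) @[n --> F] --> (0 : C^o).
  rewrite -[X in _ --> X](_ : (z0 - z0) / (z0 - z0^*) = 0); last by rewrite subrr mul0r.
  apply: cvgM; first by apply: cvgB; [exact: lb|exact: cvg_cst].
  by apply: cvgV; [exact: y0n|apply: cvgB; [exact: lb|exact: cvg_cst]].
have ldiv (f : U -> C) : (f n : C^o) @[n --> F] --> (0 : C^o) ->
    (f n / d n : C^o) @[n --> F] --> (0 : C^o).
  move=> hf; apply: (cvg_bound (g := f) (M := eta^-1)); last exact: hf.
  apply: nearW => n.
  rewrite normcM mulrC normcV ler_wpM2r ?normc_ge0 // lef_pV2 ?posrE //; first exact: hq.
  exact: lt_le_trans (hq n).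
have lim_ut t : (cong (F0 n) (gram (ker X) (P n)) (inr (lift ord0 ord0)) (inl t) : C^o)
    @[n --> F] --> (G (inr (lift ord0 ord0)) (inl t) : C^o).
  pose E z : C := (hval z * (at_ t)^* - (bt_ t)^*) / (1 - disc z * (disc (pts t))^*).
  have e n : - y0 * ((at_ t)^* + (disc (pts t))^* * ((E (a n) - E (b n)) / d n)) =
     cong (F0 n) (gram (ker X) (P n)) (inr (lift ord0 ord0)) (inl t).
    have [ua za Xa] := na n; have [ub zb Xb] := nb n.
    rewrite BE !sum_ord3 /= /ord3 /= !rmorph0 !mulr0 !mul0r !addr0.
    have [_ da] := kdiscE ua (ut t); have [_ db] := kdiscE ub (ut t).
    have dz : hval (a n) / disc (a n) - hval (b n) / disc (b n) != 0 := d0 n.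
    have za0 := disc_neq0 ua za; have zb0 := disc_neq0 ub zb.
    transitivity (- (disc (a n))^-1 / d n * (- y0 * kdisc z0 (pts t)) +
       (disc (b n))^-1 / d n * (- y0 * kdisc z0 (pts t)) +
       (X (a n)).1^-1 / disc (a n) / d n * (- y0 * kdisc (a n) (pts t)) -
       (X (b n)).1^-1 / disc (b n) / d n * (- y0 * kdisc (b n) (pts t))); last first.
      rewrite -!kcc // /cc; ring.
    have kE z : nice z -> 1 - disc z * (disc (pts t))^* != 0 ->
        (X z).1^-1 * kdisc z (pts t) = E z.
      case=> _ _ Xz dd; rewrite /kdisc /E /hval /at_ /bt_ rmorphN /=.
      by field; rewrite dd Xz.
    have EE z : 1 - disc z * (disc (pts t))^* != 0 ->
        E z = hval z * (at_ t)^* - (bt_ t)^* + disc z * (disc (pts t))^* * E z.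
      by move=> dd; rewrite /E; field.
    have ek : kdisc z0 (pts t) = - (bt_ t)^* by rewrite kdisc0l /bt_ rmorphN opprK.
    rewrite (divided_difference_mixed y0 (EE _ da) (EE _ db) (erefl (d n)) za0 zb0 (d0 n)).
    rewrite ek -(kE _ (na n) da) -(kE _ (nb n) db); ring.
  apply: (cvg_near_eq (f := fun n => - y0 * ((at_ t)^* + (disc (pts t))^* *
     ((E (a n) - E (b n)) / d n)))); first exact: nearW.
  rewrite -[X in _ --> X](_ : - y0 * ((at_ t)^* + (disc (pts t))^* * 0) = - y0 * (at_ t)^*);
    last by rewrite mulr0 addr0.
  apply: cvgM; first exact: cvg_cst.
  apply: cvgD; first exact: cvg_cst.
  apply: cvgM; first exact: cvg_cst.
  apply: ldiv; rewrite -[X in _ --> X](subrr ((0 * (at_ t)^* - (bt_ t)^*) / (1 - 0 * (disc (pts t))^*))).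
  have lE z : (hval (z n) : C^o) @[n --> F] --> (0 : C^o) ->
      (disc (z n) : C^o) @[n --> F] --> (0 : C^o) ->
      (E (z n) : C^o) @[n --> F] --> ((0 * (at_ t)^* - (bt_ t)^*) / (1 - 0 * (disc (pts t))^*) : C^o).
    move=> h1 h2; apply: cvgM.
      by apply: cvgB; [apply: cvgM; [exact: h1|]|]; exact: cvg_cst.
    apply: cvgV; first by rewrite mul0r subr0 oner_eq0.
    apply: cvgB; first exact: cvg_cst.
    by apply: cvgM; [exact: h2|exact: cvg_cst].
  by apply: cvgB; apply: lE.
have lim_uu : (cong (F0 n) (gram (ker X) (P n)) (inr (lift ord0 ord0)) (inr (lift ord0 ord0)) : C^o)
    @[n --> F] --> (0 : C^o).
  pose D z w : C := (hval z - (hval w)^*) / (1 - disc z * (disc w)^*).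
  have e n : - y0 * ((D (a n) (a n) - D (a n) (b n) - D (b n) (a n) + D (b n) (b n)) / d n / (d n)^*) =
     cong (F0 n) (gram (ker X) (P n)) (inr (lift ord0 ord0)) (inr (lift ord0 ord0)).
    have [ua za Xa] := na n; have [ub zb Xb] := nb n.
    have za0 := disc_neq0 ua za; have zb0 := disc_neq0 ub zb.
    pose al := (disc (a n))^-1 / d n; pose be := (disc (b n))^-1 / d n.
    have kD z w : nice z -> nice w ->
        (X z).1^-1 * ((X w).1^-1)^* * kdisc z w = D z w.
      move=> [uz _ Xz] [uw _ Xw]; have [_ dd] := kdiscE uz uw.
      have Xw' : ((X w).1)^* != 0 by rewrite conjC_eq0.
      rewrite /kdisc /D /hval; move: (disc z) (disc w) dd => p q dd.
      rewrite rmorphN rmorphM /= !fmorphV /=.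
      by field; rewrite dd Xz Xw'.
    have DE z w : upper z -> upper w ->
        D z w = hval z - (hval w)^* + disc z * (disc w)^* * D z w.
      by move=> uz uw; have [_ dd] := kdiscE uz uw; rewrite /D; field.
    have c1 : inr ord0 = inr ord0 :> S by [].
    pose c0 := - (al - be); pose ca := (X (a n)).1^-1 * al; pose cb := - ((X (b n)).1^-1 * be).
    have e1 : co n (inr (lift ord0 ord0)) ord0 = c0 * cc z0.
      by rewrite /co /ord3 /= /c0 /al /be; ring.
    have e2 : co n (inr (lift ord0 ord0)) (lift ord0 ord0) = ca * cc (a n).
      by rewrite /co /ord3 /= /ca /al; ring.
    have e3 : co n (inr (lift ord0 ord0)) ord_max = cb * cc (b n).
      by rewrite /co /ord3 /= /cb /be; ring.
    have kc z w p q : upper z -> upper w ->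
        p * cc z * (q * cc w)^* * ker X z w = p * q^* * (- y0 * kdisc z w).
      move=> uz uw; rewrite -(kcc z w uz uw); move: (ker _ _ _) => K.
      by rewrite rmorphM /=; ring.
    rewrite BE !sum_ord3 e1 e2 e3 /idx [P n (inr ord0)]/= [P n (inr (lift _ _))]/= [P n (inr ord_max)]/=.
    rewrite [ord3 _ _ _ ord0]/ord3 [ord3 _ _ _ (lift _ _)]/ord3 [ord3 _ _ _ ord_max]/ord3 /=.
    rewrite !kc //.
    have k00 : kdisc z0 z0 = 0 by rewrite kdisc0r X0 oppr0.
    have ka0 z : nice z -> kdisc z z0 = (X z).1 * hval z.
      by case=> _ _ Xz; rewrite kdisc0r /hval; field.
    have k0a z : nice z -> kdisc z0 z = ((X z).1)^* * - (hval z)^*.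
      case=> _ _ Xz; rewrite kdisc0l /hval rmorphN opprK rmorphM /= fmorphV /=.
      have Xw' : ((X z).1)^* != 0 by rewrite conjC_eq0.
      by field.
    have ec z : disc z != 0 -> (disc z)^* != 0 by rewrite conjC_eq0.
    have d0' : (d n)^* != 0 by rewrite conjC_eq0.
    rewrite (divided_difference_square (DE _ _ ua ua) (DE _ _ ua ub) (DE _ _ ub ua) (DE _ _ ub ub)
      za0 zb0 (ec _ za0) (ec _ zb0) (d0 n) d0').
    rewrite -!kD ?k00 ?(ka0 (a n)) ?(ka0 (b n)) ?(k0a (a n)) ?(k0a (b n)) //.
    rewrite /c0 /ca /cb /al /be.
    move: (kdisc (a n) (a n)) (kdisc (a n) (b n)) (kdisc (b n) (a n)) (kdisc (b n) (b n)).
    move=> K1 K2 K3 K4.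
    move: (hval (a n)) (hval (a n))^* (hval (b n)) (hval (b n))^* => h1 h2 h3 h4.
    move: (d0 n) za0 zb0 Xa Xb; clear; move: (y0) (d n) (disc (a n)) (disc (b n)).
    move: (X (a n)).1 (X (b n)).1 => xa xb y D da db D0 da0 db0 xa0 xb0.
    have ec (z : C) : z != 0 -> z^* != 0 by rewrite conjC_eq0.
    move: (ec _ D0) (ec _ da0) (ec _ db0) (ec _ xa0) (ec _ xb0).
    rewrite !(rmorphM, rmorphN, rmorphB, fmorphV) /=.
    move: D^* da^* db^* xa^* xb^* => D' da' db' xa' xb' D0' da0' db0' xa0' xb0'.
    by field; rewrite ?D0 ?D0' ?da0 ?db0 ?da0' ?db0' ?xa0 ?xb0 ?xa0' ?xb0'.
  apply: (cvg_near_eq (f := fun n => - y0 *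
     ((D (a n) (a n) - D (a n) (b n) - D (b n) (a n) + D (b n) (b n)) / d n / (d n)^*)));
    first exact: nearW.
  rewrite -[X in _ --> X](mulr0 (- y0)); apply: cvgM; first exact: cvg_cst.
  have lD z w : (hval (z n) : C^o) @[n --> F] --> (0 : C^o) ->
      (disc (z n) : C^o) @[n --> F] --> (0 : C^o) ->
      (hval (w n) : C^o) @[n --> F] --> (0 : C^o) ->
      (disc (w n) : C^o) @[n --> F] --> (0 : C^o) ->
      (D (z n) (w n) : C^o) @[n --> F] --> (0 : C^o).
    move=> h1 h2 h3 h4; rewrite -[X in _ --> X](mul0r (1 - 0 * 0^*)^-1); apply: cvgM.
      rewrite -[X in _ --> X](_ : 0 - 0^* = 0); last by rewrite rmorph0 subrr.
      by apply: cvgB; [exact: h1|exact: cvg_conj h3].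
    apply: cvgV; first by rewrite mul0r subr0 oner_eq0.
    apply: cvgB; first exact: cvg_cst.
    by apply: cvgM; [exact: h2|exact: cvg_conj h4].
  have l2 : ((D (a n) (a n) - D (a n) (b n) - D (b n) (a n) + D (b n) (b n)) / d n : C^o)
      @[n --> F] --> (0 : C^o).
    apply: ldiv; rewrite -[X in _ --> X](_ : 0 - 0 - 0 + 0 = 0); last by rewrite !subr0 addr0.
    apply: cvgD; last by apply: lD.
    apply: cvgB; last by apply: lD.
    by apply: cvgB; apply: lD.
  apply: (cvg_bound (g := fun n => (D (a n) (a n) - D (a n) (b n) - D (b n) (a n) + D (b n) (b n)) / d n)
    (M := eta^-1)); last exact: l2.
  apply: nearW => n.
  rewrite normcM mulrC normcV normcJR ler_wpM2r ?normc_ge0 // lef_pV2 ?posrE //; first exact: hq.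
  exact: lt_le_trans (hq n).
have limG s s' : (cong (F0 n) (gram (ker X) (P n)) s s' : C^o) @[n --> F] --> (G s s' : C^o).
  have ord2 (i : 'I_2) : i = ord0 \/ i = lift ord0 ord0.
    by case: i => [[|[|//]] hi]; [left|right]; apply: val_inj.
  have l0t i t : (cong (F0 n) (gram (ker X) (P n)) (inr i) (inl t) : C^o) @[n --> F] -->
      (G (inr i) (inl t) : C^o).
    case: (ord2 i) => ->; last exact: lim_ut.
    apply: cst => n; rewrite BE !sum_ord3 /= /ord3 /= !rmorph0 !mulr0 !mul0r !addr0.
    by rewrite kcc // kdisc0l /bt_ rmorphN; ring.
  have ord11 : (cong (F0 n) (gram (ker X) (P n)) (inr (lift ord0 ord0)) (inr ord0) : C^o)
      @[n --> F] --> (- y0 : C^o).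
    apply: cst => n; have [ua za Xa] := na n; have [ub zb Xb] := nb n.
    have za0 := disc_neq0 ua za; have zb0 := disc_neq0 ub zb.
    rewrite BE !sum_ord3 /= /ord3 /= !rmorph0 !mulr0 !mul0r !addr0.
    have k0 : ker X z0 z0 = 0 by rewrite /ker X0 /= rmorph0 mulr0 mul0r subrr mul0r.
    rewrite k0 mulr0 add0r.
    transitivity ((X (a n)).1^-1 / disc (a n) / d n * (- y0 * kdisc (a n) z0) -
       (X (b n)).1^-1 / disc (b n) / d n * (- y0 * kdisc (b n) z0)).
      by rewrite -!kcc //; move: (ker _ _ _) (ker _ _ _) => K K'; ring.
    transitivity (- y0 * (d n / d n)); last by rewrite divff ?mulr1.
    rewrite !kdisc0r {3}/d /hval; move: (d n) (d0 n) => D D0; by field; rewrite za0 zb0 Xa Xb D0.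
  case: s => [t|i]; case: s' => [t'|j].
  - apply: cst => n; rewrite BE !sum_ord3 /= /ord3 /= !rmorph0 !mulr0 !mul0r !addr0.
    exact: kcc.
  - by apply: sym; apply: l0t.
  - exact: l0t.
  - case: (ord2 i) (ord2 j) => -> [->|->].
    + apply: cst => n; rewrite BE !sum_ord3 /= /ord3 /= !rmorph0 !mulr0 !mul0r !addr0.
      by rewrite /ker X0 /= rmorph0 mulr0 mul0r subrr mul0r mulr0.
    + by apply: sym; exact: ord11.
    + exact: ord11.
    + exact: lim_uu.
(* block_neg_ge applies with the vector y0 e_0 + u of the hyperbolic plane,
   whose square 2 y0 ^ 2 is negative since y0 is imaginary *)
have gG : neg_ge G k.+1.
  pose e1 : S' := inr (lift ord0 ord0).
  pose w t := (cc (pts t))^-1 / disc (pts t).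
  pose pY (r : 'I_1 + T) : 'I_3 -> S' := match r with
    | inl _ => ord3 (inr ord0) (inr ord0) e1 | inr t => ord3 (inl t) (inr ord0) e1 end.
  pose cY (r : 'I_1 + T) : 'I_3 -> C := match r with
    | inl _ => ord3 0 y0 1 | inr t => ord3 (w t) (- at_ t * w t) (- bt_ t * w t) end.
  apply: (neg_ge_cong (X := fun r => spread (pY r) (cY r))).
  pose H (i j : 'I_1) : C := 2 * y0 * y0.
  have hH : neg_ge H 1.
    exists (fun i j => 1) => c [i ci].
    rewrite /quad /sform /H !big_ord1 /comb !big_ord1 !mulr1.
    have ey : 2 * y0 * y0 = (- (8 * complex.Im z0 ^+ 2))%:C.
      rewrite /y0; case: (z0) => p q; apply/eqP; rewrite eq_complex /=.
      by apply/andP; split; apply/eqP; ring.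
    rewrite -mulrA mulcJ ey -rmorphM /= mulNr oppr_lt0 mulr_gt0 //.
      by rewrite mulr_gt0 // exprn_gt0.
    have <- : i = ord0 by rewrite (ord1 i).
    by rewrite exprn_gt0 // normc_gt0.
  have := block_neg_ge (fun _ _ => 0) hH hk.
  rewrite add1n; apply: eq_neg_ge => r r'.
  have z0y : z0 - z0^* = y0 by [].
  rewrite /cong sform_spread !sum_ord3.
  case: r => [i|t]; case: r' => [j|t']; rewrite /pY /cY /ord3 /=.
  - rewrite addr0 form_delta /H !rmorph0 rmorph1 conj_y0; ring.
  - rewrite addr0 /sform big1 ?addr0; last first.
      by move=> p _; rewrite big1 // => q _; rewrite rmorph0 mulr0.
    by rewrite !(rmorphM, rmorphN) /=; ring.
  - rewrite addr0 /sform big1 ?addr0; last first.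
      by move=> p _; rewrite big1 // => q _; rewrite mulr0 mul0r.
    by rewrite !rmorph0 rmorph1 conj_y0; ring.
  - rewrite /sform big1 ?add0r; last first.
      by move=> p _; rewrite big1 // => q _; rewrite mulr0 mul0r.
    have nt1 := disc_neq0 (ut t) (nt t); have nt2 := disc_neq0 (ut t') (nt t').
    have c1 : cc (pts t) != 0 by apply: upper_sub_neq0.
    have c2 : cc (pts t') != 0 by apply: upper_sub_neq0.
    have [_ dd] := kdiscE (ut t) (ut t').
    have c2' : (cc (pts t'))^* != 0 by rewrite conjC_eq0.
    have n2' : (disc (pts t'))^* != 0 by rewrite conjC_eq0.
    have kE : gram (ker X) pts t t' = (cc (pts t))^-1 * ((cc (pts t'))^*)^-1 *
        (- y0 * kdisc (pts t) (pts t')).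
      by rewrite -kcc // /gram; move: (ker _ _ _) => K; field; rewrite c1 c2'.
    rewrite kE /kdisc /at_ /bt_ /w; move: dd nt1 n2' c1 c2'; clear.
    move: (disc (pts t)) (disc (pts t')) (cc (pts t)) (cc (pts t')) (y0) => D D' c c' y.
    move: (X (pts t)).1 (X (pts t)).2 (X (pts t')).1 (X (pts t')).2 => u v u' v' dd D0 D0' cn cn'.
    move: dd; rewrite !(rmorphM, rmorphN, fmorphV) /= => dd.
    by field; rewrite dd D0 D0' cn cn'.
have [n /neg_ge_cong h] := filter_ex (neg_ge_near hG limG gG).
by exists S, (P n); split=> // s; exact: uP.
Qed.

End Removable.

(** * Meromorphic functions in homogeneous coordinates *)

Section Meromorphic.
Variable R : realType.
Local Notation C := R[i].
Local Notation V2 := (C * C)%type.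

Lemma cvgCP (U : Type) (F : set_system U) {FF : Filter F} (f : U -> C) (l : C) :
  ((f u : C^o) @[u --> F] --> (l : C^o)) <->
  (forall e : R, 0 < e -> \forall u \near F, normc (f u - l) < e).
Proof.
split.
  move=> /(@cvgrPdist_lt _ C^o) h e e0; have := h e%:C; rewrite ltcR => /(_ e0).
  apply: filterS => u; rewrite -[`|_|]/((normc _)%:C) ltcR.
  by rewrite -normcN opprB.
move=> h; apply/(@cvgrPdist_lt _ C^o) => -[e e'] /=; rewrite ltcE /= => /andP[/eqP -> e0].
apply: filterS (h e e0) => u; rewrite -[`|_|]/((normc _)%:C) ltcR.
by rewrite -normcN opprB.
Qed.

Lemma nbhsCP (z0 : C^o) (P : set C^o) :
  (\forall z \near z0, P z) <-> exists2 e : R, 0 < e & forall z, normc (z - z0) < e -> P z.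
Proof.
split.
  move=> /(@nbhs_normP _ C^o) [[e e']] /=; rewrite ltcE /= => /andP[/eqP -> e0] h.
  exists e => // z hz; apply: h; rewrite /ball_ /= -[`|_|]/((normc _)%:C) ltcR.
  by rewrite -normcN opprB.
move=> [e e0 h]; apply/(@nbhs_normP _ C^o); exists e%:C; first by rewrite /= ltcR.
move=> z; rewrite /ball_ /= -[`|_|]/((normc _)%:C) ltcR => hz; apply: h.
by rewrite -normcN opprB.
Qed.

Lemma Im_abs_le (x : C) : `|complex.Im x| <= normc x.
Proof.
rewrite ler_norml Im_le_normc andbT lerNl -cImN -(normcN x); exact: Im_le_normc.
Qed.

Lemma normc_le_ReIm (x : C) : normc x <= `|complex.Re x| + `|complex.Im x|.
Proof.
have e : x = (complex.Re x)%:C + imag 1 * (complex.Im x)%:C.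
  by case: x => a b; apply/eqP; rewrite eq_complex /=; apply/andP; split; apply/eqP; ring.
rewrite {1}e; apply: le_trans (le_normcD _ _) _.
by rewrite normcM !normc_real normc_imag normr1 mul1r.
Qed.

Lemma dnbhsCP (z0 : C^o) (P : set C^o) :
  (\forall z \near z0^', P z) <-> (\forall z \near z0, z != z0 -> P z).
Proof. by []. Qed.

Lemma dnbhs_neq (z0 : C^o) : \forall z \near z0^', z != z0.
Proof. by apply: (dnbhsCP _ _).2; apply/(nbhsCP _ _).2; exists 1. Qed.

Lemma dnbhs_ex (z0 : C^o) (P : set C^o) : (\forall z \near z0^', P z) -> exists z, P z.
Proof. exact: filter_ex. Qed.

Lemma derivable_quotient (f : C -> C) (z0 l : C) :
  ((f z - f z0) / (z - z0) : C^o) @[z --> (z0 : C^o)^'] --> (l : C^o) ->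
  derivable (f : C^o -> C^o) z0 1.
Proof.
move=> h; apply/cvg_ex; exists (l : C^o); apply/cvgCP => e e0.
have [d d0 hd] := (nbhsCP _ _).1 ((dnbhsCP _ _).1 ((cvgCP _ _).1 h e e0)).
apply/(dnbhsCP _ _).2/(nbhsCP _ _).2; exists d => // x; rewrite subr0 => hx x0.
rewrite /= [_%:A]mulr1.
have e1 : x + z0 - z0 = x by rewrite addrK.
have := hd (x + z0); rewrite e1 => /(_ hx); rewrite -subr_eq0 e1 => /(_ x0).
by rewrite mulrC.
Qed.

Lemma upper_open (z0 : C^o) : upper z0 -> \forall z \near z0, upper z.
Proof.
rewrite /upper /= => h; apply/nbhsCP; exists (complex.Im z0) => // z hz.
have : complex.Im (- (z - z0)) < complex.Im z0.
  by apply: le_lt_trans (Im_le_normc _) _; rewrite normcN.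
by rewrite cImN cImD cImN /=; lra.
Qed.

Lemma cauchy_cvgC (U : Type) (F : set_system U) {FF : ProperFilter F} (q : U -> C) :
  (forall e : R, 0 < e -> exists2 P : set U, F P &
     forall x y, P x -> P y -> normc (q x - q y) < e) ->
  exists l : C, (q u : C^o) @[u --> F] --> (l : C^o).
Proof.
move=> h.
have real (g : C -> R) : (forall a b, g (a - b) = g a - g b) ->
    (forall a, `|g a| <= normc a) ->
    exists l : R, (g (q u) : R) @[u --> F] --> l.
  move=> gB gle; suff : cvg (g (q u) @[u --> F]) by move=> ?; eexists; eassumption.
  apply/cauchy_cvgP; apply: cauchy_exP => e e0.
  have [P FP hP] := h e e0; have [x0 Px0] := filter_ex FP.
  exists (g (q x0)); apply: (filterS (P := P)) FP => u Pu /=.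
  by rewrite /ball /= -gB; apply: le_lt_trans (gle _) (hP _ _ _ _).
have [a ha] : exists a : R, complex.Re (q u) @[u --> F] --> a.
  by apply: real; [move=> a b; rewrite cReD cReN|exact: Re_le_normc].
have [b hb] : exists b : R, complex.Im (q u) @[u --> F] --> b.
  by apply: real; [move=> b c; rewrite cImD cImN|exact: Im_abs_le].
exists (a +i* b); apply/cvgCP => e e0.
move/cvgrPdist_lt: ha => /(_ (e / 2)) ha; move/cvgrPdist_lt: hb => /(_ (e / 2)) hb.
have e2 : 0 < e / 2 by lra.
near=> u; apply: le_lt_trans (normc_le_ReIm _) _.
rewrite !(cReD, cReN, cImD, cImN) /=.
have h1 : `|a - complex.Re (q u)| < e / 2 by near: u; exact: ha.
have h2 : `|b - complex.Im (q u)| < e / 2 by near: u; exact: hb.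
rewrite (distrC _ a) (distrC _ b); move: (`|_|) (`|_|) h1 h2 => p1 p2; lra.
Unshelve. all: by end_near.
Qed.

(** This stands in for the removable singularity theorem: without a limit of
    the difference quotient, two sequences with separated quotients would
    raise the index by hyperbolic_plane. *)
Lemma removable (X : C -> V2) (z0 : C) k (T : finType) (pts : T -> C) :
  upper z0 -> X z0 = (1, 0) ->
  (forall t, upper (pts t)) -> (forall t, pts t != z0) ->
  neg_ge (gram (ker X) pts) k -> idx_le (ker X) k ->
  (\forall z \near (z0 : C^o)^', (X z).1 != 0) ->
  (hval X z : C^o) @[z --> (z0 : C^o)^'] --> (0 : C^o) ->
  derivable (hval X : C^o -> C^o) z0 1.
Proof.
move=> u0 X0 ut nt hk lk X1 h0.
pose q z := hval X z / disc z0 z.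
have y0 : z0 - z0^* != 0 by apply: upper_sub_neq0.
have niceF : \forall z \near (z0 : C^o)^', nice X z0 z.
  near=> z; split; first by near: z; apply: nbhs_dnbhs; exact: upper_open.
    by near: z; exact: dnbhs_neq.
  by near: z.
have [l hl] : exists l : C, (q z : C^o) @[z --> (z0 : C^o)^'] --> (l : C^o).
  apply: cauchy_cvgC => e e0; apply: contrapT => hn.
  have step n : exists ab : C * C, [/\ nice X z0 ab.1, nice X z0 ab.2,
      [/\ normc (ab.1 - z0) < n.+1%:R^-1 & normc (hval X ab.1) < n.+1%:R^-1],
      [/\ normc (ab.2 - z0) < n.+1%:R^-1 & normc (hval X ab.2) < n.+1%:R^-1] &
      e <= normc (q ab.1 - q ab.2)].
    apply: contrapT => hab; apply: hn.
    exists [set z | nice X z0 z /\ (normc (z - z0) < n.+1%:R^-1 /\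
       normc (hval X z) < n.+1%:R^-1)].
      have n0 : 0 < n.+1%:R^-1 :> R by rewrite invr_gt0.
      near=> z; split; first by near: z.
      split; last by rewrite -[hval _ _]subr0; near: z; exact: (cvgCP _ _).1 h0 _ n0.
      near: z; apply: nbhs_dnbhs; apply/nbhsCP; by exists n.+1%:R^-1.
    move=> x y [nx [x1 x2]] [ny [y1 y2]]; rewrite ltNge; apply/negP => le.
    by apply: hab; exists (x, y).
  have [ab hab] := choice step.
  have cv (f : nat -> C) (m : C) : (forall n, normc (f n - m) < n.+1%:R^-1) ->
      (f n : C^o) @[n --> \oo] --> (m : C^o).
    move=> hf; apply/cvgCP => d d0; near=> n; apply: lt_trans (hf n) _.
    by near: n; exact: near_infty_natSinv_lt (PosNum d0).
  have : idx_ge (ker X) k.+1.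
    apply: (@hyperbolic_plane _ _ _ u0 X0 _ _ _ _ \oo _
      (fun n => (ab n).1) (fun n => (ab n).2) _ ut nt hk e0).
    - by move=> n; have [] := hab n.
    - by move=> n; have [] := hab n.
    - by apply: cv => n; have [_ _ [] ] := hab n.
    - by apply: cv => n; have [_ _ _ [] ] := hab n.
    - by apply: cv => n; rewrite subr0; have [_ _ [] ] := hab n.
    - by apply: cv => n; rewrite subr0; have [_ _ _ [] ] := hab n.
    - by move=> n; have [] := hab n.
  by move=> /idx_ge_le /(_ lk); rewrite ltnn.
apply: (derivable_quotient (l := l / (z0 - z0^*))).
apply: (cvg_near_eq (f := fun z => q z / (z - z0^*))); last first.
  apply: cvgM; first exact: hl.
  apply: cvgV; first exact: y0.
  by apply: cvgB; [exact: nbhs_dnbhs|exact: cvg_cst].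
near=> z.
have [uz zz _] : nice X z0 z by near: z.
have nz := upper_sub_neq0 uz u0; have nz' : z - z0 != 0 by rewrite subr_eq0.
rewrite /q /disc {3}/hval X0 /= mul0r oppr0 subr0; field.
by rewrite nz' nz.
Unshelve. all: by end_near.
Qed.

Notation cdiff f z := (derivable (f : C^o -> C^o) z 1).

Lemma cdiff_quotient (f : C -> C) (z0 : C) : cdiff f z0 ->
  exists l : C, ((f z - f z0) / (z - z0) : C^o) @[z --> (z0 : C^o)^'] --> (l : C^o).
Proof.
move=> /cvg_ex [l h]; exists l; apply/cvgCP => e e0.
have [d d0 hd] := (nbhsCP _ _).1 ((dnbhsCP _ _).1 ((cvgCP _ _).1 h e e0)).
apply/(dnbhsCP _ _).2/(nbhsCP _ _).2; exists d => // x hx x0.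
have := hd (x - z0); rewrite subr0 => /(_ hx); rewrite subr_eq0 => /(_ x0).
by rewrite /= [_%:A]mulr1 subrK mulrC.
Qed.

Lemma cdiff_cvg (f : C -> C) (z0 : C) : cdiff f z0 ->
  (f z : C^o) @[z --> (z0 : C^o)] --> (f z0 : C^o).
Proof. by move=> /derivable1_diffP /differentiable_continuous. Qed.

Lemma cdiff_near (f : C -> C) (z0 : C) (e : R) : cdiff f z0 -> 0 < e ->
  \forall z \near (z0 : C^o), normc (f z - f z0) < e.
Proof. by move=> /cdiff_cvg /cvgCP; apply. Qed.

Lemma near_near (z0 : C^o) (P : set C^o) :
  (\forall z \near z0, P z) -> \forall z \near z0, \forall w \near z, P w.
Proof.
move=> /nbhsCP [e e0 h]; apply/nbhsCP; exists e => // z hz; apply/nbhsCP.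
exists (e - normc (z - z0)); first by rewrite subr_gt0.
move=> w hw; apply: h; have -> : w - z0 = (w - z) + (z - z0) by ring.
by apply: le_lt_trans (le_normcD _ _) _; lra.
Qed.

Lemma near_conj (z0 : C^o) (P : set C^o) :
  (\forall z \near z0, P z) -> \forall z \near (z0^* : C^o), P (z^* : C).
Proof.
move=> /nbhsCP [e e0 h]; apply/nbhsCP; exists e => // z hz; apply: h.
by rewrite -[z0]conjCK -rmorphB normcJR.
Qed.

Lemma cdiff_conj (f : C -> C) (z0 : C) : cdiff f z0 ->
  cdiff (fun z => (f z^*)^* : C) (z0^* : C).
Proof.
move=> /cdiff_quotient [l h]; apply: (derivable_quotient (l := l^*)).
apply/cvgCP => e e0; apply/(dnbhsCP _ _).2.
apply: filterS (near_conj ((dnbhsCP _ _).1 ((cvgCP _ _).1 h e e0))) => z hz zz.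
have zz' : z^* != z0 by apply: contraNneq zz => <-; rewrite conjCK.
have := hz zz'; rewrite -normcJR rmorphB rmorphM fmorphV !rmorphB /= !conjCK.
exact.
Qed.

Lemma accumulation_points (P : set C) (z0 : C^o) n :
  (forall Q : set C^o, (\forall z \near z0^', Q z) -> exists2 z, P z & Q z) ->
  exists s : seq C, [/\ size s = n, uniq s & forall z, z \in s -> P z].
Proof.
move=> h; suff [s [ss us ps _]] : exists s : seq C,
    [/\ size s = n, uniq s, forall z, z \in s -> P z & \forall z \near z0^', z \notin s].
  by exists s.
elim: n => [|n [s [ss us ps ns]]].
  by exists [::]; split=> //; apply: filterS (dnbhs_neq z0).
have [z Pz Qz] := h _ (filterI ns (dnbhs_neq z0)).
exists (z :: s); split=> /=; first by rewrite ss.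
- by rewrite us Qz.1.
- by move=> w; rewrite inE => /orP [/eqP ->|/ps].
have nz : \forall w \near z0^', w != z.
  apply: (dnbhsCP _ _).2; apply/nbhsCP; exists (normc (z - z0)).
    by rewrite normc_gt0 subr_eq0 Qz.2.
  by move=> w hw _; apply: contraTneq hw => ->; rewrite ltxx.
by apply: filterS (filterI ns nz) => w [w1 w2]; rewrite inE negb_or w2.
Qed.

Definition homog (t : option C) : V2 := if t is Some w then (w, 1) else (1, 0).
Definition ofhomog (X : V2) : option C := if X.2 == 0 then None else Some (X.1 / X.2).

Lemma homogK t : ofhomog (homog t) = t.
Proof. by case: t => [w|] //=; rewrite /ofhomog /= ?oner_eq0 ?eqxx // divr1. Qed.

Lemma hom_ofhom (X : V2) : (X.1 != 0) || (X.2 != 0) ->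
  exists2 c : C, c != 0 & X = (c * (homog (ofhomog X)).1, c * (homog (ofhomog X)).2).
Proof.
case: X => u v /=; rewrite /ofhomog /=; case: (eqVneq v 0) => [->|v0] /=.
  by rewrite orbF => u0; exists u; rewrite // mulr1 mulr0.
by move=> _; exists v; rewrite //= mulr1 mulrC divfK.
Qed.

(** Near z0, f is a quotient of differentiable functions without common zeros.
    Contrary to the alternative between holomorphy and pole, this property is
    visibly preserved by invertible polynomial transformations. *)
Definition local_coords (f : C -> option C) (z0 : C) (u v : C -> C) : Prop :=
  \forall z \near (z0 : C^o), [/\ cdiff u z, cdiff v z, (u z != 0) || (v z != 0) &
     f z = ofhomog (u z, v z)].

Definition has_coords f z0 := exists u v, local_coords f z0 u v.

Definition meromorphic_at (f : C -> option C) z := holomorphic_at f z \/ pole_at f z.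

(** Coordinates that are continuous at z0, be it a point of holomorphy or a
    pole. *)
Definition chart (f : C -> option C) (z0 z : C) : V2 :=
  if f z0 is Some _ then (fin f z, 1) else (1, (fin f z)^-1).

Lemma holomorphic_at_Some (f : C -> option C) z : holomorphic_at f z -> f z = Some (fin f z).
Proof.
move=> /nbhs_singleton [+ _]; rewrite /fin; by case: (f z).
Qed.

Lemma chart_cvg f z0 : meromorphic_at f z0 ->
  ((chart f z0 z).1 : C^o) @[z --> (z0 : C^o)^'] --> ((homog (f z0)).1 : C^o) /\
  ((chart f z0 z).2 : C^o) @[z --> (z0 : C^o)^'] --> ((homog (f z0)).2 : C^o).
Proof.
move=> [h|[e _ h]]; rewrite /chart.
  have e := holomorphic_at_Some h; rewrite e /=; split; last exact: cvg_cst.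
  have [_ /cdiff_cvg hd] := nbhs_singleton h.
  move: hd => /cvgCP hd; apply/cvgCP => d d0; apply: nbhs_dnbhs; exact: hd.
rewrite e /=; split; first exact: cvg_cst.
apply/cvgCP => d d0; apply: filterS ((cvgryPgt _).1 h d^-1) => z hz; rewrite subr0 normcV invf_plt ?posrE //.
by apply: lt_trans hz; rewrite invr_gt0.
Qed.

Lemma chart_scale f z0 : meromorphic_at f z0 ->
  \forall z \near (z0 : C^o)^', holomorphic_at f z /\
    exists2 c : C, c != 0 & chart f z0 z = (c * (homog (f z)).1, c * (homog (f z)).2).
Proof.
move=> [h|[e hd h]]; rewrite /chart.
  rewrite (holomorphic_at_Some h); apply: nbhs_dnbhs.
  apply: filterS (near_near h) => z hz; split; first exact: hz.
  by exists 1; rewrite ?oner_eq0 // (holomorphic_at_Some hz) /= !mul1r.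
rewrite e; apply: filterS (filterI hd ((cvgryPgt _).1 h 0)) => z [hz]; rewrite normc_gt0 => z0'; split=> //.
exists (fin f z)^-1; first by rewrite invr_eq0.
by rewrite (holomorphic_at_Some hz) /= mulr1 mulVf.
Qed.

Lemma gram_scale (T : finType) (X Y : T -> V2) (p : T -> C) (c : T -> C) k :
  (forall t, c t != 0) -> (forall t, X t = (c t * (Y t).1, c t * (Y t).2)) ->
  neg_ge (fun s t => ((X s).1 * ((X t).2)^* - (X s).2 * ((X t).1)^*) / (p s - (p t)^*)) k ->
  neg_ge (fun s t => ((Y s).1 * ((Y t).2)^* - (Y s).2 * ((Y t).1)^*) / (p s - (p t)^*)) k.
Proof.
move=> c0 e h; apply: (neg_ge_cong (X := fun s t => c s * (s == t)%:R)).
apply: eq_neg_ge h => s t; rewrite cong_scale !e /= !rmorphM /=; ring.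
Qed.

(** The class N_kappa is tested at points of holomorphy only. By lower
    semicontinuity, poles can be moved to regular points nearby without losing
    negative squares. *)
Lemma perturb f (T : finType) (pts : T -> C) k :
  (forall z, upper z -> meromorphic_at f z) -> (forall t, upper (pts t)) ->
  neg_ge (gram (ker (homog \o f)) pts) k ->
  exists2 pts' : T -> C, forall t, upper (pts' t) /\ holomorphic_at f (pts' t) &
    neg_ge (gram (ker (homog \o f)) pts') k.
Proof.
move=> mf up hk.
have shift (z0 : C) (P : set C^o) : (\forall z \near (z0 : C^o)^', P z) ->
    \forall h \near (0 : C^o)^', P (z0 + h).
  move=> /(dnbhsCP _ _).1 /nbhsCP [e e0 he]; apply/(dnbhsCP _ _).2/nbhsCP; exists e => //.
  move=> h; rewrite subr0 => hh h0; apply: he; first by rewrite addrC addKr.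
  by rewrite -subr_eq0 addrC addKr.
pose Y h t := chart f (pts t) (pts t + h).
pose B h s t := ((Y h s).1 * ((Y h t).2)^* - (Y h s).2 * ((Y h t).1)^*) /
   ((pts s + h) - (pts t + h)^*).
have lim (s t : T) : (B h s t : C^o) @[h --> (0 : C^o)^'] -->
    (gram (ker (homog \o f)) pts s t : C^o).
  have l1 t' : ((Y h t').1 : C^o) @[h --> (0 : C^o)^'] --> ((homog (f (pts t'))).1 : C^o).
    apply/cvgCP => e e0; have [/cvgCP h1 _] := chart_cvg (mf _ (up t')).
    exact: shift (h1 e e0).
  have l2 t' : ((Y h t').2 : C^o) @[h --> (0 : C^o)^'] --> ((homog (f (pts t'))).2 : C^o).
    apply/cvgCP => e e0; have [_ /cvgCP h1] := chart_cvg (mf _ (up t')).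
    exact: shift (h1 e e0).
  have l3 t' : (pts t' + h : C^o) @[h --> (0 : C^o)^'] --> (pts t' : C^o).
    apply/cvgCP => e e0; apply: (shift _ (fun z => normc (z - pts t') < e)).
    by apply: nbhs_dnbhs; apply/nbhsCP; exists e.
  rewrite /gram /ker /=; apply: cvgM.
    apply: cvgB; apply: cvgM.
    - exact: l1.
    - exact: cvg_conj (l2 t).
    - exact: l2.
    - exact: cvg_conj (l1 t).
  apply: cvgV; first by apply: upper_sub_neq0.
  by apply: cvgB; [exact: l3|exact: cvg_conj (l3 t)].
have hB : \forall h \near (0 : C^o)^', neg_ge (B h) k.
  by apply: (neg_ge_near _ lim hk); exact: herm_gram.
have hP : \forall h \near (0 : C^o)^', forall t, upper (pts t + h) /\
    (holomorphic_at f (pts t + h) /\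
     exists2 c : C, c != 0 & Y h t = (c * (homog (f (pts t + h))).1, c * (homog (f (pts t + h))).2)).
  apply: filter_forall => t; apply: (shift _ (fun z => upper z /\ (holomorphic_at f z /\
     exists2 c : C, c != 0 & chart f (pts t) z = (c * (homog (f z)).1, c * (homog (f z)).2)))).
  by apply: filterI; [apply: nbhs_dnbhs; exact: upper_open|exact: chart_scale (mf _ (up t))].
have [h [hk' hu]] := dnbhs_ex (filterI hB hP).
have u1 t := (hu t).1; have u2 t := (hu t).2.1; have u3 t := (hu t).2.2.
have [c hc] := choice (fun t => let: ex_intro2 c c0 e := u3 t in ex_intro _ c (conj c0 e)).
exists (fun t => pts t + h) => //.
by apply: (gram_scale (c := c) _ _ hk') => t; have [] := hc t.
Qed.

Lemma cdiff_inv (f : C -> C) (z : C) : f z != 0 -> cdiff f z -> cdiff (fun z => (f z)^-1) z.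
Proof. exact: derivableV. Qed.

Definition is_idx K k := @idx_le R K k /\ @idx_ge R K k.

Lemma is_idx_uniq K a b : is_idx K a -> is_idx K b -> a = b.
Proof.
by move=> [h1 h2] [h3 h4]; apply/eqP; rewrite eqn_leq (idx_ge_le h2 h3) (idx_ge_le h4 h1).
Qed.

Lemma nevanlinna_kernel_gram f n (z : 'I_n -> C) :
  (forall i, holomorphic_at f (z i)) ->
  forall i j, nevanlinna_kernel f z i j = gram (ker (homog \o f)) z i j.
Proof.
move=> h i j; rewrite mxE /gram /ker /= !(holomorphic_at_Some (h _)) /=.
by rewrite rmorph1 mulr1 mul1r.
Qed.

Lemma gram_ord (K : C -> C -> C) (T : finType) (pts : T -> C) k :
  neg_ge (gram K pts) k ->
  neg_ge (gram K (fun i : 'I_#|T| => pts (enum_val i))) k.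
Proof.
move=> h; apply: (neg_ge_cong (X := fun s i => (enum_rank s == i)%:R)).
by apply: eq_neg_ge h => s t; rewrite /cong form_delta /gram !enum_rankK.
Qed.

Lemma nevanlinna_index_le kappa f : nevanlinna kappa f -> idx_le (ker (homog \o f)) kappa.
Proof.
move=> [mf _ hle _] T pts up.
have mf' z : upper z -> meromorphic_at f z.
  by move=> uz; apply: mf; rewrite /nonreal /= gt_eqF.
have [k k1 k2] := inertia (herm_gram (homog \o f) pts).
have [pts' hp /gram_ord k3] := perturb mf' up k2.
have [m mk /neg_squares_neg [m1 _]] := hle _ _ (fun i : 'I_#|T| => hp (enum_val i)).
apply: neg_le_mono mk _; apply: neg_le_mono k1; apply: neg_ge_le k3 _.
by apply: eq_neg_le m1 => i j; apply: nevanlinna_kernel_gram => l; have [] := hp (enum_val l).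
Qed.

Lemma nevanlinna_index_ge kappa f : nevanlinna kappa f ->
  exists (T : finType) (pts : T -> C), (forall t, upper (pts t) /\ holomorphic_at f (pts t)) /\
    neg_ge (gram (ker (homog \o f)) pts) kappa.
Proof.
move=> [_ _ _ [n [z [hz /neg_squares_neg [_ h]]]]]; exists 'I_n, z; split=> //.
by apply: eq_neg_ge h => i j; apply: nevanlinna_kernel_gram => l; have [] := hz l.
Qed.

Lemma nevanlinna_index kappa f : nevanlinna kappa f -> is_idx (ker (homog \o f)) kappa.
Proof.
move=> h; split; first exact: nevanlinna_index_le.
have [T [pts [hp hk]]] := nevanlinna_index_ge h; exists T, pts; split=> // t.
by have [] := hp t.
Qed.

Lemma meromorphic_nevanlinna kappa f : meromorphic_nonreal f -> real_symmetric f ->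
  is_idx (ker (homog \o f)) kappa -> nevanlinna kappa f.
Proof.
move=> mf sf [h1 h2].
have mf' z : upper z -> meromorphic_at f z.
  by move=> uz; apply: mf; rewrite /nonreal /= gt_eqF.
have hH n (z : 'I_n -> C) : (forall i, upper (z i) /\ holomorphic_at f (z i)) ->
    herm (fun i j => nevanlinna_kernel f z i j).
  move=> hz i j; rewrite !nevanlinna_kernel_gram; first exact: herm_gram.
  - by move=> l; have [] := hz l.
  - by move=> l; have [] := hz l.
split=> // [n z hz|].
  have [m hm] := neg_squares_exists (hH _ _ hz).
  exists m => //; have [_ m2] := neg_squares_neg hm; apply: neg_ge_le m2 _.
  apply: (eq_neg_le _ (h1 _ z (fun i => (hz i).1))) => i j.
  by rewrite nevanlinna_kernel_gram // => l; have [] := hz l.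
case: h2 => T [pts [up hk]]; have [pts' hp /gram_ord k3] := perturb mf' up hk.
exists #|T|, (fun i : 'I_#|T| => pts' (enum_val i)).
have hz (i : 'I_#|T|) := hp (enum_val i).
split=> //; apply: neg_squaresP; first exact: hH.
  apply: (eq_neg_le _ (h1 _ _ (fun i => (hz i).1))) => i j.
  by rewrite nevanlinna_kernel_gram // => l; have [] := hz l.
apply: eq_neg_ge k3 => i j.
by rewrite nevanlinna_kernel_gram // => l; have [] := hz l.
Qed.

(** At a pole the coordinates are 1 and 1 / f, the latter differentiable by
    removable. *)
Lemma nevanlinna_coords kappa f z0 : nevanlinna kappa f -> upper z0 -> has_coords f z0.
Proof.
move=> hf u0; have [mf _ _ _] := hf.
have : meromorphic_at f z0 by apply: mf; rewrite /nonreal /= gt_eqF.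
case=> [h|hp].
  exists (fin f), (fun=> 1); apply: filterS (near_near h) => z hz.
  have [_ dz] := nbhs_singleton hz.
  split; [exact: dz|exact: derivable_cst|by rewrite oner_eq0 orbT|].
  by rewrite (holomorphic_at_Some hz) /ofhomog /= oner_eq0 divr1.
have [e hd h] := hp.
have e0 : fin f z0 = 0 by rewrite /fin e.
have hs := chart_scale (or_intror hp : meromorphic_at f z0).
have d0 : cdiff (fun z => (fin f z)^-1) z0.
  have [T [pts [hpt hk]]] := nevanlinna_index_ge hf.
  have c0 : {near (z0 : C^o), (fun z => - hval (homog \o f) z) =1 (fun z => (fin f z)^-1 : C^o)}.
    apply/nbhsCP; have [d dd hd'] := (nbhsCP _ _).1 ((dnbhsCP _ _).1 hd).
    exists d => // z hz; case: (eqVneq z z0) => [->|zz].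
      by rewrite /hval /= e /= mul0r !oppr0 e0 invr0.
    by rewrite /hval /= (holomorphic_at_Some (hd' z hz zz)) /= opprK mul1r.
  apply: (@near_eq_derivable _ C^o C^o _ _ _ _ c0); apply: (@derivableN _ C^o C^o).
  apply: (removable u0 _ _ _ hk (nevanlinna_index_le hf)).
  - by rewrite /= e.
  - by move=> t; have [] := hpt t.
  - move=> t; apply: contra_eqN e => /eqP <-; have [_ ht] := hpt t.
    by rewrite (holomorphic_at_Some ht).
  - apply: filterS (filterI hd ((cvgryPgt _).1 h 0)) => z [hz].
    by rewrite normc_gt0 /= (holomorphic_at_Some hz).
  - have [_ h2] := chart_cvg (or_intror hp : meromorphic_at f z0).
    rewrite e /chart e /= in h2.
    rewrite -[X in _ --> X]oppr0; apply: (cvg_near_eq (f := fun z => - (fin f z)^-1)).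
      apply: filterS hd => z hz; by rewrite /hval /= (holomorphic_at_Some hz) /= mul1r.
    by apply: cvgN; exact: h2.
exists (fun=> 1), (fun z => (fin f z)^-1).
apply/nbhsCP; have [d dd hd'] := (nbhsCP _ _).1 ((dnbhsCP _ _).1
  (filterI hd ((cvgryPgt _).1 h 0))).
exists d; first exact: dd.
move=> z hz; have [->|zz] := eqVneq z z0.
  split; [exact: derivable_cst|exact: d0|by rewrite oner_eq0|].
  by rewrite e /ofhomog /= e0 invr0 eqxx.
have [hh] := hd' z hz zz; rewrite normc_gt0 => f0.
split; [exact: derivable_cst| |by rewrite oner_eq0|].
  have [_ dz] := nbhs_singleton hh; exact: (cdiff_inv f0 dz).
by rewrite (holomorphic_at_Some hh) /ofhomog /= invr_eq0 (negPf f0) invrK mul1r.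
Qed.

Lemma ofhom_None (X : V2) : (ofhomog X == None) = (X.2 == 0).
Proof. by rewrite /ofhomog; case: ifP. Qed.

Lemma coords_holomorphic f z0 u v : local_coords f z0 u v -> v z0 != 0 -> holomorphic_at f z0.
Proof.
move=> h v0; have [_ dv _ _] := nbhs_singleton h.
have nv : \forall z \near (z0 : C^o), v z != 0.
  have v0' : 0 < normc (v z0) by rewrite normc_gt0.
  apply: filterS (cdiff_near dv v0') => z; apply: contraTneq => ->.
  by rewrite sub0r normcN ltxx.
apply: filterS (near_near (filterI h nv)) => z hz.
have [[du dv' _ fz] vz] := nbhs_singleton hz.
split; first by rewrite fz ofhom_None.
have e : {near (z : C^o), (fun z => u z * (v z)^-1) =1 (fin f : C^o -> C^o)}.
  apply: filterS hz => w [[_ _ _ fw] vw].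
  by rewrite /fin fw /ofhomog /= (negPf vw).
apply: (@near_eq_derivable _ C^o C^o _ _ _ _ e).
exact: (@derivableM _ C^o u _ _ _ du (cdiff_inv vz dv')).
Qed.

Lemma coords_pole f z0 u v : local_coords f z0 u v -> v z0 = 0 ->
  (\forall z \near (z0 : C^o)^', f z != None) -> pole_at f z0.
Proof.
move=> h v0 fN; have [du dv uv0 fz0] := nbhs_singleton h.
have u0 : u z0 != 0 by move: uv0; rewrite v0 eqxx orbF.
have vN : \forall z \near (z0 : C^o)^', v z != 0.
  apply: filterS (filterI (nbhs_dnbhs h) fN) => z [[_ _ _ ->]].
  by rewrite ofhom_None.
split; first by rewrite fz0 /ofhomog /= v0 eqxx.
  have := near_near h; move=> /nbhs_dnbhs hh.
  apply: filterS (filterI hh vN) => z [hz vz]; exact: (coords_holomorphic hz vz).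
apply/cvgryPgt => A.
have A1 : 0 < `|A| + 1 by rewrite ltr_wpDl.
have n0 : 0 < normc (u z0) by rewrite normc_gt0.
have n2 : 0 < normc (u z0) / 2 by lra.
have n3 : 0 < normc (u z0) / 2 / (`|A| + 1) by rewrite divr_gt0.
have h1 := nbhs_dnbhs (cdiff_near du n2).
have h2 := nbhs_dnbhs (cdiff_near dv n3).
apply: filterS (filterI (filterI h1 h2) (filterI (nbhs_dnbhs h) vN)).
move=> z [[h1z h2z] [[_ _ _ fz] vz]].
rewrite /fin fz /ofhomog /= (negPf vz) -[odflt _ _]/(u z / v z) normcM normcV.
have nv : 0 < normc (v z) by rewrite normc_gt0.
rewrite ltr_pdivlMr //; apply: le_lt_trans (_ : (`|A| + 1) * normc (v z) < _).
  by rewrite ler_wpM2r ?normc_ge0 // (le_trans (ler_norm A)) // lerDl.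
have : normc (v z) < normc (u z0) / 2 / (`|A| + 1) by move: h2z; rewrite v0 subr0.
rewrite ltr_pdivlMr // mulrC => h3; apply: lt_trans h3 _.
have : normc (u z0) <= normc (u z0 - u z) + normc (u z).
  by rewrite -[in X in X <= _](subrK (u z) (u z0)); exact: le_normcD.
rewrite -(normcN (u z0 - u z)) opprB; move: h1z.
by move: (normc (u z - u z0)) (normc (u z0)) (normc (u z)) => a b c; lra.
Qed.

Lemma conj_nonreal (z : C) : nonreal z -> nonreal (z^*).
Proof. by rewrite /nonreal /= cIm_conj oppr_eq0. Qed.

Lemma nonreal_open (z0 : C^o) : nonreal z0 -> \forall z \near z0, nonreal z.
Proof.
rewrite /nonreal /= => h; apply/nbhsCP; exists `|complex.Im z0|; first by rewrite normr_gt0.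
move=> z hz; apply: contraTneq (le_lt_trans (Im_abs_le (z - z0)) hz) => e.
by rewrite cImD cImN e sub0r normrN ltxx.
Qed.

Lemma symmetricE (f : C -> option C) (z : C) : real_symmetric f -> nonreal z ->
  f (z^*) = omap (fun w : C => w^*) (f z).
Proof. by move=> sf nz; exact: sf. Qed.

Lemma holomorphic_conj (f : C -> option C) (z0 : C) :
  real_symmetric f -> nonreal z0 -> holomorphic_at f z0 -> holomorphic_at f (z0^* : C).
Proof.
move=> /symmetricE sf nr h.
have e z : nonreal z -> fin f (z^* : C) = ((fin f z)^* : C).
  by move=> /sf; rewrite /fin => ->; case: (f z) => //=; rewrite rmorph0.
have h2 : \forall z \near (z0 : C^o), (f z != None /\ cdiff (fin f) z) /\ nonreal z.
  by apply: filterI h (nonreal_open nr).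
apply: filterS (near_conj (near_near h2)) => z hz; have [[fz dz] nz] := nbhs_singleton hz.
have nz' : nonreal z by rewrite -[z]conjCK; exact: conj_nonreal.
split.
  by have := sf _ nz; rewrite conjCK => ->; case: (f _) fz.
rewrite -[z]conjCK.
have en : {near ((z^*^* : C) : C^o), (fun w => (fin f (w^* : C))^* : C) =1 (fin f : C^o -> C^o)}.
  rewrite conjCK; apply: filterS (nonreal_open nz') => w nw; rewrite -e ?conjCK //.
  exact: conj_nonreal.
apply: (@near_eq_derivable _ C^o C^o _ _ _ _ en).
exact: (@cdiff_conj (fin f) _ dz).
Qed.

Lemma meromorphic_conj (f : C -> option C) (z0 : C) :
  real_symmetric f -> nonreal z0 -> meromorphic_at f z0 -> meromorphic_at f (z0^* : C).
Proof.
move=> sf nr [h|[fz hd hn]]; first by left; exact: holomorphic_conj.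
have nnr := (dnbhsCP _ _).1 (nbhs_dnbhs (nonreal_open nr)).
right; split; first by rewrite (symmetricE sf nr) fz.
  apply: (dnbhsCP _ _).2.
  apply: filterS (near_conj (filterI nnr ((dnbhsCP _ _).1 hd))) => z [h1 h2] zz.
  have zz' : z^* != z0 by apply: contraNneq zz => <-; rewrite conjCK.
  by rewrite -[z]conjCK; apply: holomorphic_conj; [exact: sf|exact: h1|exact: h2].
apply/cvgryPgt => A; apply: (dnbhsCP _ _).2.
apply: filterS (near_conj (filterI nnr ((dnbhsCP _ _).1 ((cvgryPgt _).1 hn A)))) => z [h1 h2] zz.
have zz' : z^* != z0 by apply: contraNneq zz => <-; rewrite conjCK.
have := h2 zz'; have := symmetricE sf (h1 zz'); rewrite conjCK /fin => ->.
by case: (f _) => //= w; rewrite normcJR.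
Qed.

(** It remains to isolate the zeros of v. If they clustered at a point, f
    would be infinite at any number of points; if f is finite somewhere it is
    finite nearby, and few_infinite forbids both together. *)
Lemma coords_meromorphic f k : real_symmetric f -> idx_le (ker (homog \o f)) k ->
  (forall z, upper z -> has_coords f z) ->
  meromorphic_nonreal f \/ (forall z, nonreal z -> f z = None).
Proof.
move=> sf hk hc.
have [hN|hN] := pselect (forall z, upper z -> f z = None).
  right=> z nz; have [u|u] := ltP 0 (complex.Im z); first exact: hN.
  have uz : upper (z^* : C).
    by rewrite /upper /= cIm_conj oppr_gt0 lt_neqAle u andbT.
  by have := symmetricE sf (conj_nonreal nz); rewrite conjCK (hN _ uz).
have [b [ub fb]] : exists b, upper b /\ f b != None.
  apply: contrapT => h; apply: hN => z uz; apply/eqP; apply: contrapT => /negP fz.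
  by apply: h; exists z.
left=> z nz.
suff main z0 : upper z0 -> meromorphic_at f z0.
  have [u|u] := ltP 0 (complex.Im z); first exact: main.
  have uz : upper (z^* : C).
    by rewrite /upper /= cIm_conj oppr_gt0 lt_neqAle u andbT.
  rewrite -[z]conjCK; apply: meromorphic_conj; [exact: sf|exact: conj_nonreal|exact: main].
move=> u0.
have fN : \forall z \near (z0 : C^o)^', f z != None.
  apply: contrapT => hn.
  have [s [ss us hs]] : exists s : seq C, [/\ size s = k.+1, uniq s &
      forall z, z \in s -> upper z /\ f z = None].
    apply: (accumulation_points (z0 := z0)) => Q hQ; apply: contrapT => hz; apply: hn.
    apply: filterS (filterI hQ (nbhs_dnbhs (upper_open u0))) => w [Qw uw].
    by apply/negP => /eqP fw; apply: hz; exists w.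
  have [u' [v' huv]] := hc _ ub.
  have vb : v' b != 0 by have [_ _ _ e] := nbhs_singleton huv; rewrite e ofhom_None in fb.
  have [r [sr ur hr]] : exists s : seq C, [/\ size s = k.+1, uniq s &
      forall z, z \in s -> upper z /\ f z != None].
    apply: (accumulation_points (z0 := b)) => Q hQ.
    have hh := nbhs_dnbhs (coords_holomorphic huv vb).
    have [w [Qw [uw [fw _]]]] := dnbhs_ex (filterI hQ (filterI (nbhs_dnbhs (upper_open ub)) hh)).
    by exists w.
  have inj (q : seq C) : size q = k.+1 -> uniq q -> injective (fun i : 'I_k.+1 => q`_i).
    move=> sq uq i j /eqP; rewrite nth_uniq ?sq //; exact: (fun h => val_inj (eqP h)).
  have mem (q : seq C) (i : 'I_k.+1) : size q = k.+1 -> q`_i \in q.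
    by move=> sq; rewrite mem_nth ?sq.
  apply: (few_infinite hk (inj s ss us) (inj r sr ur)) => i.
  - by have [] := hs _ (mem s i ss).
  - by have [] := hr _ (mem r i sr).
  - by have [_ e] := hs _ (mem s i ss); rewrite /= e.
  - by have [_ e] := hs _ (mem s i ss); rewrite /= e oner_eq0.
  - by have [_] := hr _ (mem r i sr); rewrite /=; case: (f _) => //= w _; rewrite oner_eq0.
have [u [v huv]] := hc _ u0.
have [v0|v0] := eqVneq (v z0) 0; first by right; exact: coords_pole huv v0 fN.
by left; exact: coords_holomorphic huv v0.
Qed.

End Meromorphic.
Arguments homog {R} t.

(** * Moebius transformations with polynomial coefficients *)

Section Moebius.
Variable R : realType.
Local Notation C := R[i].
Local Notation V2 := (C * C)%type.
Notation cdiff f z := (derivable (f : C^o -> C^o) z 1).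

Lemma cdiffM (f g : C -> C) (z : C) : cdiff f z -> cdiff g z -> let h (w : C) : C := f w * g w in cdiff h z.
Proof. exact: (@derivableM _ C^o f g). Qed.

Lemma cdiffD (f g : C -> C) (z : C) : cdiff f z -> cdiff g z -> let h (w : C) : C := f w + g w in cdiff h z.
Proof. exact: (@derivableD _ C^o C^o f g). Qed.

Definition proportional (X Y : V2) : Prop :=
  exists2 c : C, c != 0 & X = (c * Y.1, c * Y.2).

Lemma proportional_sym X Y : proportional X Y -> proportional Y X.
Proof.
move=> [c c0 ->]; exists c^-1; rewrite ?invr_eq0 //= !mulrA mulVf // !mul1r.
by case: Y.
Qed.

Lemma is_idx_scale (X Y : C -> V2) k :
  (forall z, upper z -> proportional (X z) (Y z)) -> is_idx (ker X) k -> is_idx (ker Y) k.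
Proof.
move=> h [h1 h2].
have [c hc] : exists c : C -> C, forall z, upper z -> c z != 0 /\ Y z = (c z * (X z).1, c z * (X z).2).
  have /choice [c hc] z : exists c : C, upper z -> c != 0 /\ Y z = (c * (X z).1, c * (X z).2).
    have [uz|uz] := pselect (upper z); last by exists 0.
    by have [c c0 e] := proportional_sym (h z uz); exists c.
  by exists c.
have e z w : upper z -> upper w -> c z * (c w)^* * ker X z w = ker Y z w.
  move=> /hc [_ ez] /hc [_ ew]; rewrite /ker ez ew /= !rmorphM /=; ring.
split; first exact: (eq_idx_le e (idx_le_scale c h1)).
by apply: (eq_idx_ge e); apply: idx_ge_scale => // z /hc [].
Qed.

Definition zmul (X : C -> V2) : C -> V2 := fun z => (z * (X z).1, (X z).2).

Lemma idx_ge0 K : @idx_ge R K 0.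
Proof.
exists void, (fun=> 0); split; first by case.
by exists (fun i => match i with Ordinal _ h => fun=> 0 end) => c [[]].
Qed.

Lemma upper_neq0 (z : C) : upper z -> z != 0.
Proof. by rewrite /upper /=; apply: contraTneq => ->; rewrite /= ltxx. Qed.

Lemma upper_nonreal (z : C) : upper z -> nonreal z.
Proof. by rewrite /upper /nonreal /= => h; rewrite gt_eqF. Qed.

Lemma zmul_mulz f z : upper z -> proportional (zmul (homog \o f) z) (homog (mulz f z)).
Proof.
move=> uz; rewrite /zmul /mulz /=; case: (f z) => [w|] /=.
  by exists 1; rewrite ?oner_eq0 // !mul1r.
by exists z; rewrite ?upper_neq0 // mulr0.
Qed.

Lemma coords_mulz (f : C -> option C) z0 : upper z0 -> has_coords f z0 -> has_coords (mulz f) z0.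
Proof.
move=> u0 [u [v h]]; exists (fun z => z * u z), v.
apply: filterS (filterI h (upper_open u0)) => z [[du dv uv fz] uz].
have z_neq := upper_neq0 uz; split.
- exact: (@derivableM _ C^o id u _ _ (@derivable_id _ C^o _ _) du).
- exact: dv.
- by rewrite mulf_eq0 (negPf z_neq).
- rewrite /mulz fz /ofhomog /=; case: ifP => //= _; by rewrite mulrA.
Qed.

(** The constant infinity ceases to be exceptional: its coordinates (1, 0)
    give index zero for both kernels. Either case of the definition is
    recovered by coords_meromorphic. *)
Lemma nevanlinna2P (a b : nat) (f : C -> option C) :
  nevanlinna2 (Posz a) (Posz b) f <->
  [/\ real_symmetric f, forall z0, upper z0 -> has_coords f z0,
      is_idx (ker (homog \o f)) a & is_idx (ker (zmul (homog \o f))) b].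
Proof.
split=> [[[ha hb]|[-> -> h]]|[sf hc ha hb]].
- split.
  + by case: ha.
  + by move=> z0; apply: nevanlinna_coords ha.
  + exact: nevanlinna_index.
  + apply: is_idx_scale (nevanlinna_index hb) => z uz; exact/proportional_sym/zmul_mulz.
- have i0 X : (forall z, upper z -> (X z).2 = 0) -> is_idx (@ker R X) 0.
    move=> e; apply: (is_idx_scale (X := fun z => ((X z).1, 0))).
      by move=> z uz; exists 1; rewrite ?oner_eq0 // !mul1r (e z uz).
    by split; [apply: idx_le0|exact: idx_ge0].
  split.
  + by move=> z nz; rewrite !h //; exact: conj_nonreal.
  + move=> z0 u0; exists (fun=> 1), (fun=> 0).
    apply: filterS (upper_open u0) => z uz; split; try exact: derivable_cst.
      by rewrite oner_eq0.
    by rewrite h ?/ofhomog /= ?eqxx //; exact: upper_nonreal.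
  + by apply: i0 => z uz /=; rewrite h //; exact: upper_nonreal.
  + by apply: i0 => z uz /=; rewrite h //; exact: upper_nonreal.
- have hb' : is_idx (ker (homog \o mulz f)) b.
    by apply: is_idx_scale hb => z; exact: zmul_mulz.
  have sf' : real_symmetric (mulz f).
    move=> z nz; rewrite /mulz (sf z nz); case: (f z) => //= w.
    by congr Some; rewrite -rmorphM.
  have hc' z : upper z -> has_coords (mulz f) z.
    by move=> uz; apply: coords_mulz => //; exact: hc.
  have none : (forall z, nonreal z -> f z = None) ->
      nevanlinna2 (Posz a) (Posz b) f.
    move=> hN; right.
    have i0 X : (forall z, upper z -> (X z).2 = 0) -> is_idx (@ker R X) 0.
      move=> e; apply: (is_idx_scale (X := fun z => ((X z).1, 0))).
        by move=> z uz; exists 1; rewrite ?oner_eq0 // !mul1r (e z uz).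
      by split; [apply: idx_le0|exact: idx_ge0].
    split=> //.
      by apply: (is_idx_uniq ha); apply: i0 => z uz /=; rewrite hN //; exact: upper_nonreal.
    by apply: (is_idx_uniq hb); apply: i0 => z uz /=; rewrite hN //; exact: upper_nonreal.
  have [mf|] := coords_meromorphic sf ha.1 hc; last exact: none.
  have [mf'|hN] := coords_meromorphic sf' hb'.1 hc'; last first.
    by apply: none => z /hN; rewrite /mulz; case: (f z).
  by left; split; exact: meromorphic_nevanlinna.
Qed.

Lemma moebius_hom (a b c d : C) (t : option C) : a * d - b * c != 0 ->
  proportional (a * (homog t).1 + b * (homog t).2, c * (homog t).1 + d * (homog t).2)
    (homog (moebius a b c d t)).
Proof.
move=> dn; case: t => [w|] /=; rewrite ?mulr1 ?mulr0 ?addr0.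
  case: eqVneq => [e|e] /=; last by exists (c * w + d); rewrite //= mulr1 [in RHS]mulrC divfK.
  exists (a * w + b); last by rewrite e mulr1 mulr0.
  apply: contra dn => /eqP e'; have [c0|c0] := eqVneq c 0.
    by move: e; rewrite c0 mul0r add0r => ->; rewrite !mulr0 subrr.
  have ew : w = - d / c by rewrite -[d](addKr (c * w)) e addr0 opprK mulrC mulKf.
  have eb : b = - (a * w) by rewrite -[b](addKr (a * w)) e' addr0.
  by rewrite eb ew; apply/eqP; field.
case: eqVneq => [e|e] /=; last by exists c; rewrite //= mulr1 [in RHS]mulrC divfK.
exists a; last by rewrite e mulr1 mulr0.
by apply: contra dn => /eqP ->; rewrite e mul0r mulr0 subrr.
Qed.

Lemma ofhom_proportional X Y : proportional X Y -> ofhomog X = ofhomog Y.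
Proof.
move=> [c c0 ->]; rewrite /ofhomog /= mulf_eq0 (negPf c0) /=; case: eqVneq => //= Y0.
by congr Some; rewrite invfM mulrACA divff // mul1r.
Qed.

Lemma moebiusE (a b c d : C) (t : option C) : a * d - b * c != 0 ->
  moebius a b c d t = ofhomog (a * (homog t).1 + b * (homog t).2, c * (homog t).1 + d * (homog t).2).
Proof. by move=> /(moebius_hom t) /ofhom_proportional ->; rewrite homogK. Qed.

Lemma cdiff_evalC (p : {poly R}) (z : C) : cdiff (evalC p) z.
Proof.
elim/poly_ind: p => [|p c IH].
  rewrite (_ : evalC 0 = (fun=> 0)); first exact: derivable_cst.
  by apply/funext => w; rewrite /evalC rmorph0 horner0.
rewrite (_ : evalC _ = (fun w => evalC p w * w + c%:C)); last first.
  by apply/funext => w; rewrite evalCD evalCM evalCX evalCC.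
apply: (@derivableD _ C^o C^o); last exact: derivable_cst.
exact: (@derivableM _ C^o (evalC p) id _ _ IH (@derivable_id _ C^o _ _)).
Qed.

Definition act (a b c d : {poly R}) (X : C -> V2) : C -> V2 := fun z =>
  (evalC a z * (X z).1 + evalC b z * (X z).2, evalC c z * (X z).1 + evalC d z * (X z).2).

Definition pmoebius (a b c d : {poly R}) (t : C -> option C) : C -> option C := fun z =>
  moebius (evalC a z) (evalC b z) (evalC c z) (evalC d z) (t z).

Lemma evalC_det (a b c d : {poly R}) z : a * d - b * c = 1 ->
  evalC a z * evalC d z - evalC b z * evalC c z != 0.
Proof.
move=> e; rewrite -!evalCM -evalCN -evalCD e.
by rewrite (_ : evalC 1 z = 1) ?oner_eq0 // /evalC rmorph1 hornerC.
Qed.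

Lemma pmoebius_coords a b c d t z : a * d - b * c = 1 ->
  proportional (act a b c d (homog \o t) z) (homog (pmoebius a b c d t z)).
Proof. by move=> /(evalC_det z) /moebius_hom; apply. Qed.

Lemma pmoebiusE a b c d t z : a * d - b * c = 1 ->
  pmoebius a b c d t z = ofhomog (act a b c d (homog \o t) z).
Proof. by move=> /(evalC_det z) /moebiusE; apply. Qed.

Lemma pmoebiusK a b c d t z : a * d - b * c = 1 ->
  pmoebius d (- b) (- c) a (pmoebius a b c d t) z = t z.
Proof.
move=> e; have e' : d * a - (- b) * (- c) = 1 by rewrite -e; ring.
rewrite pmoebiusE // -[RHS]homogK; apply: ofhom_proportional.
have [k k0 ek] := pmoebius_coords t z e; exists k^-1; first by rewrite invr_eq0.
move: ek; rewrite /act /=; case: (homog (pmoebius _ _ _ _ _ _)) => p q /= [e1 e2].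
have ep : p = k^-1 * (k * p) by rewrite mulKf.
have eq : q = k^-1 * (k * q) by rewrite mulKf.
have ed : evalC a z * evalC d z - evalC b z * evalC c z = 1.
  by rewrite -!evalCM -evalCN -evalCD e /evalC rmorph1 hornerC.
rewrite ep eq -e1 -e2 !evalCN; case: (homog (t z)) => u v /=.
by congr (_, _); rewrite -[X in _ = k^-1 * X]mul1r -ed; ring.
Qed.

Lemma pmoebius_symmetric a b c d t : a * d - b * c = 1 -> real_symmetric t ->
  real_symmetric (pmoebius a b c d t).
Proof.
move=> e st z nz; change (pmoebius a b c d t (z^* : C) = omap (fun w : C => w^*) (pmoebius a b c d t z)).
rewrite /pmoebius (symmetricE st nz) -!evalC_conj.
case: (t z) => [w|] /=.
  rewrite -!rmorphM -!rmorphD /= conjC_eq0; case: ifP => //= _.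
  by rewrite -fmorphV -rmorphM.
by rewrite conjC_eq0; case: ifP => //= _; rewrite -fmorphV -rmorphM.
Qed.

Lemma pmoebius_has_coords a b c d t z0 : a * d - b * c = 1 -> has_coords t z0 ->
  has_coords (pmoebius a b c d t) z0.
Proof.
move=> e [u [v h]]; exists (fun z => evalC a z * u z + evalC b z * v z),
  (fun z => evalC c z * u z + evalC d z * v z).
apply: filterS h => z [du dv uv tz].
pose lin p q (w : C) : C := evalC p w * u w + evalC q w * v w.
have dlin p q : cdiff (lin p q) z.
  have h1 := cdiffM (@cdiff_evalC p z) du.
  have h2 := cdiffM (@cdiff_evalC q z) dv.
  exact: cdiffD h1 h2.
split; [exact: dlin|exact: dlin| |].
  apply: contraTT uv; rewrite !negb_or !negbK => /andP [/eqP e1 /eqP e2].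
  have ed : evalC a z * evalC d z - evalC b z * evalC c z = 1.
    by rewrite -!evalCM -evalCN -evalCD e /evalC rmorph1 hornerC.
  have eu : u z = 0.
    rewrite -[u z]mul1r -ed.
    transitivity (evalC d z * (evalC a z * u z + evalC b z * v z) -
      evalC b z * (evalC c z * u z + evalC d z * v z)); first by ring.
    by rewrite e1 e2 !mulr0 subrr.
  have ev : v z = 0.
    rewrite -[v z]mul1r -ed.
    transitivity (evalC a z * (evalC c z * u z + evalC d z * v z) -
      evalC c z * (evalC a z * u z + evalC b z * v z)); first by ring.
    by rewrite e1 e2 !mulr0 subrr.
  by rewrite eu ev eqxx.
rewrite pmoebiusE //; apply: ofhom_proportional.
have [k k0 ek] := @hom_ofhom R (u z, v z) uv; rewrite -tz /= in ek; case: ek => ek1 ek2.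
apply: proportional_sym; exists k => //; rewrite /act /=.
by rewrite ek1 ek2; congr (_, _); ring.
Qed.

End Moebius.

(** * Index of a continued fraction *)

Section Levels.
Variable R : realType.
Local Notation C := R[i].
Local Notation V2 := (C * C)%type.

Lemma idx_le_is_idx K b : (forall z w : C, K w z = (K z w)^*) -> @idx_le R K b ->
  exists2 c, (c <= b)%N & is_idx K c.
Proof.
move=> hK hb.
have ex : exists c, `[< idx_ge K c >] by exists 0%N; apply/asboolP; exact: idx_ge0.
have bd c : `[< idx_ge K c >] -> (c <= b)%N by move=> /asboolP h; exact: idx_ge_le h hb.
case: (ex_maxnP ex bd) => c /asboolP hc mc; exists c; first exact: idx_ge_le hc hb.
split=> // T pts up.
have [k k1 k2] := @inertia R T (gram K pts) (fun s t => hK _ _).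
by apply: neg_le_mono k1; apply: mc; apply/asboolP; exists T, pts.
Qed.

Lemma hankel_sym (s : seq R) n : (hankel s n)^T = hankel s n.
Proof. by apply/matrixP => i j; rewrite !mxE addnC. Qed.

Lemma hankel_plus_sym (s : seq R) n : (hankel_plus s n)^T = hankel_plus s n.
Proof. by apply/matrixP => i j; rewrite !mxE addnC. Qed.

(** The number of negative squares contributed by a shear by p. *)
Definition weight (p : {poly R}) d := nu_minus (hankel_plus p d).

Lemma weight_neg (p : {poly R}) d : neg_le (mxC (hankel_plus p d)) (weight p d) /\
  neg_ge (mxC (hankel_plus p d)) (weight p d).
Proof. exact: nu_minus_neg (hankel_plus_sym _ _). Qed.

Lemma weight0 (p : {poly R}) : weight p 0 = 0%N.
Proof.
have := nu_minus_opp_le (hankel_plus_sym p 0); rewrite leqn0 addn_eq0 => /andP [/eqP]. done.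
Qed.

Lemma weightN (p : {poly R}) d : (weight p d + weight (- p) d <= d)%N.
Proof.
have e : hankel_plus (- p) d = - hankel_plus p d.
  by apply/matrixP => i j; rewrite !mxE coefN.
by rewrite /weight e; exact: nu_minus_opp_le (hankel_plus_sym p d).
Qed.

Lemma weight1 (a : R) : weight ('X * a%:P) 1 = (a < 0).
Proof.
have [h1 h2] := weight_neg ('X * a%:P) 1.
have q x : quad (mxC (hankel_plus ('X * a%:P) 1)) x = a * normc (x ord0) ^+ 2.
  rewrite /quad /sform !big_ord1 /mxC !mxE coefXM /= coefC /= -mulrA mulcJ -rmorphM.
  by [].
apply/eqP; rewrite eqn_leq; case: (ltP a 0) => a0.
  apply/andP; split.
    by apply: leq_trans (leq_addr _ _) (weightN ('X * a%:P) 1).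
  apply: neg_ge_le h1; exists (fun _ _ => 1) => c [i ci]; rewrite q /comb big_ord1 mulr1.
  rewrite nmulr_rlt0 // exprn_gt0 //.
  by have <- : i = ord0 by [rewrite (ord1 i)]; rewrite normc_gt0.
rewrite leq0n andbT; apply: neg_ge_le h2 _; exists (fun _ _ => 0) => x _.
by rewrite q mulr_ge0 // exprn_ge0 // normc_ge0.
Qed.

(** On u / v = f this is f + p; up to swap it is a shear. *)
Definition translate (p : {poly R}) (X : C -> V2) : C -> V2 :=
  fun z => ((X z).1 + evalC p z * (X z).2, (X z).2).

Lemma ker_translate p X z w : ker (translate p X) z w = ker (shear p (swap X)) z w.
Proof.
rewrite -ker_swap /ker /swap /shear /translate /= !(rmorphN, rmorphB, rmorphD, rmorphM) /=.
by congr (_ / _); ring.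
Qed.

Lemma shear_idx_le (p : {poly R}) d X k : (size p <= d.+1)%N -> idx_le (ker X) k ->
  idx_le (ker (shear p X)) (weight p d + k).
Proof. by move=> le; apply: shear_le le (weight_neg p d).1. Qed.

Lemma shear_idx_ge (p : {poly R}) d X k : (size p <= d.+1)%N -> slow X -> idx_ge (ker X) k ->
  idx_ge (ker (shear p X)) (weight p d + k).
Proof. by move=> le sX; apply: shear_ge le sX (weight_neg p d).2. Qed.

Lemma translate_idx_le (p : {poly R}) d X k : (size p <= d.+1)%N -> idx_le (ker X) k ->
  idx_le (ker (translate p X)) (weight p d + k).
Proof.
move=> le h; apply: (eq_idx_le (K1 := ker (shear p (swap X)))).
  by move=> z w _ _; rewrite ker_translate.
apply: shear_idx_le le _; apply: eq_idx_le h => z w _ _; by rewrite ker_swap.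
Qed.

Lemma translate_idx_ge (p : {poly R}) d X k : (size p <= d.+1)%N -> slow (swap X) -> idx_ge (ker X) k ->
  idx_ge (ker (translate p X)) (weight p d + k).
Proof.
move=> le sX h; apply: (eq_idx_ge (K1 := ker (shear p (swap X)))).
  by move=> z w _ _; rewrite ker_translate.
apply: shear_idx_ge le sX _; apply: eq_idx_ge h => z w _ _; by rewrite ker_swap.
Qed.

Lemma zmul_shear (m : {poly R}) X z : zmul (shear ('X * m) X) z = shear m (zmul X) z.
Proof. by rewrite /zmul /shear /= evalCM evalCX; congr (_, _); ring. Qed.

Lemma zmul_translate (p : {poly R}) X z : zmul (translate p X) z = translate ('X * p) (zmul X) z.
Proof. by rewrite /zmul /translate /= evalCM evalCX; congr (_, _); ring. Qed.

Lemma eq_ker (X Y : C -> V2) z w : X z = Y z -> X w = Y w -> ker X z w = ker Y z w.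
Proof. by rewrite /ker => -> ->. Qed.

Lemma eqX_idx_le X Y k : X =1 Y -> idx_le (ker X) k -> @idx_le R (ker Y) k.
Proof. by move=> e; apply: eq_idx_le => z w _ _; apply: eq_ker. Qed.

Lemma eqX_idx_ge X Y k : X =1 Y -> idx_ge (ker X) k -> @idx_ge R (ker Y) k.
Proof. by move=> e; apply: eq_idx_ge => z w _ _; apply: eq_ker. Qed.

Definition small (X : C -> V2) : Prop :=
  (\forall y \near +oo, (X (imag y)).2 != 0) /\
  ((X (imag y)).1 / (X (imag y)).2 : C^o) @[y --> +oo] --> (0 : C^o).

Lemma near_gt0 : \forall y \near +oo, (0 : R) < y.
Proof. exact: nbhs_pinfty_gt. Qed.

Lemma inv_real (y : R) : (y^-1)%:C = (y%:C)^-1 :> C.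
Proof. by rewrite fmorphV. Qed.

Lemma slow_swap X : small X -> slow (swap X).
Proof.
move=> [v0 h]; split; first exact: v0.
rewrite -[X in _ --> X](_ : - 0 * 0 = 0); last by rewrite mulr0.
apply: (cvg_near_eq (f := fun y => - ((X (imag y)).1 / (X (imag y)).2) * (y^-1)%:C)).
  by near=> y; rewrite /swap /= inv_real !mulNr.
apply: cvgM; last exact: cvg_invC.
by apply: cvgN; exact: h.
Unshelve. all: by end_near. Qed.

Lemma imag_real (y : R) : imag y = imag 1 * y%:C.
Proof. by rewrite -imagM mul1r. Qed.

Lemma slow_swap_zmul X : small X -> slow (swap (zmul X)).
Proof.
move=> [v0 h]; split; first exact: v0.
rewrite -[X in _ --> X](_ : - imag 1 * 0 = 0); last by rewrite mulr0.
apply: (cvg_near_eq (f := fun y => - imag 1 * ((X (imag y)).1 / (X (imag y)).2))).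
  near=> y; have y0 : y%:C != 0 :> C by rewrite fmorph_eq0 gt_eqF //; near: y; exact: near_gt0.
  have v0' : (X (imag y)).2 != 0 by near: y.
  move: v0'; rewrite /swap /zmul /=; case: (X (imag y)) => u v /= v0'.
  by rewrite (imag_real y); field; rewrite y0 v0'.
by apply: cvgM; [exact: cvg_cst|exact: h].
Unshelve. all: by end_near. Qed.

Lemma slow_zmul (X : C -> V2) : slow X -> slow (zmul X).
Proof.
move=> [u0 h]; split.
  near=> y; rewrite /zmul /= mulf_neq0 //; last by near: y.
  by rewrite imag_eq0 gt_eqF //; near: y; exact: near_gt0.
rewrite -[X in _ --> X](_ : 0 * ((imag 1)^-1 * 0) = 0); last by rewrite mul0r.
apply: (cvg_near_eq (f := fun y => (X (imag y)).2 / (X (imag y)).1 / y%:C *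
   ((imag 1)^-1 * (y^-1)%:C))).
  near=> y; have y0 : y%:C != 0 :> C by rewrite fmorph_eq0 gt_eqF //; near: y; exact: near_gt0.
  have v0' : (X (imag y)).1 != 0 by near: y.
  have i0 : imag 1 != 0 :> C by rewrite imag_eq0 oner_eq0.
  move: v0'; rewrite /zmul /= inv_real; case: (X (imag y)) => u v /= v0'.
  by rewrite (imag_real y); field; rewrite y0 v0' i0.
apply: cvgM; first exact: h.
by apply: cvgM; [exact: cvg_cst|exact: cvg_invC].
Unshelve. all: by end_near. Qed.

Lemma translate_limit (l : R) X : l != 0 -> small X ->
  (\forall y \near +oo, (translate l%:P X (imag y)).1 != 0) /\
  ((translate l%:P X (imag y)).2 / (translate l%:P X (imag y)).1 : C^o) @[y --> +oo] --> ((l%:C)^-1 : C^o).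
Proof.
move=> l0 [v0 h].
have l0' : l%:C != 0 :> C by rewrite fmorph_eq0.
have hl : ((X (imag y)).1 / (X (imag y)).2 + l%:C : C^o) @[y --> +oo] --> (l%:C : C^o).
  rewrite -[X in _ --> X]add0r; apply: cvgD; [exact: h|exact: cvg_cst].
have nz : \forall y \near +oo, (translate l%:P X (imag y)).1 != 0.
  have nl : 0 < normc (l%:C : C) by rewrite normc_gt0.
  near=> y; have : normc ((X (imag y)).1 / (X (imag y)).2 + l%:C - l%:C) < normc (l%:C : C).
    by near: y; apply: (cvgCP _ _).1 hl _ nl.
  apply: contraTneq; rewrite /translate /= evalCC => e.
  have v0' : (X (imag y)).2 != 0 by near: y.
  have -> : (X (imag y)).1 = - (l%:C * (X (imag y)).2).
    by apply/eqP; rewrite -addr_eq0 e.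
  by rewrite mulNr mulfK // addNr sub0r normcN ltxx.
split; first exact: nz.
apply: (cvg_near_eq (f := fun y => ((X (imag y)).1 / (X (imag y)).2 + l%:C)^-1)).
  near=> y; have v0' : (X (imag y)).2 != 0 by near: y.
  have u0' : (translate l%:P X (imag y)).1 != 0 by near: y.
  move: u0'; rewrite /translate /= evalCC => u0'.
  have e : (X (imag y)).1 / (X (imag y)).2 + l%:C =
    ((X (imag y)).1 + l%:C * (X (imag y)).2) / (X (imag y)).2 by field.
  by rewrite e invf_div.
by apply: cvgV; [exact: l0'|exact: hl].
Unshelve. all: by end_near. Qed.

Lemma slow_translate (l : R) X : l != 0 -> small X -> slow (translate l%:P X).
Proof.
move=> l0 /(translate_limit l0) [h1 h2]; split; first exact: h1.
rewrite -[X in _ --> X](_ : (l%:C)^-1 * 0 = 0); last by rewrite mulr0.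
apply: (cvg_near_eq (f := fun y => (translate l%:P X (imag y)).2 / (translate l%:P X (imag y)).1 * (y^-1)%:C)).
  by near=> y; rewrite inv_real.
by apply: cvgM; [exact: h2|exact: cvg_invC].
Unshelve. all: by end_near. Qed.

Variables (m : nat -> {poly R}) (l : nat -> R) (nu : nat -> nat).

(** The continued fraction 1 / (- z m_(j+1) + 1 / (l_(j+1) + 1 / (- z m_(j+2)
    + ...))) with n + 1 polynomials, closed with the parameter t. As a chain
    of shears and translations it shows its index term by term. *)
Fixpoint levels (j n : nat) (t : C -> V2) : C -> V2 :=
  shear ('X * m j.+1) (if n is n'.+1 then translate (l j.+1)%:P (levels j.+1 n' t) else t).

(** The contribution of the coefficients to the index of the continued
    fraction (mass) and of its product with z (massp): that multiplication
    turns the shears by z m into shears by m, and the translations by l into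
    translations by z l. *)
Definition mass j n := (\sum_(i < n.+1) weight ('X * m (j + i.+1)%N) (nu (j + i.+1)))%N.
Definition massp j n := (\sum_(i < n.+1) weight (m (j + i.+1)%N) (nu (j + i.+1)).-1 +
  \sum_(i < n) (l (j + i.+1)%N < 0)%R)%N.

Lemma mass0 j : mass j 0 = weight ('X * m j.+1) (nu j.+1).
Proof. by rewrite /mass big_ord1 addn1. Qed.

Lemma massS j n : mass j n.+1 = (weight ('X * m j.+1) (nu j.+1) + mass j.+1 n)%N.
Proof.
rewrite /mass big_ord_recl /= addn1; congr (_ + _)%N.
by apply: eq_bigr => i _; rewrite /bump /= add1n addSnnS.
Qed.

Lemma massp0 j : massp j 0 = weight (m j.+1) (nu j.+1).-1.
Proof. by rewrite /massp big_ord1 big_ord0 addn0 addn1. Qed.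

Lemma masspS j n : massp j n.+1 =
  (weight (m j.+1) (nu j.+1).-1 + ((l j.+1 < 0)%R + massp j.+1 n))%N.
Proof.
rewrite /massp big_ord_recl [X in (_ + X)%N]big_ord_recl /= addn1.
under eq_bigr do rewrite /bump /= add1n -addSnnS.
under [X in (_ + (_ + X))%N]eq_bigr do rewrite /bump /= add1n -addSnnS.
by rewrite -!addnA; congr (_ + _)%N; rewrite addnCA.
Qed.

Definition sized j n := forall i, (i <= n)%N ->
  (0 < nu (j + i.+1))%N /\ (size (m (j + i.+1)%N) <= nu (j + i.+1))%N.

Lemma sized_head j n : sized j n -> (0 < nu j.+1)%N /\ (size (m j.+1) <= nu j.+1)%N.
Proof. by move=> /(_ 0%N isT); rewrite addn1. Qed.

Lemma sized_tail j n : sized j n.+1 -> sized j.+1 n.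
Proof. by move=> h i hi; have := h i.+1 hi; rewrite addSnnS. Qed.

Lemma size_Xm (p : {poly R}) d : (size p <= d)%N -> (size ('X * p)%R <= d.+1)%N.
Proof.
move=> h; have [->|p0] := eqVneq p 0; first by rewrite mulr0 size_poly0.
by rewrite mulrC size_mulX.
Qed.

Lemma levels_idx_le j n t k : sized j n -> idx_le (ker t) k ->
  idx_le (ker (levels j n t)) (mass j n + k).
Proof.
elim: n j => [|n IH] j hs hk; have [_ sm] := sized_head hs.
  by rewrite mass0; apply: shear_idx_le hk; exact: size_Xm.
rewrite massS -addnA; apply: shear_idx_le; first exact: size_Xm.
rewrite -[X in idx_le _ X]add0n -(weight0 (l j.+1)%:P).
by apply: translate_idx_le (IH _ (sized_tail hs) hk); exact: size_polyC_leq1.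
Qed.

Lemma levels_zmul_idx_le j n t k : sized j n -> idx_le (ker (zmul t)) k ->
  idx_le (ker (zmul (levels j n t))) (massp j n + k).
Proof.
elim: n j => [|n IH] j hs hk; have [n0 sm] := sized_head hs.
  rewrite massp0; apply: eqX_idx_le (fsym (zmul_shear _ _)) _.
  by apply: shear_idx_le hk; rewrite prednK.
rewrite masspS -addnA -addnA; apply: eqX_idx_le (fsym (zmul_shear _ _)) _.
apply: shear_idx_le; first by rewrite prednK.
apply: eqX_idx_le (fsym (zmul_translate _ _)) _; rewrite -weight1.
by apply: translate_idx_le (IH _ (sized_tail hs) hk); apply: size_Xm; exact: size_polyC_leq1.
Qed.

(** The growth conditions under which every step of the chain adds its full
    weight. *)
Definition steady j n t :=
  slow t /\ forall i, (i < n)%N -> l (j + i.+1)%N != 0 /\ small (levels (j + i.+1) (n - i.+1) t).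

Lemma steady_tail j n t : steady j n.+1 t ->
  [/\ l j.+1 != 0, small (levels j.+1 n t) & steady j.+1 n t].
Proof.
move=> [h1 h2]; have [] := h2 0%N isT; rewrite addn1 subn1 /= => a b; split=> //.
by split=> // i hi; have := h2 i.+1 hi; rewrite addSnnS subSS.
Qed.

Lemma levels_idx_ge j n t k : sized j n -> steady j n t -> idx_ge (ker t) k ->
  idx_ge (ker (levels j n t)) (mass j n + k).
Proof.
elim: n j => [|n IH] j hs st hk; have [_ sm] := sized_head hs.
  by rewrite mass0; apply: shear_idx_ge hk; [exact: size_Xm|exact: st.1].
have [l0 sX st'] := steady_tail st.
rewrite massS -addnA; apply: shear_idx_ge; [exact: size_Xm|exact: slow_translate|].
rewrite -[X in idx_ge _ X]add0n -(weight0 (l j.+1)%:P).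
apply: translate_idx_ge (IH _ (sized_tail hs) st' hk); first exact: size_polyC_leq1.
exact: slow_swap.
Qed.

Lemma levels_zmul_idx_ge j n t k : sized j n -> steady j n t -> idx_ge (ker (zmul t)) k ->
  idx_ge (ker (zmul (levels j n t))) (massp j n + k).
Proof.
elim: n j => [|n IH] j hs st hk; have [n0 sm] := sized_head hs.
  rewrite massp0; apply: eqX_idx_ge (fsym (zmul_shear _ _)) _.
  by apply: shear_idx_ge hk; [rewrite prednK|exact: slow_zmul st.1].
have [l0 sX st'] := steady_tail st.
rewrite masspS -addnA -addnA; apply: eqX_idx_ge (fsym (zmul_shear _ _)) _.
apply: shear_idx_ge; [by rewrite prednK|exact: slow_zmul (slow_translate l0 sX)|].
apply: eqX_idx_ge (fsym (zmul_translate _ _)) _; rewrite -weight1.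
apply: translate_idx_ge (IH _ (sized_tail hs) st' hk); last exact: slow_swap_zmul.
by apply: size_Xm; exact: size_polyC_leq1.
Qed.

Lemma levels_is_idx j n t k : sized j n -> steady j n t -> is_idx (ker t) k ->
  is_idx (ker (levels j n t)) (mass j n + k).
Proof. by move=> hs st [h1 h2]; split; [exact: levels_idx_le|exact: levels_idx_ge]. Qed.

Lemma levels_zmul_is_idx j n t k : sized j n -> steady j n t -> is_idx (ker (zmul t)) k ->
  is_idx (ker (zmul (levels j n t))) (massp j n + k).
Proof. by move=> hs st [h1 h2]; split; [exact: levels_zmul_idx_le|exact: levels_zmul_idx_ge]. Qed.

End Levels.

(** * Opposite continued fraction *)

Section Opposite.
Variable R : realType.
Local Notation C := R[i].
Local Notation V2 := (C * C)%type.
Variables (m : nat -> {poly R}) (l : nat -> R) (nu : nat -> nat).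

Definition oppX (X : C -> V2) : C -> V2 := fun z => (- (X z).1, (X z).2).

Lemma levels_opp j n (t : C -> V2) z :
  levels (fun i => - m i) (fun i => - l i) j n (oppX t) z = oppX (levels m l j n t) z.
Proof.
elim: n j z => [|n IH] j z.
  by rewrite /levels /shear /oppX /= (mulrN 'X) evalCN; congr (_, _); ring.
rewrite [levels _ _ _ _ _]/= -/(levels _ _) /shear /translate IH {2}/oppX /=.
by rewrite -/(levels _ _) /oppX /= (mulrN 'X) polyCN !evalCN; congr (_, _); ring.
Qed.

(** A Hankel matrix and its opposite share the squares allowed by its size.
    The same count for massp follows. *)
Lemma mass_opp j n :
  (mass m nu j n + mass (fun i => - m i) nu j n <= \sum_(i < n.+1) nu (j + i.+1))%N.
Proof.
rewrite /mass -big_split; apply: leq_sum => i _ /=.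
by rewrite mulrN; exact: weightN.
Qed.

Lemma massp_opp j n : (forall i, (i < n)%N -> l (j + i.+1)%N != 0) ->
  (massp m l nu j n + massp (fun i => - m i) (fun i => (- l i)%R) nu j n <=
   \sum_(i < n.+1) (nu (j + i.+1)).-1 + n)%N.
Proof.
move=> l0; rewrite /massp addnACA -!big_split leq_add //.
  by apply: leq_sum => i _; exact: weightN.
rewrite -[leqRHS](card_ord n) -sum1_card; apply: leq_sum => i _ /=.
by rewrite oppr_lt0; case: ltgtP (l0 i (ltn_ord i)).
Qed.

End Opposite.

(** * Asymptotic expansions on the imaginary axis *)

Section Asymptotics.
Variable R : realType.
Local Notation C := R[i].
Local Notation V2 := (C * C)%type.

Lemma near_imag : \forall y \near +oo, imag y != 0 :> C.
Proof.
near=> y; rewrite imag_eq0 gt_eqF //; near: y; exact: near_gt0.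
Unshelve. all: by end_near. Qed.

Definition expands (g : R -> C) (P : {poly R}) (n : nat) : Prop :=
  ((g y - evalC P (imag y)^-1) * imag y ^+ n : C^o) @[y --> +oo] --> (0 : C^o).

Lemma eq_expands g g' P n : (\forall y \near +oo, g y = g' y) -> expands g P n -> expands g' P n.
Proof.
move=> e; apply: cvg_near_eq; near=> y; congr ((_ - _) * _); near: y; exact: e.
Unshelve. all: by end_near. Qed.

Lemma cvg_invimag : ((imag y)^-1 : C^o) @[y --> +oo] --> (0 : C^o).
Proof.
rewrite -[X in _ --> X](_ : (imag 1)^-1 * 0 = 0); last by rewrite mulr0.
apply: (cvg_near_eq (f := fun y => (imag 1)^-1 * (y^-1)%:C)).
  by near=> y; rewrite (imag_real y) invfM inv_real.
by apply: cvgM; [exact: cvg_cst|exact: cvg_invC].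
Unshelve. all: by end_near. Qed.

Lemma cvg_evalC P : (evalC P (imag y)^-1 : C^o) @[y --> +oo] --> (evalC P 0 : C^o).
Proof.
elim/poly_ind: P => [|P c IH].
  apply: (cvg_near_eq (f := fun=> 0)).
    by near=> y; rewrite /evalC rmorph0 horner0.
  by rewrite /evalC rmorph0 horner0; exact: cvg_cst.
apply: (cvg_near_eq (f := fun y => evalC P (imag y)^-1 * (imag y)^-1 + c%:C)).
  by near=> y; rewrite evalCD evalCM evalCX evalCC.
rewrite -[X in _ --> X](_ : evalC P 0 * 0 + c%:C = evalC (P * 'X + c%:P) 0); last first.
  by rewrite evalCD evalCM evalCX evalCC.
apply: cvgD; last exact: cvg_cst.
by apply: cvgM; [exact: IH|exact: cvg_invimag].
Unshelve. all: by end_near. Qed.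

Lemma cvg_invimagX n : ((imag y)^-1 ^+ n : C^o) @[y --> +oo] --> (0 ^+ n : C^o).
Proof.
elim: n => [|n IH].
  apply: (cvg_near_eq (f := fun=> 1)); first by near=> y; rewrite expr0.
  by rewrite expr0; exact: cvg_cst.
apply: (cvg_near_eq (f := fun y => (imag y)^-1 * (imag y)^-1 ^+ n)).
  by near=> y; rewrite exprS.
by rewrite exprS; apply: cvgM; [exact: cvg_invimag|exact: IH].
Unshelve. all: by end_near. Qed.

Lemma expands_cvg g P n : expands g P n -> (g y : C^o) @[y --> +oo] --> (evalC P 0 : C^o).
Proof.
move=> h; apply: (cvg_near_eq (f := fun y =>
    (g y - evalC P (imag y)^-1) * imag y ^+ n * (imag y)^-1 ^+ n + evalC P (imag y)^-1)).
  near=> y; have y0 : imag y != 0 by near: y; exact: near_imag.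
  by rewrite exprVn mulfK ?expf_neq0 // subrK.
rewrite -[X in _ --> X](_ : 0 * 0 ^+ n + evalC P 0 = evalC P 0); last by rewrite mul0r add0r.
apply: cvgD; last exact: cvg_evalC.
by apply: cvgM; [exact: h|exact: cvg_invimagX].
Unshelve. all: by end_near. Qed.

Lemma cvg_neq0 (g : R -> C) (a : C) : a != 0 -> (g y : C^o) @[y --> +oo] --> (a : C^o) ->
  \forall y \near +oo, g y != 0.
Proof.
move=> a0 h; have na : 0 < normc a by rewrite normc_gt0.
apply: filterS ((cvgCP _ _).1 h _ na) => y; apply: contraTneq => ->.
by rewrite sub0r normcN ltxx.
Qed.

Definition inverse_mod (n : nat) (P Q : {poly R}) := exists D, P * Q = 1 + 'X^n * D.

Lemma inverse_mod_sym n P Q : inverse_mod n P Q -> inverse_mod n Q P.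
Proof. by move=> [D e]; exists D; rewrite mulrC. Qed.

Lemma expands_inv g P Q n : inverse_mod n.+1 Q P -> expands g P n ->
  (\forall y \near +oo, g y != 0) /\ expands (fun y => (g y)^-1) Q n.
Proof.
move=> [D e] h; have hg := expands_cvg h.
have P0 : evalC P 0 != 0.
  have : evalC (Q * P) 0 = 1.
    by rewrite e evalCD evalCM evalCXn expr0n mul0r addr0 /evalC rmorph1 hornerC.
  by rewrite evalCM => h1; apply: contra_eq_neq h1 => ->; rewrite mulr0 eq_sym oner_eq0.
have nz := cvg_neq0 P0 hg; split; first exact: nz.
rewrite /expands; apply: (cvg_near_eq (f := fun y =>
   (- ((imag y)^-1 * evalC D (imag y)^-1) -
    evalC Q (imag y)^-1 * ((g y - evalC P (imag y)^-1) * imag y ^+ n)) / g y)).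
  near=> y; have g0 : g y != 0 by near: y; exact: nz.
  have y0 : imag y != 0 by near: y; exact: near_imag.
  have := congr1 (fun p => evalC p (imag y)^-1) e.
  rewrite /= evalCM evalCD evalCM evalCXn [evalC 1 _](_ : _ = 1); last first.
    by rewrite /evalC rmorph1 hornerC.
  move: (evalC Q _) (evalC P _) (evalC D _) => q p d eqp.
  have : (imag y)^-1 * d = (q * p - 1) * imag y ^+ n.
    by rewrite eqp exprS exprVn; field; rewrite y0 expf_neq0.
  move=> ->; move: (imag y ^+ n) => a; by field.
rewrite -[X in _ --> X](_ : (- (0 * evalC D 0) - evalC Q 0 * 0) / evalC P 0 = 0); last first.
  by rewrite mul0r mulr0 subr0 oppr0 mul0r.
apply: cvgM; last by apply: cvgV; [exact: P0|exact: hg].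
apply: cvgB.
  by apply: cvgN; apply: cvgM; [exact: cvg_invimag|exact: cvg_evalC].
by apply: cvgM; [exact: cvg_evalC|exact: h].
Unshelve. all: by end_near. Qed.

(** The moment condition on f = u / v: up to sign, the moments are the
    coefficients of the expansion in powers of 1 / z, from the first power on.
    *)
Definition asym (X : C -> V2) (s : seq R) : Prop :=
  (\forall y \near +oo, (X (imag y)).2 != 0) /\
  expands (fun y => (X (imag y)).1 / (X (imag y)).2) (- ('X * Poly s)) (size s).

Lemma asym_small X s : (0 < size s)%N -> asym X s -> small X.
Proof.
move=> s0 [v0 /expands_cvg h]; split; first exact: v0.
by move: h; rewrite evalCN evalCM evalCX mul0r oppr0.
Qed.

Lemma evalC_Poly (s : seq R) z : evalC (Poly s) z = \sum_(i < size s) (s`_i)%:C * z ^+ i.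
Proof.
rewrite (evalC_coef _ (size_Poly _)); apply: eq_bigr => i _.
by rewrite coef_Poly.
Qed.

(** The coefficients in the order of the Toeplitz identities, that of
    increasing powers of 1 / z. *)
Definition mrev (m : {poly R}) nu : {poly R} := Poly (rev (mkseq (fun i => m`_i) nu)).

Lemma evalC_mrev (m : {poly R}) nu z : (size m <= nu)%N -> z != 0 ->
  evalC (mrev m nu) z^-1 * z ^+ nu = z * evalC m z.
Proof.
move=> sm z0; rewrite /mrev evalC_Poly size_rev size_mkseq (evalC_coef _ sm).
rewrite mulr_suml mulr_sumr (reindex_inj rev_ord_inj) /=; apply: eq_bigr => i _.
rewrite nth_rev size_mkseq; last by rewrite ltn_subrL (leq_ltn_trans _ (ltn_ord i)).
have -> : (nu - (nu - i.+1).+1 = i)%N by have := ltn_ord i; lia.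
rewrite nth_mkseq // exprVn [in z ^+ nu](_ : nu = (nu - i.+1 + i.+1)%N); last first.
  by have := ltn_ord i; lia.
by rewrite exprD exprS; field; rewrite expf_neq0.
Qed.

(** The first nonzero moment has index nu - 1, so - v / u grows like z ^ nu,
    with an expansion that is the reciprocal of that of u / v. *)
Lemma asym_inv X s nu P : (0 < nu <= size s)%N -> (forall i, (i < nu.-1)%N -> s`_i = 0) ->
  inverse_mod (size s - nu).+1 P (Poly (drop nu.-1 s)) ->
  asym X s <-> ((\forall y \near +oo, (X (imag y)).1 != 0) /\
    expands (fun y => - ((X (imag y)).2 / (X (imag y)).1) / imag y ^+ nu) P (size s - nu)).
Proof.
move=> /andP [nu0 le] s0 hP.
have eS : Poly s = 'X^(nu.-1) * Poly (drop nu.-1 s).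
  apply/polyP => i; rewrite coefXnM !coef_Poly; case: ltnP => hi; first exact: s0.
  by rewrite nth_drop subnKC.
have key g : expands g (- ('X * Poly s)) (size s) <->
    expands (fun y => - g y * imag y ^+ nu) (Poly (drop nu.-1 s)) (size s - nu).
  have e y : imag y != 0 -> (- g y * imag y ^+ nu - evalC (Poly (drop nu.-1 s)) (imag y)^-1) *
       imag y ^+ (size s - nu) = - ((g y - evalC (- ('X * Poly s)) (imag y)^-1) * imag y ^+ size s).
    move=> y0; rewrite eS mulrA -exprS prednK // evalCN evalCM evalCXn exprVn.
    have -> : imag y ^+ size s = imag y ^+ (size s - nu) * imag y ^+ nu by rewrite -exprD subnK.
    by field; rewrite expf_neq0.
  rewrite /expands; split=> h.
    rewrite -[X in _ --> X]oppr0; apply: (cvg_near_eq (f := fun y =>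
      - ((g y - evalC (- ('X * Poly s)) (imag y)^-1) * imag y ^+ size s))).
      near=> y; rewrite e //; near: y; exact: near_imag.
    by apply: cvgN; exact: h.
  rewrite -[X in _ --> X]oppr0; apply: (cvg_near_eq (f := fun y =>
    - ((- g y * imag y ^+ nu - evalC (Poly (drop nu.-1 s)) (imag y)^-1) * imag y ^+ (size s - nu)))).
    near=> y; rewrite e ?opprK //; near: y; exact: near_imag.
  by apply: cvgN; exact: h.
rewrite /asym key; split=> [[v0 h]|[u0 h]].
  have [nz h2] := expands_inv hP h; split.
    near=> y; have : - ((X (imag y)).1 / (X (imag y)).2) * imag y ^+ nu != 0 by near: y.
    by apply: contraNneq => ->; rewrite mul0r oppr0 mul0r.
  apply: eq_expands h2; near=> y.
  by rewrite invfM invrN invf_div mulNr.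
have [nz h2] := expands_inv (inverse_mod_sym hP) h; split.
  near=> y; have : - ((X (imag y)).2 / (X (imag y)).1) / imag y ^+ nu != 0 by near: y.
  by apply: contraNneq => ->; rewrite mul0r oppr0 mul0r.
apply: eq_expands h2; near=> y.
by rewrite invfM invrN invf_div invrK mulNr.
Unshelve. all: by end_near. Qed.

(** At the last level the moments determine the polynomial z m and leave the
    condition o(z) on the reciprocal of the parameter. *)
Lemma asym_last t s (m : {poly R}) nu : (0 < nu)%N -> size s = (2 * nu - 1)%N ->
  (forall i, (i < nu.-1)%N -> s`_i = 0) -> (size m <= nu)%N ->
  inverse_mod nu (mrev m nu) (Poly (drop nu.-1 s)) ->
  asym (shear ('X * m) t) s <-> slow t.
Proof.
move=> nu0 ss s0 sm hP.
have e1 : (size s - nu = nu.-1)%N by rewrite ss; lia.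
rewrite (@asym_inv _ _ nu (mrev m nu)) //; first last.
- by rewrite e1 prednK.
- by rewrite ss; lia.
rewrite e1.
have e y : imag y != 0 -> (t (imag y)).1 != 0 ->
    (- ((shear ('X * m) t (imag y)).2 / (shear ('X * m) t (imag y)).1) / imag y ^+ nu -
     evalC (mrev m nu) (imag y)^-1) * imag y ^+ nu.-1 =
    - (imag 1)^-1 * ((t (imag y)).2 / (t (imag y)).1 / y%:C).
  move=> y0 u0; have en : imag y ^+ nu = imag y * imag y ^+ nu.-1 by rewrite -exprS prednK.
  have -> : evalC (mrev m nu) (imag y)^-1 = evalC m (imag y) / imag y ^+ nu.-1.
    apply: (mulIf (expf_neq0 nu y0)); rewrite evalC_mrev // en.
    by field; rewrite expf_neq0.
  have y1 : y%:C != 0 :> C by rewrite fmorph_eq0 -imag_eq0.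
  have i0 : imag 1 != 0 :> C by rewrite imag_eq0 oner_eq0.
  rewrite en /shear /= evalCM evalCX.
  move: (imag y ^+ nu.-1) (expf_neq0 nu.-1 y0) (evalC m (imag y)) => a a0 mm.
  move: u0; case: (t (imag y)) => u v /= u0; rewrite (imag_real y).
  by field; rewrite a0 y1 u0 i0.
have i0 : imag 1 != 0 :> C by rewrite imag_eq0 oner_eq0.
split=> -[u0 h]; split; try exact: u0.
  rewrite -[X in _ --> X](_ : - imag 1 * 0 = 0); last by rewrite mulr0.
  apply: (cvg_near_eq (f := fun y => - imag 1 *
    ((- ((shear ('X * m) t (imag y)).2 / (shear ('X * m) t (imag y)).1) / imag y ^+ nu -
     evalC (mrev m nu) (imag y)^-1) * imag y ^+ nu.-1))).
    near=> y; rewrite e.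
    - by rewrite mulrA mulNr mulrN opprK divff // mul1r.
    - by near: y; exact: near_imag.
    - by near: y; exact: u0.
  by apply: cvgM; [exact: cvg_cst|exact: h].
rewrite /expands -[X in _ --> X](_ : - (imag 1)^-1 * 0 = 0); last by rewrite mulr0.
apply: (cvg_near_eq (f := fun y => - (imag 1)^-1 * ((t (imag y)).2 / (t (imag y)).1 / y%:C))).
  near=> y; rewrite e //; first by near: y; exact: near_imag.
  by near: y; exact: u0.
by apply: cvgM; [exact: cvg_cst|exact: h].
Unshelve. all: by end_near. Qed.

(** The two Toeplitz identities say that two reciprocals turn the moments s of
    the fraction into the moments s1 of its tail. *)
Lemma asym_step X s s1 fs (m : {poly R}) l nu : (0 < nu)%N -> size s = (size s1 + 2 * nu)%N ->
  (forall i, (i < nu.-1)%N -> s`_i = 0) -> (size m <= nu)%N ->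
  inverse_mod (size s1 + nu).+1 (mrev m nu - 'X^nu * Poly fs) (Poly (drop nu.-1 s)) ->
  inverse_mod (size s1).+1 (l%:P - 'X * Poly s1) (Poly fs) ->
  asym (shear ('X * m) (translate l%:P X)) s <-> asym X s1.
Proof.
move=> nu0 ss s0 sm hP hF.
have e1 : (size s - nu = size s1 + nu)%N by rewrite ss; lia.
rewrite (@asym_inv _ _ nu (mrev m nu - 'X^nu * Poly fs)) //; first last.
- by rewrite e1.
- by rewrite ss; lia.
rewrite e1; pose U y := (translate l%:P X (imag y)).1.
have eF : expands (fun y => - ((shear ('X * m) (translate l%:P X) (imag y)).2 / U y) / imag y ^+ nu)
    (mrev m nu - 'X^nu * Poly fs) (size s1 + nu) <->
    expands (fun y => (shear ('X * m) (translate l%:P X) (imag y)).2 / U y + imag y * evalC m (imag y))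
      (Poly fs) (size s1).
  have e y : imag y != 0 ->
    (- ((shear ('X * m) (translate l%:P X) (imag y)).2 / U y) / imag y ^+ nu -
      evalC (mrev m nu - 'X^nu * Poly fs) (imag y)^-1) * imag y ^+ (size s1 + nu) =
    - (((shear ('X * m) (translate l%:P X) (imag y)).2 / U y + imag y * evalC m (imag y) -
       evalC (Poly fs) (imag y)^-1) * imag y ^+ size s1).
    move=> y0; rewrite -(evalC_mrev sm y0) evalCD evalCN evalCM evalCXn exprD exprVn.
    move: (_ / U y) (evalC _ _) (evalC _ _) (imag y ^+ size s1) => p q r w.
    by field; rewrite expf_neq0.
  rewrite /expands; split=> h; rewrite -[X in _ --> X]oppr0.
    apply: (cvg_near_eq (f := fun y =>
      - ((- ((shear ('X * m) (translate l%:P X) (imag y)).2 / U y) / imag y ^+ nu -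
      evalC (mrev m nu - 'X^nu * Poly fs) (imag y)^-1) * imag y ^+ (size s1 + nu)))).
      near=> y; rewrite e ?opprK //; near: y; exact: near_imag.
    by apply: cvgN; exact: h.
  apply: (cvg_near_eq (f := fun y =>
    - (((shear ('X * m) (translate l%:P X) (imag y)).2 / U y + imag y * evalC m (imag y) -
       evalC (Poly fs) (imag y)^-1) * imag y ^+ size s1))).
    near=> y; rewrite e //; near: y; exact: near_imag.
  by apply: cvgN; exact: h.
have eV y : U y != 0 ->
   (shear ('X * m) (translate l%:P X) (imag y)).2 / U y + imag y * evalC m (imag y) =
   (X (imag y)).2 / U y.
  by rewrite /U /shear /translate /= => u0; rewrite evalCM evalCX; field.
have eL : expands (fun y => U y / (X (imag y)).2) (l%:P - 'X * Poly s1) (size s1) <->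
    expands (fun y => U y / (X (imag y)).2 - l%:C) (- ('X * Poly s1)) (size s1).
  rewrite /expands; split; apply: cvg_near_eq; near=> y; rewrite evalCD evalCC !evalCN;
    by congr (_ * _); ring.
have eU : (\forall y \near +oo, (X (imag y)).2 != 0) ->
    \forall y \near +oo, U y / (X (imag y)).2 - l%:C = (X (imag y)).1 / (X (imag y)).2.
  move=> v0; near=> y; have v0' : (X (imag y)).2 != 0 by near: y.
  by rewrite /U /translate /= evalCC; field.
split=> [[u0 /eF h]|[v0 h]].
  have h1 : expands (fun y => (X (imag y)).2 / U y) (Poly fs) (size s1).
    apply: eq_expands h; near=> y; apply: eV; near: y; exact: u0.
  have [nz h2] := expands_inv hF h1.
  have v0 : \forall y \near +oo, (X (imag y)).2 != 0.
    by apply: filterS nz => y; apply: contraNneq => ->; rewrite mul0r.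
  split; first exact: v0.
  apply: eq_expands (eU v0) _; apply/eL; apply: eq_expands h2.
  by near=> y; rewrite invf_div.
have h1 : expands (fun y => U y / (X (imag y)).2) (l%:P - 'X * Poly s1) (size s1).
  apply/eL; apply: eq_expands h; apply: filterS (eU v0) => y ->; by [].
have [nz h2] := expands_inv (inverse_mod_sym hF) h1.
have u0 : \forall y \near +oo, U y != 0.
  by apply: filterS nz => y; apply: contraNneq => ->; rewrite mul0r.
split; first exact: u0.
apply/eF; apply: eq_expands h2; near=> y; rewrite eV ?invf_div //; near: y; exact: u0.
Unshelve. all: by end_near. Qed.

End Asymptotics.

(** * Schur recursion and Hankel determinants *)

Section Schur.
Variable R : realType.

Lemma dvdXnP (n : nat) (p : {poly R}) : reflect (forall k, (k < n)%N -> p`_k = 0) ('X^n %| p).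
Proof.
apply: (iffP idP) => [/dvdpP [q ->] k hk|h]; first by rewrite coefMXn hk.
rewrite -[p](poly_take_drop n) (_ : take_poly n p = 0) ?add0r ?dvdp_mull //.
by apply/polyP => k; rewrite coef_take_poly coef0; case: ltnP => // /h.
Qed.

Lemma dvdXn_small n (p : {poly R}) : (size p <= n)%N -> 'X^n %| p -> p = 0.
Proof.
move=> sp dp; apply/eqP; apply: contraTT dp => p0; apply/negP => /(dvdp_leq p0).
by rewrite size_polyXn ltnNge sp.
Qed.

Lemma dvdXn_shift n k (p : {poly R}) : ('X^(n + k) %| p * 'X^k) = ('X^n %| p).
Proof. by rewrite exprD dvdp_mul2r // -size_poly_eq0 size_polyXn. Qed.

Lemma inverse_modP n (P Q : {poly R}) : inverse_mod n P Q <-> 'X^n %| P * Q - 1.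
Proof.
split=> [[D ->]|/dvdpP [D e]]; first by rewrite addrAC subrr add0r dvdp_mulr.
by exists D; rewrite (mulrC 'X^n) -e addrC subrK.
Qed.

Lemma inverse_mod_le a b (P Q : {poly R}) : (a <= b)%N -> inverse_mod b P Q -> inverse_mod a P Q.
Proof.
move=> ab /inverse_modP h; apply/inverse_modP; apply: dvdp_trans h; exact: dvdp_exp2l.
Qed.

(** Upper triangular Toeplitz matrices multiply like truncated power series.
    *)
Lemma toeplitz_inverse n (c a : seq R) : toeplitz n c *m toeplitz n a = 1%:M ->
  inverse_mod n (Poly c) (Poly a).
Proof.
move=> h; apply/inverse_modP/dvdXnP => k hk.
have n0 : (0 < n)%N by apply: leq_ltn_trans hk.
have := congr1 (fun A : 'M[R]_n => fun_of_matrix A (Ordinal n0) (Ordinal hk)) h.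
rewrite !mxE coefB coefM coef1 /= => e; apply/eqP; rewrite subr_eq0; apply/eqP.
transitivity (\sum_(j < n) toeplitz n c (Ordinal n0) j * toeplitz n a j (Ordinal hk)); last first.
  by rewrite e; case: k hk e.
rewrite (big_ord_widen n (fun i => (Poly c)`_i * (Poly a)`_(k - i))) // [LHS]big_mkcond /=.
apply: eq_bigr => j _; rewrite !mxE /= subn0 ltnS !coef_Poly.
by case: ifP; rewrite ?mulr0.
Qed.

Lemma Poly_mrev_cat (m : {poly R}) nu (fs : seq R) :
  Poly (rev (mkseq (fun i => m`_i) nu) ++ map -%R fs) = mrev m nu - 'X^nu * Poly fs.
Proof.
apply/polyP => i; rewrite coefB coefXnM !coef_Poly nth_cat size_rev size_mkseq.
case: ltnP => hi; rewrite ?subr0 //.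
rewrite (nth_default 0 (s := rev _)) ?size_rev ?size_mkseq // sub0r.
have [hi'|hi'] := ltnP (i - nu) (size fs); first by rewrite (nth_map 0).
by rewrite !nth_default ?oppr0 ?size_map.
Qed.

Lemma Poly_cons_opp l (s : seq R) : Poly (l :: map -%R s) = l%:P - 'X * Poly s.
Proof.
apply/polyP => -[|i]; rewrite coefB coefC coefXM coef_Poly /= ?subr0 // sub0r coef_Poly.
have [hi'|hi'] := ltnP i (size s); first by rewrite (nth_map 0).
by rewrite !nth_default ?oppr0 ?size_map.
Qed.

(** The matrix of schur_delta, with an arbitrary last row. *)
Definition shifted_rows (s : seq R) n (r : 'I_n.+1 -> R) : 'M[R]_n.+1 :=
  \matrix_(i < n.+1, p < n.+1) if (i.+1 < n.+1)%N then s`_(i + p).+1 else r p.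

(** Expansion along the last row: the cofactors are the same for all rows r.
    *)
Lemma schur_delta_coef (s : seq R) n : exists c : 'I_n.+1 -> R,
  schur_delta s n.+1 = \sum_p c p *: 'X^p /\
  forall r, \det (shifted_rows s r) = \sum_p c p * r p.
Proof.
pose c (p : 'I_n.+1) : R := cofactor (shifted_rows s (fun _ : 'I_n.+1 => 0)) ord_max p; exists c; split=> [|r].
  rewrite /schur_delta (expand_det_row _ ord_max); apply: eq_bigr => p _.
  rewrite mxE /= ltnn mulrC -mul_polyC; congr (_ * _).
  rewrite /c /cofactor -[in LHS](polyC1) rmorphM rmorphXn rmorphN1 /= polyC1; congr (_ * _).
  rewrite -det_map_mx; congr (\det _); apply/matrixP => i j; rewrite !mxE.
  have -> : ((fintype.lift ord_max i).+1 < n.+1)%N = true by rewrite lift_max ltnS ltn_ord.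
  by [].
rewrite (expand_det_row _ ord_max); apply: eq_bigr => p _.
rewrite mxE /= ltnn mulrC; congr (_ * _); rewrite /c /cofactor; congr (_ * _).
congr (\det _); apply/matrixP => i j; rewrite !mxE.
have -> : ((fintype.lift ord_max i).+1 < n.+1)%N = true by rewrite lift_max ltnS ltn_ord.
by [].
Qed.

Lemma size_schur_m (s : seq R) nu : (0 < nu)%N -> (size (schur_m s nu) <= nu)%N.
Proof.
case: nu => // n _; have [c [e _]] := schur_delta_coef s n.
rewrite /schur_m e; apply: leq_trans (size_scale_leq _ _) _.
apply: leq_trans (size_sum _ _ _) _; apply/bigmax_leqP => p _.
by apply: leq_trans (size_scale_leq _ _) _; rewrite size_polyXn.
Qed.

(** Pairing the coefficients of m with shifted moments gives determinants with
    a repeated row, except in degree 0, where a cyclic permutation of the rows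
    leads back to the Hankel matrix. *)
Lemma schur_m_inverse (s : seq R) n : (forall i, (i < n)%N -> s`_i = 0) ->
  \det (hankel s n.+1) != 0 ->
  inverse_mod n.+1 (mrev (schur_m s n.+1) n.+1) (Poly (drop n s)).
Proof.
move=> s0 d0; have [c [e hc]] := schur_delta_coef s n.
pose k : R := (-1) ^+ n.+2 / \det (hankel s n.+1).
have em (p : 'I_n.+1) : (schur_m s n.+1)`_p = k * c p.
  rewrite /schur_m e coefZ coef_sum (bigD1 p) //= coefZ coefXn eqxx mulr1.
  rewrite big1 ?addr0 // => q qp; rewrite coefZ coefXn.
  by rewrite (_ : (p == q :> nat) = false) ?mulr0 //; apply/negbTE; rewrite eq_sym.
have eL r : \sum_(p < n.+1) (schur_m s n.+1)`_p * r p = k * \det (shifted_rows s r).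
  by rewrite hc mulr_sumr; apply: eq_bigr => p _; rewrite em mulrA.
apply/inverse_modP/dvdXnP => j hj; rewrite coefB coefM coef1.
have -> : \sum_(i < j.+1) (mrev (schur_m s n.+1) n.+1)`_i * (Poly (drop n s))`_(j - i) =
   \sum_(p < n.+1) (schur_m s n.+1)`_p * s`_(p + j).
  rewrite (big_ord_widen n.+1 (fun i => (mrev (schur_m s n.+1) n.+1)`_i *
    (Poly (drop n s))`_(j - i))) // big_mkcond /= (reindex_inj rev_ord_inj) /=.
  apply: eq_bigr => i _; rewrite subSS ltnS.
  have hi : (i <= n)%N by rewrite -ltnS.
  case: leqP => hij; last by rewrite s0 ?mulr0 //; lia.
  rewrite !coef_Poly nth_rev ?size_mkseq; last by lia.
  rewrite nth_mkseq; last by lia.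
  by rewrite nth_drop; congr (_`_ _ * _`_ _); lia.
case: j hj => [|j] hj /=; last first.
  rewrite (eL (fun p => s`_(p + j.+1))) subr0.
  rewrite (@determinant_alternate _ _ _ (Ordinal (ltnW hj)) ord_max) ?mulr0 //.
    by rewrite -val_eqE /= neq_ltn -ltnS hj.
  by move=> p; rewrite !mxE /= hj ltnn addnC addnS.
rewrite (eL (fun p => s`_(p + 0))).
have -> : shifted_rows s (fun p => s`_(p + 0)) =
    row_perm (lift_perm ord_max ord0 (1%g : {perm 'I_n})) (hankel s n.+1).
  apply/matrixP => i p; rewrite !mxE; case: (unliftP ord_max i) => [i'|] ->.
    have -> : ((fintype.lift ord_max i').+1 < n.+1)%N = true by rewrite lift_max ltnS ltn_ord.
    by rewrite lift_perm_lift perm1 lift_max lift0 addSn.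
  by rewrite ltnn lift_perm_id /= addnC.
rewrite row_permE det_mulmx det_perm odd_lift_perm odd_perm1 /= !addbF signr_odd.
rewrite /k; apply/eqP; rewrite subr_eq0; apply/eqP.
transitivity (((-1) ^+ n * (-1) ^+ n.+2 : R) * (\det (hankel s n.+1) / \det (hankel s n.+1))).
  by ring.
by rewrite divff // mulr1 -exprD addnS addnS !exprS mulrA mulrNN !mul1r addnn -muln2 exprM sqrr_sign.
Qed.

(** Approximants of S with one order of contact more than the generic ones: p
    and q have 2 n - 1 coefficients, subject to 2 n - 1 linear equations. By
    hankel_pade they exist exactly if the Hankel determinant vanishes, and in
    this form the vanishing passes through the recursion by polynomial
    algebra. *)
Definition pade (S : {poly R}) n := exists p q : {poly R},
  [/\ p != 0, (size p <= n)%N, (size q <= n.-1)%N & 'X^(2 * n - 1) %| p * S - q].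

Lemma hankel_pade (s : seq R) n : (0 < n)%N -> \det (hankel s n) = 0 <-> pade (Poly s) n.
Proof.
move=> n0; have n1 : n = n.-1.+1 by rewrite prednK.
have coefE (p : {poly R}) (i : 'I_n) : (size p <= n)%N ->
    (p * Poly s)`_(n.-1 + i) = \sum_(j < n) p`_(n - j.+1) * s`_(j + i).
  move=> sp; rewrite coefM.
  have hn : (n <= (n.-1 + i).+1)%N by rewrite {1}n1 ltnS leq_addr.
  transitivity (\sum_(a < n) p`_a * (Poly s)`_(n.-1 + i - a)).
    rewrite (big_ord_widen _ (fun a => p`_a * (Poly s)`_(n.-1 + i - a)) hn) [RHS]big_mkcond /=.
    by apply: eq_bigr => a _; case: ltnP => // ha; rewrite (nth_default _ (leq_trans sp ha)) mul0r.
  rewrite (reindex_inj rev_ord_inj) /=; apply: eq_bigr => j _; rewrite coef_Poly.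
  congr (_ * _`_ _); have := ltn_ord j; lia.
split=> [/eqP/det0P [v v0 hv]|[p [q [p0 sp sq hpq]]]].
  pose p : {poly R} := \poly_(a < n) (if insub (n - a.+1)%N is Some j then v ord0 j else 0).
  have pE (j : 'I_n) : p`_(n - j.+1) = v ord0 j.
    have hj := ltn_ord j; rewrite coef_poly (_ : n - j.+1 < n)%N; last by lia.
    have -> : (n - (n - j.+1).+1 = j)%N by lia.
    by rewrite valK.
  have sp : (size p <= n)%N := size_poly _ _.
  exists p, (take_poly n.-1 (p * Poly s)); split=> //.
  - apply: contraNneq v0 => p0; apply/eqP/rowP => j.
    by rewrite mxE -pE p0 coef0.
  - exact: size_take_poly.
  - apply/dvdXnP => k hk; rewrite coefB coef_take_poly; case: ltnP => hkn; first by rewrite subrr.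
    have hi : (k - n.-1 < n)%N by lia.
    rewrite subr0 -(subnKC hkn) -[(k - n.-1)%N]/(val (Ordinal hi)) coefE //.
    have := congr1 (fun A : 'rV[R]_n => fun_of_matrix A ord0 (Ordinal hi)) hv.
    rewrite !mxE => h; rewrite -[RHS]h; apply: eq_bigr => j _.
    by rewrite pE !mxE.
apply/eqP/det0P; exists (\row_(j < n) p`_(n - j.+1)).
  apply: contraNneq p0 => e; apply/eqP/polyP => a; rewrite coef0.
  have [ha|ha] := ltnP a n; last by rewrite nth_default // (leq_trans sp).
  have ha' : (n - a.+1 < n)%N by lia.
  have := congr1 (fun A : 'rV[R]_n => fun_of_matrix A ord0 (Ordinal ha')) e.
  by rewrite !mxE /= (_ : n - (n - a.+1).+1 = a)%N //; lia.
apply/rowP => i; rewrite !mxE.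
have hi := ltn_ord i; have hk : (n.-1 + i < 2 * n - 1)%N by lia.
have := (dvdXnP _ _ hpq) _ hk; rewrite coefB coefE // (nth_default _ (s := q)); last first.
  by apply: leq_trans sq _; exact: leq_addr.
rewrite subr0 => h; rewrite -[RHS]h; apply: eq_bigr => j _; by rewrite !mxE.
Qed.

Lemma coprime_Xn n (p : {poly R}) : p`_0 != 0 -> coprimep 'X^n p.
Proof.
move=> p0; rewrite coprimep_sym coprimep_expr // coprimep_sym.
by rewrite coprimep_sym coprimepX -horner_coef0 in p0 *.
Qed.

(** If s_i were the first nonzero moment, the Hankel matrix of size i + 1
    would be antitriangular and nonsingular. *)
Lemma hankel_prefix (s : seq R) nu : (forall n, (0 < n < nu)%N -> \det (hankel s n) = 0) ->
  forall i, (i < nu.-1)%N -> s`_i = 0.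
Proof.
move=> d0; elim/ltn_ind => i IH hi; apply/eqP; apply: contraT => si.
have IH' j : (j < i)%N -> s`_j = 0 by move=> hj; apply: IH => //; exact: ltn_trans hi.
have /hankel_pade [|p [q [p0 sp sq hpq]]] // : \det (hankel s i.+1) = 0 by apply: d0; lia.
pose A := Poly (drop i s).
have eS : Poly s = A * 'X^i.
  apply/polyP => k; rewrite coefMXn !coef_Poly; case: ltnP => hk; first exact: IH'.
  by rewrite nth_drop subnKC.
have A0 : A`_0 != 0 by rewrite coef_Poly nth_drop addn0.
have hq : 'X^i %| q.
  have h1 : 'X^i %| p * Poly s - q by apply: dvdp_trans hpq; apply: dvdp_exp2l; lia.
  have h2 : 'X^i %| p * Poly s by rewrite eS mulrA dvdp_mull.
  by rewrite -(subKr (p * Poly s) q) dvdp_sub.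
have q0 := dvdXn_small sq hq.
move: hpq; rewrite q0 subr0 eS mulrA (_ : 2 * i.+1 - 1 = i.+1 + i)%N; last by lia.
rewrite dvdXn_shift Gauss_dvdpl ?coprime_Xn // => /(dvdXn_small sp) /eqP.
by rewrite (negPf p0).
Qed.

Lemma size_shift (q : {poly R}) k n : (size (q * 'X^k)%R <= n + k)%N -> (size q <= n)%N.
Proof.
have [->|q0] := eqVneq q 0; first by rewrite size_poly0.
by rewrite size_Mmonic ?monicXn // size_polyXn addnS /= leq_add2r.
Qed.

Lemma size_shift_le (q : {poly R}) k n : (size q <= n)%N -> (size (q * 'X^k)%R <= n + k)%N.
Proof.
have [->|q0] := eqVneq q 0; first by rewrite mul0r size_poly0.
by rewrite size_Mmonic ?monicXn // size_polyXn addnS /= leq_add2r.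
Qed.

Lemma size_mul_le (p q : {poly R}) a b : (0 < a)%N -> (size p <= a)%N -> (size q <= b)%N ->
  (size (p * q)%R <= a.-1 + b)%N.
Proof.
move=> a0 sp sq; have [->|p0] := eqVneq p 0; first by rewrite mul0r size_poly0.
have [->|q0] := eqVneq q 0; first by rewrite mulr0 size_poly0.
rewrite size_mul // (leq_trans (_ : _ <= (a + b).-1)%N) //; last by lia.
by rewrite -!subn1 leq_sub2r // leq_add.
Qed.

Lemma dvdXn_cancel n (A B p q : {poly R}) : 'X^n %| A * B - 1 ->
  ('X^n %| A * p - q) = ('X^n %| p - B * q).
Proof.
move=> h.
have e1 : p - B * q = B * (A * p - q) - (A * B - 1) * p by ring.
have e2 : A * p - q = A * (p - B * q) + (A * B - 1) * q by ring.
apply/idP/idP => h1; first by rewrite e1; apply: dvdp_sub; [exact: dvdp_mull|exact: dvdp_mulr].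
by rewrite e2; apply: dvdp_add; [exact: dvdp_mull|exact: dvdp_mulr].
Qed.

(** The recursion maps a function to the tail of its continued fraction by a
    Moebius transformation with polynomial coefficients. The same
    transformation maps the approximants of the function to those of the tail.
    *)
Lemma pade_transfer (A F G S1 M : {poly R}) l nu n :
  (0 < nu)%N -> (0 < n)%N -> (size M <= nu)%N -> G = l%:P - S1 * 'X :> {poly R} ->
  'X^(2 * n) %| G * F - 1 -> 'X^(nu + 2 * n) %| A * (M - F * 'X^nu) - 1 ->
  pade (A * 'X^(nu.-1))%R (nu + n) <-> pade S1 n.
Proof.
move=> nu0 n0 sM eG hGF hA; pose C := M - F * 'X^nu.
have hFG : 'X^(2 * n) %| F * G - 1 by rewrite mulrC.
have dn2 : (2 * (nu + n) - 1 = nu + 2 * n + nu.-1)%N by lia.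
split=> [[p [q [p0 sp sq hpq]]]|[r [q2 [r0 sr sq hrq]]]].
  have hq : 'X^(nu.-1) %| q.
    have h1 : 'X^(nu.-1) %| p * (A * 'X^(nu.-1)) - q.
      by apply: dvdp_trans hpq; apply: dvdp_exp2l; lia.
    have h2 : 'X^(nu.-1) %| p * (A * 'X^(nu.-1)) by rewrite mulrA dvdp_mull.
    by rewrite -(subKr (p * (A * 'X^(nu.-1))) q) dvdp_sub.
  case/dvdpP: hq => q1 eq; rewrite eq in hpq sq.
  have sq1 : (size q1 <= n)%N by apply: (@size_shift _ nu.-1); apply: leq_trans sq _; lia.
  have hA1 : 'X^(nu + 2 * n) %| A * p - q1.
    rewrite -(dvdXn_shift _ nu.-1) -dn2; congr (_ %| _): hpq; ring.
  have hp : 'X^(nu + 2 * n) %| p - C * q1 by rewrite -(dvdXn_cancel _ _ hA).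
  have hr : 'X^nu %| p - M * q1.
    have -> : p - M * q1 = (p - C * q1) - F * q1 * 'X^nu by rewrite /C; ring.
    rewrite dvdp_sub ?dvdp_mull //; apply: dvdp_trans hp; apply: dvdp_exp2l; lia.
  (* p = M q1 - X^nu r is the first half of the transformation, and
   q1 = l r - X q2 below is the second *)
case/dvdpP: hr => r' er; pose r := - r'.
  have er' : p - M * q1 = - (r * 'X^nu) by rewrite er /r; ring.
  have sr : (size r <= n)%N.
    apply: (@size_shift _ nu); rewrite -size_polyN -er'.
    apply: leq_trans (size_polyD _ _) _; rewrite geq_max size_polyN; apply/andP; split.
      by apply: leq_trans sp _; lia.
    by apply: leq_trans (size_mul_le nu0 sM sq1) _; lia.
  have hr1 : 'X^(2 * n) %| r - F * q1.
    rewrite -(dvdXn_shift _ nu) -dvdpNr [in 'X^_]addnC; congr (_ %| _): hp.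
    transitivity ((p - M * q1) + F * q1 * 'X^nu); first by rewrite /C; ring.
    by rewrite er'; ring.
  have hG1 : 'X^(2 * n) %| G * r - q1 by rewrite (dvdXn_cancel _ _ hGF).
  have hX : 'X^1 %| r * l%:P - q1.
    have -> : r * l%:P - q1 = (G * r - q1) + r * S1 * 'X^1 by rewrite eG expr1; ring.
    rewrite dvdp_add ?dvdp_mull //; apply: dvdp_trans hG1; apply: dvdp_exp2l; lia.
  case/dvdpP: hX => q2 eq2; exists r, q2; split=> //.
  - apply: contraNneq p0 => r0; rewrite r0 mulr0 sub0r dvdpNr in hG1.
    have q10 : q1 = 0 by apply: (dvdXn_small _ hG1); apply: leq_trans sq1 _; lia.
    by move: er'; rewrite r0 q10 mul0r mulr0 subr0 oppr0 => ->.
  - have : (size (q2 * 'X^1)%R <= n)%N.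
      rewrite -eq2; apply: leq_trans (size_polyD _ _) _; rewrite geq_max size_polyN sq1 andbT.
      by rewrite mulrC mul_polyC; apply: leq_trans (size_scale_leq _ _) sr.
    rewrite [in X in X -> _](_ : n = n.-1 + 1)%N; last by rewrite addn1 prednK.
    exact: size_shift.
  - rewrite -(dvdXn_shift _ 1) (_ : 2 * n - 1 + 1 = 2 * n)%N; last by lia.
    rewrite -dvdpNr; congr (_ %| _): hG1.
    by rewrite mulrBl -eq2 eG expr1; ring.
pose q1 := r * l%:P - q2 * 'X.
have sq1 : (size q1 <= n)%N.
  apply: leq_trans (size_polyD _ _) _; rewrite geq_max size_polyN; apply/andP; split.
    by rewrite mulrC mul_polyC; apply: leq_trans (size_scale_leq _ _) sr.
  by have := size_shift_le 1 sq; rewrite expr1 addn1 prednK.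
have hG1 : 'X^(2 * n) %| G * r - q1.
  have -> : G * r - q1 = - ((r * S1 - q2) * 'X^1) by rewrite eG /q1 expr1; ring.
  by rewrite dvdpNr (_ : 2 * n = 2 * n - 1 + 1)%N ?dvdXn_shift //; lia.
have hr1 : 'X^(2 * n) %| r - F * q1 by rewrite -(dvdXn_cancel _ _ hGF).
pose p := M * q1 - r * 'X^nu.
have hp : 'X^(nu + 2 * n) %| p - C * q1.
  have -> : p - C * q1 = - ((r - F * q1) * 'X^nu) by rewrite /p /C; ring.
  by rewrite dvdpNr addnC dvdXn_shift.
have hA1 : 'X^(nu + 2 * n) %| A * p - q1 by rewrite (dvdXn_cancel _ _ hA).
exists p, (q1 * 'X^(nu.-1)); split.
- apply: contraNneq r0 => p0; rewrite p0 mulr0 sub0r dvdpNr in hA1.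
  have q10 : q1 = 0 by apply: (dvdXn_small _ hA1); apply: leq_trans sq1 _; lia.
  move/eqP: p0; rewrite /p q10 mulr0 sub0r oppr_eq0 mulf_eq0.
  by rewrite -[_ == 0 in X in _ || X]size_poly_eq0 size_polyXn orbF.
- apply: leq_trans (size_polyD _ _) _; rewrite geq_max size_polyN; apply/andP; split.
    by apply: leq_trans (size_mul_le nu0 sM sq1) _; lia.
  by apply: leq_trans (size_shift_le _ sr) _; lia.
- by apply: leq_trans (size_shift_le _ sq1) _; lia.
- have -> : p * (A * 'X^(nu.-1)) - q1 * 'X^(nu.-1) = (A * p - q1) * 'X^(nu.-1) by ring.
  by rewrite dn2 dvdXn_shift.
Qed.

Lemma prefix_Poly (s : seq R) nu : (forall i, (i < nu)%N -> s`_i = 0) ->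
  Poly s = Poly (drop nu s) * 'X^nu.
Proof.
move=> s0; apply/polyP => k; rewrite coefMXn !coef_Poly; case: ltnP => hk; first exact: s0.
by rewrite nth_drop subnKC.
Qed.

(** The normal indices of the tail are those of s, shifted by nu. *)
Lemma hankel_transfer (s s1 fs : seq R) (m : {poly R}) l nu n :
  (0 < nu)%N -> (0 < n)%N -> (2 * n - 1 <= size s1)%N ->
  (forall i, (i < nu.-1)%N -> s`_i = 0) ->
  inverse_mod (size s1 + nu).+1 (mrev m nu - 'X^nu * Poly fs) (Poly (drop nu.-1 s)) ->
  inverse_mod (size s1).+1 (l%:P - 'X * Poly s1) (Poly fs) ->
  \det (hankel s (nu + n)) = 0 <-> \det (hankel s1 n) = 0.
Proof.
move=> nu0 n0 le s0 h1 h2; rewrite !hankel_pade ?addn_gt0 ?nu0 // (prefix_Poly s0).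
apply: (@pade_transfer _ (Poly fs) (l%:P - Poly s1 * 'X) _ (mrev m nu) l) => //.
- by rewrite /mrev; apply: leq_trans (size_Poly _) _; rewrite size_rev size_mkseq.
- apply/inverse_modP; rewrite (mulrC _ 'X).
  by apply: inverse_mod_le h2; lia.
- apply/inverse_modP; rewrite (mulrC (Poly fs)); apply: inverse_mod_sym.
  by apply: inverse_mod_le h1; lia.
Qed.

Lemma nidx_lt (ns : seq nat) j k : sorted ltn ns -> (forall n, n \in ns -> (0 < n)%N) ->
  (k <= size ns)%N -> (j < k)%N -> (nidx ns j < nidx ns k)%N.
Proof.
move=> so pos hk jk; rewrite /nidx.
have so' : sorted ltn (0%N :: ns).
  by case: ns so pos hk => //= x s -> pos _; rewrite pos ?mem_head.
by apply: (sorted_ltn_nth ltn_trans 0%N so'); rewrite ?inE //=; lia.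
Qed.

Lemma nidx_gap (ns : seq nat) j n : sorted ltn ns -> (forall n, n \in ns -> (0 < n)%N) ->
  (j < size ns)%N -> (nidx ns j < n < nidx ns j.+1)%N -> n \notin ns.
Proof.
move=> so pos hj /andP [h1 h2]; apply/negP => hn.
have hi : (index n ns < size ns)%N by rewrite index_mem.
have e : nidx ns (index n ns).+1 = n by rewrite /nidx /= nth_index.
case: (ltngtP (index n ns).+1 j.+1) => hc.
- have : (nidx ns (index n ns).+1 <= nidx ns j)%N.
    move: hc; rewrite ltnS leq_eqVlt => /orP [/eqP ->//|hc].
    by apply: ltnW; apply: nidx_lt => //; exact: ltnW.
  by rewrite e leqNgt h1.
- have : (nidx ns j.+1 < nidx ns (index n ns).+1)%N by apply: nidx_lt.
  by rewrite e ltnNge (ltnW h2).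
- by move: h2; rewrite -hc e ltnn.
Qed.

Lemma nidx_mem (ns : seq nat) j : (j < size ns)%N -> nidx ns j.+1 \in ns.
Proof. by move=> hj; rewrite /nidx /= mem_nth. Qed.

Section Recursion.
Variables (s : seq R) (ns : seq nat) (ss fs : nat -> seq R) (m : nat -> {poly R}) (l : nat -> R).
Let N := size ns.
Let nu j := (nidx ns j - nidx ns j.-1)%N.
Hypotheses (so : sorted ltn ns) (hns : forall n, (n \in ns) = normal_index s n).
Hypotheses (szs : size s = (2 * nidx ns N - 1)%N) (hrec : schur_recursion s ns ss fs m l).

Lemma ns_pos n : n \in ns -> (0 < n)%N.
Proof. by rewrite hns => /and3P []. Qed.

Lemma nu_gt0 j : (j < N)%N -> (0 < nu j.+1)%N.
Proof. by move=> hj; rewrite subn_gt0 /=; apply: nidx_lt => //; exact: ns_pos. Qed.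

Lemma nidx_nu j : (j < N)%N -> nidx ns j.+1 = (nidx ns j + nu j.+1)%N.
Proof.
by move=> hj; rewrite /nu /= subnKC // ltnW //; apply: nidx_lt => //; exact: ns_pos.
Qed.

Lemma nidx_le j : (j <= N)%N -> (nidx ns j <= nidx ns N)%N.
Proof.
rewrite leq_eqVlt => /orP [/eqP -> //|hj]; apply/ltnW/nidx_lt => //; exact: ns_pos.
Qed.

Lemma size_ss j : (j < N)%N -> size (ss j) = (2 * (nidx ns N - nidx ns j) - 1)%N.
Proof.
case: hrec => e0 _ _ hr; case: j => [|j] hj; first by rewrite e0 szs subn0.
have [|-> _ _ _] := hr j.+1; first by rewrite /= -ltnS (ltn_predK hj).
by rewrite szs mulnBr; lia.
Qed.

Lemma size_m j : (j < N)%N -> (size (m j.+1) <= nu j.+1)%N.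
Proof.
by case: hrec => _ hm _ _ hj; rewrite (hm j.+1) //; apply: size_schur_m; exact: nu_gt0.
Qed.

Lemma recursion_inverse j : (j.+1 < N)%N ->
  [/\ size (ss j) = (size (ss j.+1) + 2 * nu j.+1)%N,
     inverse_mod (size (ss j.+1) + nu j.+1).+1 (mrev (m j.+1) (nu j.+1) - 'X^(nu j.+1) * Poly (fs j.+1))
       (Poly (drop (nu j.+1).-1 (ss j))) &
     inverse_mod (size (ss j.+1)).+1 ((l j.+1)%:P - 'X * Poly (ss j.+1)) (Poly (fs j.+1))].
Proof.
move=> hj; have hj' := ltnW hj; split.
- rewrite !size_ss //; have := nidx_nu hj'; have := nidx_nu hj; have := nu_gt0 hj.
  have := nidx_le hj; lia.
- case: hrec => _ _ _ hr; have [|h1 h2 h3 _] := hr j.+1; first by rewrite /= -ltnS (ltn_predK hj).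
  move: h3; rewrite size_cat size_rev size_mkseq size_map h2 /= -/(nu j.+1) => /toeplitz_inverse.
  by rewrite Poly_mrev_cat addnS addnC.
- case: hrec => _ _ _ hr; have [|h1 h2 _ h4] := hr j.+1; first by rewrite /= -ltnS (ltn_predK hj).
  by move: h4 => /=; rewrite size_map => /toeplitz_inverse; rewrite Poly_cons_opp.
Qed.

Lemma hankel_levels j : (j < N)%N -> forall n, (0 < n)%N -> (2 * n - 1 <= size (ss j))%N ->
  (\det (hankel (ss j) n) == 0) = (nidx ns j + n \notin ns)%N.
Proof.
elim: j => [|j IH] hj n n0 hn.
  have [e0 _ _ _] := hrec; rewrite /nidx /= add0n hns /normal_index n0 e0 in hn *.
  by rewrite hn negbK.
have hj' := ltnW hj; have [e1 h1 h2] := recursion_inverse hj.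
have nu0 := nu_gt0 hj'.
have pre : forall i, (i < (nu j.+1).-1)%N -> (ss j)`_i = 0.
  apply: hankel_prefix => i /andP [i0 hi]; apply/eqP; rewrite IH //; last by rewrite e1; lia.
  by apply: (nidx_gap so ns_pos hj'); rewrite nidx_nu //; lia.
have := hankel_transfer nu0 n0 hn pre h1 h2 => e.
have := IH hj' (nu j.+1 + n)%N; rewrite addn_gt0 nu0 addnA -nidx_nu // => <- //; last by rewrite e1; lia.
by apply/eqP/eqP => /e.
Qed.

Lemma ss_prefix j : (j < N)%N -> forall i, (i < (nu j.+1).-1)%N -> (ss j)`_i = 0.
Proof.
move=> hj; have le := nidx_le hj; have e := nidx_nu hj.
apply: hankel_prefix => i /andP [i0 hi]; apply/eqP; rewrite hankel_levels //.
  by apply: (nidx_gap so ns_pos hj); rewrite e; lia.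
by rewrite size_ss //; lia.
Qed.

Lemma m_inverse j : (j < N)%N ->
  inverse_mod (nu j.+1) (mrev (m j.+1) (nu j.+1)) (Poly (drop (nu j.+1).-1 (ss j))).
Proof.
move=> hj; have nu0 := nu_gt0 hj; have [_ hm _ _] := hrec; rewrite hm //= -/(nu j.+1).
have le := nidx_le hj; have e := nidx_nu hj.
have pre := ss_prefix hj.
have d0 : \det (hankel (ss j) (nu j.+1)) != 0.
  by rewrite hankel_levels // ?negbK -?nidx_nu ?nidx_mem // size_ss //; lia.
move: nu0 pre d0; case: (nu j.+1) => // n _ pre d0; exact: schur_m_inverse.
Qed.

Lemma l_neq0 j : (j.+1 < N)%N -> l j.+1 != 0.
Proof.
move=> hj; have [_ _ /inverse_modP /dvdXnP /(_ 0%N isT)] := recursion_inverse hj.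
rewrite coefB coef1 coefM big_ord1 coefB coefC coefXM subr0 /= => /eqP.
by rewrite subr_eq0; apply: contraTneq => ->; rewrite mul0r eq_sym oner_eq0.
Qed.

End Recursion.

End Schur.

(** * Parametrization of the solutions *)

Section Assembly.
Variable R : realType.
Local Notation C := R[i].
Local Notation V2 := (C * C)%type.

Lemma expands_trunc (g : R -> C) (P P' : {poly R}) n d : (d <= n)%N -> 'X^(d.+1) %| P - P' ->
  expands g P n -> expands g P' d.
Proof.
move=> dn /dvdpP [D eD] h; rewrite /expands.
apply: (cvg_near_eq (f := fun y => (g y - evalC P (imag y)^-1) * imag y ^+ n *
   (imag y)^-1 ^+ (n - d) + evalC D (imag y)^-1 * (imag y)^-1)).
  near=> y; have y0 : imag y != 0 by near: y; exact: near_imag.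
  have -> : P = P' + D * 'X^(d.+1) by rewrite -eD addrC subrK.
  have -> : imag y ^+ n = imag y ^+ d * imag y ^+ (n - d) by rewrite -exprD subnKC.
  rewrite evalCD evalCM evalCXn !exprVn exprS; field.
  by rewrite y0 !expf_neq0.
rewrite -[X in _ --> X](_ : 0 * 0 ^+ (n - d) + evalC D 0 * 0 = 0); last first.
  by rewrite mul0r mulr0 addr0.
apply: cvgD; apply: cvgM.
- exact: h.
- exact: cvg_invimagX.
- exact: cvg_evalC.
- exact: cvg_invimag.
Unshelve. all: by end_near. Qed.

Lemma evalC_moments (s : seq R) d (z : C) :
  evalC ('X * Poly (take d s)) z^-1 = \sum_(j < d) (s`_j)%:C / z ^+ j.+1.
Proof.
rewrite evalCM evalCX (evalC_coef _ (size_Poly _)) mulr_sumr.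
have [hd|hd] := ltnP d (size s).
  rewrite size_take hd; apply: eq_bigr => i _.
  by rewrite coef_Poly nth_take // mulrCA -exprS exprVn.
rewrite take_oversize // (big_ord_widen d (fun i => z^-1 * (((Poly s)`_i)%:C * z^-1 ^+ i)) hd).
rewrite big_mkcond; apply: eq_bigr => i _ /=; rewrite coef_Poly mulrCA -exprS exprVn.
by case: ltnP => // hi; rewrite nth_default // mul0r.
Qed.

Lemma asym_hankel (X : C -> V2) (s : seq R) n k : (2 * n - 1 <= size s)%N -> asym X s ->
  neg_ge (mxC (hankel s n)) k -> idx_ge (ker X) k.
Proof.
move=> le [v0 h]; apply: hankel_index_ge; first exact: v0.
have h' : expands (fun y => (X (imag y)).1 / (X (imag y)).2)
    (- ('X * Poly (take (2 * n - 1) s))) (2 * n - 1).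
  apply: expands_trunc le _ h.
  have -> : - ('X * Poly s) - - ('X * Poly (take (2 * n - 1) s)) =
    - ('X * (Poly s - Poly (take (2 * n - 1) s))) by ring.
  rewrite dvdpNr exprS dvdp_mul2l ?polyX_eq0 //.
  by apply/dvdXnP => i hi; rewrite coefB !coef_Poly nth_take // subrr.
apply: cvg_near_eq h'; near=> y.
by rewrite evalCN opprK evalC_moments.
Unshelve. all: by end_near. Qed.

Lemma asym_opp X (s : seq R) : asym X s -> asym (oppX X) (map -%R s).
Proof.
move=> [v0 h]; split; first exact: v0.
have -> : Poly (map -%R s) = - Poly s.
  apply/polyP => i; rewrite coefN !coef_Poly.
  have [hi|hi] := ltnP i (size s); first by rewrite (nth_map 0).
  by rewrite !nth_default ?oppr0 ?size_map.
rewrite size_map /expands -[X in _ --> X]oppr0.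
apply: (cvg_near_eq (f := fun y => - (((X (imag y)).1 / (X (imag y)).2 -
   evalC (- ('X * Poly s)) (imag y)^-1) * imag y ^+ size s))).
  by near=> y; rewrite /oppX /= mulrN !evalCN; ring.
by apply: cvgN; exact: h.
Unshelve. all: by end_near. Qed.

Lemma asym_zmul X (s : seq R) : (0 < size s)%N -> asym X s ->
  asym (translate (s`_0)%:P (zmul X)) (behead s).
Proof.
case: s => // a s _ [v0 h]; split; first exact: v0.
rewrite /expands; apply: cvg_near_eq h; near=> y.
have v0' : (X (imag y)).2 != 0 by near: y.
have y0 : imag y != 0 by near: y; exact: near_imag.
rewrite /translate /zmul /= evalCC exprS !evalCN !evalCM evalCX.
have -> : cons_poly a (Poly s) = Poly s * 'X + a%:P by rewrite cons_poly_def.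
rewrite evalCD evalCM evalCX evalCC; field.
by rewrite y0 v0'.
Unshelve. all: by end_near. Qed.

Lemma asym_scale X Y (s : seq R) : (forall z, upper z -> proportional (X z) (Y z)) ->
  asym X s -> asym Y s.
Proof.
move=> hXY [v0 h].
have e : \forall y \near +oo, proportional (X (imag y)) (Y (imag y)).
  near=> y; apply: hXY; rewrite /upper /=; near: y; exact: near_gt0.
split.
  near=> y; have : (X (imag y)).2 != 0 by near: y.
  have [c c0 ->] : proportional (X (imag y)) (Y (imag y)) by near: y.
  by rewrite mulf_eq0 negb_or => /andP [].
apply: eq_expands h; near=> y; have [c c0 ->] : proportional (X (imag y)) (Y (imag y)) by near: y.
by rewrite /= invfM mulrACA divff // mul1r.
Unshelve. all: by end_near. Qed.

Lemma moment_asym kappa k (s : seq R) (f : C -> option C) :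
  moment_solution kappa k s f <-> nevanlinna2 kappa k f /\ asym (homog \o f) s.
Proof.
have e y : f (imag y) != None ->
    imag y ^+ size s * (fin f (imag y) + \sum_(j < size s) (s`_j)%:C / imag y ^+ j.+1) =
    ((homog (f (imag y))).1 / (homog (f (imag y))).2 - evalC (- ('X * Poly s)) (imag y)^-1) *
      imag y ^+ size s.
  move=> fy; have := evalC_moments s (size s) (imag y); rewrite take_size => <-.
  rewrite evalCN opprK mulrC; congr ((_ + _) * _); rewrite /fin.
  by case: (f _) fy => //= w _; rewrite divr1.
split=> [[h1 h2 h3]|[h1 [v0 h]]].
  split; first exact: h1.
  split; first by apply: filterS h2 => y; rewrite -/(imag y) /=; case: (f _) => //= w _; exact: oner_neq0.
  by rewrite /expands; apply: cvg_near_eq h3; apply: filterS h2 => y fy; apply: e.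
have h2 : \forall y \near +oo, f (imag y) != None.
  by apply: filterS v0 => y /=; case: (f _) => //=; rewrite eqxx.
split; [exact: h1|exact: h2|].
by apply: cvg_near_eq h; apply: filterS h2 => y fy; rewrite e.
Qed.

Lemma nontangential_slow (t : C -> option C) :
  nontangential_o_z (fun z => sphere_inv (t z)) -> slow (homog \o t).
Proof.
move=> h.
have key (delta : R) : 0 < delta -> \forall y \near +oo,
    (homog (t (imag y))).1 != 0 /\
    normc ((homog (t (imag y))).2 / (homog (t (imag y))).1) <= delta * y.
  move=> d0; have p0 := pi_gt0 R; have e0 : 0 < pi / 4 :> R by rewrite divr_gt0.
  have [rho hr] := h _ _ e0 d0; near=> y.
  have y0 : 0 < y by near: y; exact: near_gt0.
  have yr : rho < y by near: y; apply: nbhs_pinfty_gt; exact: num_real.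
  have [|w] := hr y (pi / 2) y0 yr.
    by apply/andP; split; move: p0; move: (pi : R) => p p0; lra.
  rewrite cos_pihalf sin_pihalf mulr0 mulr1 -/(imag y) /sphere_inv.
  case: (t (imag y)) => [v|].
    have [//|v0] := eqVneq v 0; move=> [<-] hw; split; first by move: v0; rewrite /homog /=.
    by have -> : (homog (Some v)).2 / (homog (Some v)).1 = v^-1 by rewrite /= mul1r.
  have e : (homog None).2 / (homog None).1 = 0 :> C by rewrite /= mul0r.
  by move=> [<-]; rewrite e; split; first exact: oner_neq0.
split.
  by apply: filterS (key 1 ltr01) => y [].
apply/cvgCP => e e0; have e2 : 0 < e / 2 by rewrite divr_gt0.
apply: filterS (filterI (key _ e2) (near_gt0 R)) => y [[_ hy] y0].
rewrite subr0 normcM -inv_real normc_real ger0_norm ?invr_ge0 ?ltW //.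
rewrite ltr_pdivrMr //; apply: le_lt_trans hy _; rewrite ltr_pM2r //.
by rewrite ltr_pdivrMr // ltr_pMr // ltr1n.
Unshelve. all: by end_near. Qed.

(** For a function of finite index the condition on the axis implies the one
    in sectors. *)
Lemma slow_nontangential_o (t : C -> option C) k : idx_le (ker (homog \o t)) k ->
  slow (homog \o t) -> nontangential_o_z (fun z => sphere_inv (t z)).
Proof.
move=> hk st eps delta e0 d0.
have [ep|ep] := ltP eps (pi / 2); last first.
  exists 0 => r th _ _ /andP [h1 h2]; have : eps < pi - eps := lt_trans h1 h2.
  by move: ep; move: (pi : R) => p ep h3; lra.
have p0 := pi_gt0 R.
have s0 : 0 < sin eps by apply: sin_gt0_pi; rewrite e0 /=; move: p0 ep; move: (pi : R) => p; lra.
have s1 : sin eps <= 1 by have := sin_le1 eps.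
have [rho hrho] := slow_nontangential hk st s0 s1 d0.
exists rho => r th r0 rr /andP [h1 h2].
pose z : C := (r * cos th) +i* (r * sin th).
have sin_le : sin eps <= sin th.
  have mono a : eps <= a <= pi / 2 -> sin eps <= sin a.
    rewrite le_eqVlt => /andP [/orP [/eqP -> //|a1] a2].
    apply: ltW; rewrite ltr_sin // in_itv /=; move: p0 a1 a2 ep e0; move: (pi : R) => p *;
      apply/andP; split; lra.
  have [ht|ht] := leP th (pi / 2); first by apply: mono; rewrite (ltW h1).
  have -> : sin th = sin (pi - th) by rewrite sinB sinpi cospi mul0r mulN1r sub0r opprK.
   apply: mono; move: h1 h2 ht; move: (pi : R) => p *; apply/andP; split; lra.
have nz : normc z = r.
  rewrite /z /= !exprMn -mulrDr cos2Dsin2 mulr1 sqrtr_sqr ger0_norm //; exact: ltW.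
have uz : upper z.
  by rewrite /upper /=; apply: mulr_gt0 => //; exact: lt_le_trans sin_le.
have := hrho z uz; rewrite nz => /(_ _ rr).
have -> : sin eps * r <= complex.Im z by rewrite /= mulrC ler_pM2l.
move=> /(_ isT); rewrite -/z /sphere_inv [(homog \o t) z]/(homog (t z)).
case: (t z) => [w|] hw; last first.
  by exists 0; rewrite ?normc0 // mulr_ge0 // ltW.
have {}hw : 1 <= delta * r * normc w.
  have e1 : normc (homog (Some w)).2 = 1 :> R by rewrite /homog normc1.
  by rewrite -e1.
have w0 : w != 0.
  by apply: contraTneq hw => ->; rewrite normc0 mulr0 -ltNge ltr01.
rewrite (negPf w0); exists w^-1 => //.
have nw : 0 < normc w by rewrite normc_gt0.
by rewrite normcV -div1r ler_pdivrMr.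
Qed.

Lemma shear_small (c : R) (X : C -> V2) : c != 0 -> slow X -> small (shear ('X * c%:P) X).
Proof.
move=> c0 [u0 h]; have c0' : - c%:C != 0 :> C by rewrite oppr_eq0 fmorph_eq0.
have i0 : imag 1 != 0 :> C by rewrite imag_eq0 oner_eq0.
pose g y := (shear ('X * c%:P) X (imag y)).2 / (X (imag y)).1 / imag y.
have hg : (g y : C^o) @[y --> +oo] --> (- c%:C : C^o).
  rewrite -[X in _ --> X](_ : 0 / imag 1 - c%:C = - c%:C); last by rewrite mul0r sub0r.
  apply: (cvg_near_eq (f := fun y => (X (imag y)).2 / (X (imag y)).1 / y%:C / imag 1 - c%:C)).
    near=> y; have u0' : (X (imag y)).1 != 0 by near: y.
    have y0 : imag y != 0 by near: y; exact: near_imag.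
    have y1 : y%:C != 0 :> C by rewrite fmorph_eq0 -imag_eq0.
    rewrite /g /shear /= evalCM evalCX evalCC.
    case: (X (imag y)) u0' => u v /= u0'; rewrite (imag_real y); field.
    by rewrite u0' y1 i0.
  apply: cvgD; last exact: cvg_cst.
  by apply: cvgM; [exact: h|exact: cvg_cst].
have nz := cvg_neq0 c0' hg; split.
  by apply: filterS nz => y; apply: contraNneq; rewrite /g => ->; rewrite !mul0r.
rewrite -[X in _ --> X](_ : (- c%:C)^-1 * 0 = 0); last by rewrite mulr0.
apply: (cvg_near_eq (f := fun y => (g y)^-1 * (imag y)^-1)).
  near=> y; have u0' : (X (imag y)).1 != 0 by near: y.
  have g0 : g y != 0 by near: y; exact: nz.
  have y0 : imag y != 0 by near: y; exact: near_imag.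
  have s0 : (shear ('X * c%:P) X (imag y)).2 != 0.
    by move: g0; apply: contraNneq; rewrite /g => ->; rewrite !mul0r.
  change (shear ('X * c%:P) X (imag y)).1 with (X (imag y)).1; rewrite /g; field.
  by rewrite s0 y0 u0'.
apply: cvgM; last exact: cvg_invimag.
by apply: cvgV; [exact: c0'|exact: hg].
Unshelve. all: by end_near. Qed.

(** A parameter with prescribed indices that satisfies the growth condition.
    *)
Definition param (a b : nat) (t : C -> option C) :=
  [/\ real_symmetric t, forall z0, upper z0 -> has_coords t z0,
      is_idx (ker (homog \o t)) a, is_idx (ker (zmul (homog \o t))) b & slow (homog \o t)].

(** The new parameter is e + 1 / (e z + 1 / t). For e > 0 the inner shear
    raises the first index by one; for e < 0 the translation, multiplied by z,
    raises the second. *)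
Lemma param_step (e : R) a b t : e != 0 -> param a b t ->
  exists t', param (a + (0 < e)%R) (b + (e < 0)%R) t'.
Proof.
move=> e0 [sy hc ha hb sl]; pose X := homog \o t.
pose A : {poly R} := 1 + e%:P * ('X * (e%:P)); pose B : {poly R} := e%:P.
pose D : {poly R} := 'X * e%:P.
have dt : A * 1 - B * D = 1 by rewrite /A /B /D; ring.
pose Y := translate e%:P (shear ('X * (- e)%:P) X).
have eY z : act A B D 1 X z = Y z.
  rewrite /act /Y /translate /shear /A /B /D /= !(evalCD, evalCM, evalCX, evalCC).
  have -> : (1 : R)%:C = 1 :> C by [].
  by rewrite rmorphN /=; congr (_, _); ring.
have en : - e != 0 by rewrite oppr_eq0.
have sm : small (shear ('X * (- e)%:P) X) := shear_small en sl.
have prop z : upper z -> proportional (Y z) (homog (pmoebius A B D 1 t z)).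
  by move=> _; rewrite -eY; exact: pmoebius_coords.
have prop' z : upper z -> proportional (zmul Y z) (zmul (homog \o pmoebius A B D 1 t) z).
  by move=> /prop [c c0 ec]; exists c; [exact: c0|rewrite /zmul ec /=; congr (_, _); ring].
have iY : is_idx (ker Y) (a + (0 < e)%R).
  have w0 := weight0 e%:P; have w1 := weight1 (- e); rewrite oppr_lt0 in w1.
  rewrite addnC -w1 (_ : (weight ('X * (- e)%:P) 1 + a = weight e%:P 0 + (weight ('X * (- e)%:P) 1 + a))%N); last by rewrite w0.
  split.
    apply: translate_idx_le; first exact: size_polyC_leq1.
    by apply: shear_idx_le ha.1; apply: size_Xm; exact: size_polyC_leq1.
  apply: translate_idx_ge; [exact: size_polyC_leq1|exact: slow_swap|].
  by apply: shear_idx_ge ha.2 => //; apply: size_Xm; exact: size_polyC_leq1.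
have iZ : is_idx (ker (zmul Y)) (b + (e < 0)%R).
  have w0 := weight0 (- e)%:P; have w1 := weight1 e.
  have e1 := fsym (zmul_translate e%:P (shear ('X * (- e)%:P) X)).
  have e2 := fsym (zmul_shear (- e)%:P X).
  rewrite addnC -w1 (_ : b = (weight (- e)%:P 0 + b)%N); last by rewrite w0.
  split.
    apply: (eqX_idx_le e1); apply: translate_idx_le.
      by apply: size_Xm; exact: size_polyC_leq1.
    apply: (eqX_idx_le e2); apply: shear_idx_le hb.1; exact: size_polyC_leq1.
  apply: (eqX_idx_ge e1); apply: translate_idx_ge.
  - by apply: size_Xm; exact: size_polyC_leq1.
  - exact: slow_swap_zmul.
  apply: (eqX_idx_ge e2); apply: shear_idx_ge hb.2; first exact: size_polyC_leq1.
  exact: slow_zmul.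
exists (pmoebius A B D 1 t); split.
- exact: pmoebius_symmetric.
- by move=> z0 u0; apply: pmoebius_has_coords => //; exact: hc.
- exact: (is_idx_scale prop iY).
- exact: (is_idx_scale prop' iZ).
have [h1 h2] := slow_translate e0 sm.
have pr y : proportional (Y (imag y)) (homog (pmoebius A B D 1 t (imag y))).
  by rewrite -eY; exact: pmoebius_coords.
split.
  by apply: filterS h1 => y; rewrite -[translate _ _]/Y; have [c c0 ->] := pr y; rewrite mulf_eq0 negb_or => /andP [].
apply: cvg_near_eq h2; apply: nearW => y; rewrite -[translate _ _]/Y.
by have [c c0 ->] := pr y; rewrite /= invfM mulrACA divff // mul1r.
Qed.

Lemma param_infinity : param 0 0 (fun=> None).
Proof.
have i0 X : (forall z, (X z).2 = 0) -> is_idx (@ker R X) 0.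
  by move=> e; split; [exact: idx_le0|exact: idx_ge0].
split.
- by [].
- move=> z0 u0; exists (fun=> 1), (fun=> 0); apply: filterS (upper_open u0) => z _.
  by split; [exact: derivable_cst|exact: derivable_cst|rewrite oner_eq0|rewrite /ofhomog eqxx].
- exact: i0.
- exact: i0.
split; first by apply: nearW => y; exact: oner_neq0.
apply: (cvg_near_eq (f := fun=> 0)); last exact: cvg_cst.
by apply: nearW => y; rewrite /= !mul0r.
Qed.

(** No class of parameters is emptied by the growth condition, whence the
    sufficiency of the inequalities in the solvability criterion. *)
Lemma param_exists a b : exists t, param a b t.
Proof.
elim: a => [|a [t /(param_step (oner_neq0 R))]].
  elim: b => [|b [t /(param_step (e := -1)) h]]; first by exists (fun=> None); exact: param_infinity.
  have [|t'] := h; first by rewrite oppr_eq0 oner_eq0.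
  by rewrite oppr_gt0 oppr_lt0 ltr01 ltr10 !addn0 addn1 => ht; exists t'.
by rewrite ltr01 ltr10 addn0 addn1.
Qed.

(** Shears are inverted by shears, and translations by translations; so if a
    continued fraction has finite index, then so has its parameter. *)
Lemma shear_idx_inv (p : {poly R}) X k : idx_le (ker (shear p X)) k ->
  exists b, @idx_le R (ker X) b.
Proof.
move=> h; exists (weight (- p) (size p) + k)%N.
apply: (eqX_idx_le (X := shear (- p) (shear p X))).
  by move=> z; rewrite /shear /= evalCN; case: (X z) => u v /=; congr (_, _); ring.
by apply: shear_idx_le h; rewrite size_polyN.
Qed.

Lemma translate_idx_inv (p : {poly R}) X k : idx_le (ker (translate p X)) k ->
  exists b, @idx_le R (ker X) b.
Proof.
move=> h; exists (weight (- p) (size p) + k)%N.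
apply: (eqX_idx_le (X := translate (- p) (translate p X))).
  by move=> z; rewrite /translate /= evalCN; case: (X z) => u v /=; congr (_, _); ring.
by apply: translate_idx_le h; rewrite size_polyN.
Qed.

Lemma levels_idx_inv m l j n t k : idx_le (ker (levels m l j n t)) k ->
  exists b, @idx_le R (ker t) b.
Proof.
elim: n j k => [|n IH] j k; first exact: shear_idx_inv.
by move=> /shear_idx_inv [b /translate_idx_inv [b' /IH]].
Qed.

Lemma levels_zmul_idx_inv m l j n t k : idx_le (ker (zmul (levels m l j n t))) k ->
  exists b, @idx_le R (ker (zmul t)) b.
Proof.
elim: n j k => [|n IH] j k h.
  by apply: (@shear_idx_inv (m j.+1) _ k); apply: eqX_idx_le (zmul_shear _ _) h.
have [b h1] : exists b, idx_le (ker (zmul (translate (l j.+1)%:P (levels m l j.+1 n t)))) b.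
  by apply: (@shear_idx_inv (m j.+1) _ k); apply: eqX_idx_le (zmul_shear _ _) h.
have [b' h2] : exists b, idx_le (ker (zmul (levels m l j.+1 n t))) b.
  by apply: (@translate_idx_inv _ _ b); apply: eqX_idx_le (zmul_translate _ _) h1.
exact: IH h2.
Qed.

Lemma stieltjesS m l x y k :
  @stieltjes_pair R m l x y k.+1 = ((stieltjes_pair m l x y k).2,
   (if odd k.+1 then - 'X * m (uphalf k.+1) else (l k.+1./2)%:P) *
     (stieltjes_pair m l x y k).2 + (stieltjes_pair m l x y k).1).
Proof. by []. Qed.

Lemma stieltjes_odd m l x y j :
  @stieltjes_pair R m l x y j.*2.+1 = ((stieltjes_pair m l x y j.*2).2,
   - 'X * m j.+1 * (stieltjes_pair m l x y j.*2).2 + (stieltjes_pair m l x y j.*2).1).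
Proof. by rewrite stieltjesS oddS odd_double uphalfE -doubleS doubleK. Qed.

Lemma stieltjes_even m l x y j :
  @stieltjes_pair R m l x y j.*2.+2 = ((stieltjes_pair m l x y j.*2.+1).2,
   (l j.+1)%:P * (stieltjes_pair m l x y j.*2.+1).2 + (stieltjes_pair m l x y j.*2.+1).1).
Proof. by rewrite stieltjesS -doubleS odd_double doubleK. Qed.

(** The recurrence builds up the product of the elementary matrices of the
    chain. *)
Lemma stieltjes_levels m l x y j n (t : C -> V2) z :
  evalC (@stieltjes_pair R m l x y (j + n).*2.+1).2 z * (t z).1 +
  evalC (stieltjes_pair m l x y (j + n).*2.+1).1 z * (t z).2 =
  evalC (stieltjes_pair m l x y j.*2).1 z * (levels m l j n t z).1 +
  evalC (stieltjes_pair m l x y j.*2).2 z * (levels m l j n t z).2.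
Proof.
elim: n j => [|n IH] j.
  rewrite addn0 stieltjes_odd /= /shear /= !evalCD !evalCM !evalCN evalCX; ring.
rewrite -addSnnS IH doubleS stieltjes_even stieltjes_odd.
rewrite [levels m l j n.+1 t]/= -/(levels m l) /shear /translate.
move: (levels m l j.+1 n t z) => [u v]; move: (stieltjes_pair _ _ _ _ _) => [p q].
by rewrite /= !(evalCD, evalCM, evalCN, evalCX, evalCC); ring.
Qed.

Lemma stieltjes_det m l k :
  (stieltjes_pair m l 1 0 k).2 * (stieltjes_pair m l 0 1 k).1 -
  (stieltjes_pair m l 1 0 k).1 * (stieltjes_pair m l 0 1 k).2 = - (-1) ^+ k :> {poly R}.
Proof.
elim: k => [|k IH]; first by rewrite /= expr0; ring.
rewrite exprS mulN1r -IH [stieltjes_pair m l 1 0 k.+1]/= [stieltjes_pair m l 0 1 k.+1]/=.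
move: (if _ then _ else _) => a.
move: (stieltjes_pair m l 1 0 k) (stieltjes_pair m l 0 1 k) => [p q] [p' q'] /=; ring.
Qed.

Section Main.
Variables (s : seq R) (ns : seq nat) (ss fs : nat -> seq R) (m : nat -> {poly R}) (l : nat -> R).
Let N := size ns.
Let nu j := (nidx ns j - nidx ns j.-1)%N.
Hypotheses (N0 : (0 < N)%N) (so : sorted ltn ns) (hns : forall n, (n \in ns) = normal_index s n).
Hypotheses (szs : size s = (2 * nidx ns N - 1)%N) (hrec : schur_recursion s ns ss fs m l).
Hypothesis (reg : regular s ns).

Let ss0 : ss 0%N = s. Proof. by case: hrec. Qed.

Lemma levels_sized : sized m nu 0 N.-1.
Proof.
move=> i hi; rewrite add0n.
have hi' : (i < N)%N by lia.
by split; [exact: (nu_gt0 so hns)|exact: (size_m so hns hrec)].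
Qed.

(** The moment condition descends the levels and ends as the growth condition
    on the parameter. *)
Lemma levels_asym j n t : (j + n.+1 = N)%N -> asym (levels m l j n t) (ss j) <-> slow t.
Proof.
elim: n j => [|n IH] j e.
  have hj : (j < N)%N by lia.
  apply: (asym_last t (nu := nu j.+1)).
  - exact: (nu_gt0 so hns).
  - by rewrite (size_ss so szs hrec hj) -[size ns]/N -e addn1.
  - exact: (ss_prefix so hns szs hrec hj).
  - exact: (size_m so hns hrec).
  - exact: (m_inverse so hns szs hrec hj).
have hj : (j.+1 < N)%N by lia.
have hj' := ltnW hj.
have [e1 h1 h2] := recursion_inverse so hns szs hrec hj.
rewrite -(IH j.+1); last by lia.
apply: (asym_step _ (nu := nu j.+1) (fs := fs j.+1)).
- exact: (nu_gt0 so hns).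
- exact: e1.
- exact: (ss_prefix so hns szs hrec hj').
- exact: (size_m so hns hrec).
- exact: h1.
- exact: h2.
Qed.

Lemma levels_asym0 t : asym (levels m l 0 N.-1 t) s <-> slow t.
Proof. by rewrite -ss0; apply: levels_asym; rewrite add0n prednK. Qed.

Lemma levels_steady t : slow t -> steady m l 0 N.-1 t.
Proof.
move=> st; split=> // i hi; rewrite add0n.
have hi' : (i.+1 < N)%N by lia.
split; first exact: (l_neq0 so hns szs hrec hi').
have sz : (0 < size (ss i.+1))%N.
  have := nu_gt0 so hns hi'; have := nidx_nu so hns hi'; have := nidx_le so hns hi'.
  by rewrite (size_ss so szs hrec hi'); lia.
apply: (asym_small sz); apply/levels_asym => //; lia.
Qed.

Lemma nidx_sum k : (k <= N)%N -> (\sum_(i < k) nu i.+1 = nidx ns k)%N.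
Proof.
elim: k => [|k IH] hk; first by rewrite big_ord0.
by rewrite big_ord_recr /= IH ?(ltnW hk) // (nidx_nu so hns hk).
Qed.

Let t0 : C -> V2 := homog \o (fun=> None).

Lemma det_last : \det (hankel s (nidx ns N)) != 0.
Proof.
have : nidx ns N \in ns by rewrite -(prednK N0); apply: nidx_mem; rewrite prednK.
by rewrite hns => /and3P [].
Qed.

Lemma det_plus_last : \det (hankel_plus s (nidx ns N - 1)) != 0.
Proof. by apply: reg; rewrite N0 leqnn. Qed.

Lemma hankel_behead (r : seq R) n : hankel_plus r n = hankel (behead r) n.
Proof. by apply/matrixP => i j; rewrite !mxE nth_behead. Qed.

Lemma hankel_opp (r : seq R) n : hankel (map -%R r) n = - hankel r n.
Proof.
apply/matrixP => i j; rewrite !mxE; have [h|h] := ltnP (i + j)%N (size r).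
  by rewrite (nth_map 0).
by rewrite !nth_default ?oppr0 ?size_map.
Qed.

(** The Hankel matrix bounds the indices of X and of its opposite from below.
    Being nonsingular, it has n squares in all; so upper bounds whose sum is
    at most n are attained. *)
Lemma index_by_opposite X (r : seq R) n a b : (2 * n - 1 <= size r)%N -> asym X r ->
  \det (hankel r n) != 0 -> idx_le (ker X) a -> idx_le (ker (oppX X)) b -> (a + b <= n)%N ->
  nu_minus (hankel r n) = a.
Proof.
move=> le hX d0 ha hb hab; have sy := hankel_sym r n.
have h1 : (nu_minus (hankel r n) <= a)%N.
  by apply: idx_ge_le ha; apply: asym_hankel le hX _; exact: (nu_minus_neg sy).2.
have h2 : (nu_minus (- hankel r n) <= b)%N.
  apply: idx_ge_le hb; apply: (@asym_hankel _ (map -%R r) n).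
  - by rewrite size_map.
  - exact: asym_opp.
  - by rewrite hankel_opp; apply: (nu_minus_neg _).2; rewrite linearN /= sy.
by have := nu_minus_opp_ge sy d0; lia.
Qed.

(** The parameter infinity has index 0, and for it the sum of the weights is
    an upper bound to which index_by_opposite applies. *)
Lemma mass_hankel : nu_minus (hankel s (nidx ns N)) = mass m nu 0 N.-1.
Proof.
have [_ _ h0 h1 sl] := param_infinity; have sz := levels_sized.
have szN : sized (fun i => - m i) nu 0 N.-1.
  by move=> i /sz [h2 h3]; split=> //; rewrite size_polyN.
have opp0 : idx_le (ker (oppX t0)) 0 by exact: idx_le0.
apply: (@index_by_opposite (levels m l 0 N.-1 t0) s _ _ (mass (fun i => - m i) nu 0 N.-1 + 0)).
- by rewrite szs.
- exact/levels_asym0.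
- exact: det_last.
- by rewrite -[X in idx_le _ X]addn0; exact: (levels_idx_le l sz h0.1).
- apply: eqX_idx_le (levels_idx_le (fun i => - l i) szN opp0) => z.
  exact: levels_opp.
- rewrite addn0; apply: leq_trans (mass_opp _ _ _ _) _.
  under eq_bigr do rewrite add0n.
  by rewrite prednK // nidx_sum.
Qed.

(** Adding s_0 to z f leaves a function with the moments s_1, s_2, ... and
    does not change the kernel. *)
Lemma massp_hankel : nu_minus (hankel_plus s (nidx ns N - 1)) = massp m l nu 0 N.-1.
Proof.
have [_ _ h0 h1 sl] := param_infinity; have sz := levels_sized.
have szN : sized (fun i => - m i) nu 0 N.-1.
  by move=> i /sz [h2 h3]; split=> //; rewrite size_polyN.
have opp0 : idx_le (ker (zmul (oppX t0))) 0 by exact: idx_le0.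
have nN : (0 < nidx ns N)%N by rewrite -[0%N]/(nidx ns 0); apply: nidx_lt => //; exact: ns_pos hns.
pose X := translate (s`_0)%:P (zmul (levels m l 0 N.-1 t0)).
rewrite hankel_behead.
apply: (@index_by_opposite X (behead s) _ _ (massp (fun i => - m i) (fun i => - l i) nu 0 N.-1)).
- by rewrite size_behead szs; lia.
- by apply: asym_zmul; [rewrite szs; lia|exact/levels_asym0].
- by rewrite -hankel_behead det_plus_last.
- have := translate_idx_le (size_polyC_leq1 s`_0) (levels_zmul_idx_le l sz h1.1).
  by rewrite weight0 add0n addn0.
- have := translate_idx_le (size_polyC_leq1 (- s`_0))
    (levels_zmul_idx_le (fun i => - l i) szN opp0).
  rewrite weight0 add0n addn0; apply: eqX_idx_le => z.
  rewrite /X /translate /zmul levels_opp /oppX /= polyCN evalCN; congr (_, _); ring.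
- have hl i : (i < N.-1)%N -> l (0 + i.+1)%N != 0.
    by move=> hi; rewrite add0n; apply: (l_neq0 so hns szs hrec); move: hi; rewrite -/N; lia.
  apply: leq_trans (massp_opp m nu hl) _.
  under eq_bigr do rewrite add0n.
  have e : (\sum_(i < N.-1.+1) (nu i.+1).-1 + N.-1.+1 = nidx ns N)%N.
    rewrite -[X in (_ + X)%N]card_ord -sum1_card -big_split /= -[in RHS](prednK N0).
    rewrite -nidx_sum; last by rewrite prednK.
    apply: eq_bigr => i _; rewrite addn1 prednK //; apply: (nu_gt0 so hns).
    by have := ltn_ord i; rewrite -/N; lia.
  by rewrite -e addnS subn1.
Qed.

Let a := Qplus m l (2 * N - 1).
Let b := Qplus m l (2 * N - 2).
Let c := Pplus m l (2 * N - 1).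
Let d := Pplus m l (2 * N - 2).

Let index1 : (2 * N - 1 = (0 + N.-1).*2.+1)%N. Proof. by move: N0; lia. Qed.
Let index2 : (2 * N - 2 = (0 + N.-1).*2)%N. Proof. by move: N0; lia. Qed.

Lemma chain_det : a * d - b * c = 1.
Proof.
have := stieltjes_det m l (0 + N.-1).*2.+1.
rewrite exprS -muln2 mulnC exprM sqrrN expr1n expr1n mulN1r opprK => <-.
by rewrite /a /b /c /d /Qplus /Pplus index1 index2 -muln2 mulnC.
Qed.

Lemma chain_coords t z : act a b c d t z = levels m l 0 N.-1 t z.
Proof.
have h1 := stieltjes_levels m l 1 0 0 N.-1 t z; have h2 := stieltjes_levels m l 0 1 0 N.-1 t z.
rewrite /act /a /b /c /d /Qplus /Pplus index1 index2.
have e1 : evalC 1 z = 1 :> C by rewrite /evalC rmorph1 hornerC.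
have e0 : evalC 0 z = 0 :> C by rewrite /evalC rmorph0 horner0.
move: h1 h2; rewrite !stieltjesS /= e1 e0 !mul1r !mul0r addr0 add0r => -> ->.
by case: (levels _ _ _ _ _ _).
Qed.

Lemma real_symmetric_eq (f g : C -> option C) : (forall z, nonreal z -> f z = g z) ->
  real_symmetric g -> real_symmetric f.
Proof. by move=> e sg z nz; rewrite !e //; [exact: sg|exact: conj_nonreal]. Qed.

Lemma has_coords_eq (f g : C -> option C) z0 : (forall z, nonreal z -> f z = g z) ->
  upper z0 -> has_coords g z0 -> has_coords f z0.
Proof.
move=> e u0 [u [v h]]; exists u, v; apply: filterS (filterI h (upper_open u0)).
by move=> z [[h1 h2 h3 h4] uz]; split=> //; rewrite e //; exact: upper_nonreal.
Qed.

Lemma solution_param (f tau : C -> option C) (kappa k : nat) :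
  (forall z, nonreal z -> f z = pmoebius a b c d tau z) ->
  moment_solution (Posz kappa) (Posz k) s f <->
  nevanlinna2 (Posz kappa - Posz (nu_minus (hankel s (nidx ns N))))
    (Posz k - Posz (nu_minus (hankel_plus s (nidx ns N - 1)))) tau /\
  nontangential_o_z (fun z => sphere_inv (tau z)).
Proof.
move=> hf; have dt := chain_det; rewrite mass_hankel massp_hankel.
set M := mass _ _ _ _; set P := massp _ _ _ _ _.
pose t := homog \o tau; pose X := levels m l 0 N.-1 t.
have prop z : upper z -> proportional (X z) (homog (f z)).
  by move=> uz; rewrite (hf _ (upper_nonreal uz)) /X -chain_coords; exact: pmoebius_coords.
have prop' z : upper z -> proportional (zmul X z) (zmul (homog \o f) z).
  by move=> /prop [q q0 e]; exists q => //; rewrite /zmul e /=; congr (_, _); ring.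
have asymE : asym (homog \o f) s <-> slow t.
  rewrite -levels_asym0; split; last exact: asym_scale.
  by apply: asym_scale => z /prop; exact: proportional_sym.
have hf' z : nonreal z -> tau z = pmoebius d (- b) (- c) a f z.
  by move=> nz; rewrite -(pmoebiusK tau z dt) /pmoebius (hf _ nz).
have dt' : d * a - - b * - c = 1 by rewrite -dt; ring.
rewrite moment_asym asymE; split=> [[/nevanlinna2P [sf hc ha hb] sl]|[h nt]].
  have hX : is_idx (ker X) kappa.
    by apply: is_idx_scale ha => z /prop; exact: proportional_sym.
  have hZ : is_idx (ker (zmul X)) k.
    by apply: is_idx_scale hb => z /prop'; exact: proportional_sym.
  have st := levels_steady sl; have sz := levels_sized.
  have [q /idx_le_is_idx [|p _ hp]] := levels_idx_inv hX.1; first by move=> z w; exact: herm_ker.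
  have [q' /idx_le_is_idx [|p' _ hp']] := levels_zmul_idx_inv hZ.1.
    by move=> z w; exact: herm_ker.
  have <- := is_idx_uniq (levels_is_idx sz st hp) hX.
  have <- := is_idx_uniq (levels_zmul_is_idx sz st hp') hZ.
  have sub (x y : nat) : (Posz (x + y)%N - Posz x)%R = Posz y by lia.
  rewrite -/M -/P !sub.
  split; last exact: slow_nontangential_o hp.1 sl.
  apply/nevanlinna2P; split; [|move=> z0 u0| |] => //.
  - by apply: real_symmetric_eq hf' _; exact: pmoebius_symmetric.
  - exact: (has_coords_eq hf' u0 (pmoebius_has_coords dt' (hc _ u0))).
have sl := nontangential_slow nt; split; last exact: sl.
have st := levels_steady sl; have sz := levels_sized.
have [p [q [ep eq]]] : exists p q : nat, (kappa%:Z - M%:Z)%R = p%:Z /\ (k%:Z - P%:Z)%R = q%:Z.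
  move: h; case: (kappa%:Z - M%:Z)%R => // p; case: (k%:Z - P%:Z)%R => // q _.
  by exists p, q.
move: h; rewrite ep eq => /nevanlinna2P [sf hc ha hb].
have ek : kappa = (M + p)%N by lia.
have ek' : k = (P + q)%N by lia.
apply/nevanlinna2P; rewrite ek ek'; split.
- by apply: real_symmetric_eq hf _; exact: pmoebius_symmetric.
- move=> z0 u0; exact: (has_coords_eq hf u0 (pmoebius_has_coords dt (hc _ u0))).
- exact: is_idx_scale prop (levels_is_idx sz st ha).
- exact: is_idx_scale prop' (levels_zmul_is_idx sz st hb).
Qed.

Lemma parametrization (kappa k : nat) (f : C -> option C) :
  moment_solution (Posz kappa) (Posz k) s f <->
  exists tau : C -> option C,
    [/\ nevanlinna2 (Posz kappa - Posz (nu_minus (hankel s (nidx ns N))))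
          (Posz k - Posz (nu_minus (hankel_plus s (nidx ns N - 1)))) tau,
        nontangential_o_z (fun z => sphere_inv (tau z)) &
        forall z, nonreal z -> f z = pmoebius a b c d tau z].
Proof.
split=> [h|[tau [h1 h2 h3]]]; last exact/(solution_param _ _ h3).
have dt := chain_det; have dt' : d * a - - b * - c = 1 by rewrite -dt; ring.
pose tau := pmoebius d (- b) (- c) a f.
have hf z : nonreal z -> f z = pmoebius a b c d tau z.
  by move=> _; rewrite -[LHS](pmoebiusK f z dt') !opprK.
by have [h1 h2] := (solution_param _ _ hf).1 h; exists tau.
Qed.

Lemma solvability (kappa k : nat) :
  (exists f, moment_solution (Posz kappa) (Posz k) s f) <->
  (nu_minus (hankel s (nidx ns N)) <= kappa)%N /\
  (nu_minus (hankel_plus s (nidx ns N - 1)) <= k)%N.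
Proof.
split=> [[f /parametrization [tau [h _ _]]]|[h1 h2]].
  move: h; set M := nu_minus _; set P := nu_minus _.
  case E : (Posz kappa - Posz M)%R => [p|//]; case E' : (Posz k - Posz P)%R => [q|//] _.
  by split; lia.
have [tau [h3 h4 h5 h6 h7]] := param_exists (kappa - nu_minus (hankel s (nidx ns N)))
  (k - nu_minus (hankel_plus s (nidx ns N - 1))).
exists (pmoebius a b c d tau); apply/parametrization; exists tau; split=> //.
  by rewrite !subzn //; apply/nevanlinna2P.
exact: slow_nontangential_o h5.1 h7.
Qed.

End Main.

End Assembly.

Local Open Scope complex_scope.

Theorem theorem5p7 (R : realType) (N kappa k : nat) (s : seq R) (ns : seq nat)
    (ss fs : nat -> seq R) (m : nat -> {poly R}) (l : nat -> R) :
  (1 <= N)%N ->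
  size ns = N ->
  sorted ltn ns ->
  (forall n, (n \in ns) = normal_index s n) ->
  size s = (2 * nidx ns N - 1)%N ->
  regular s ns ->
  schur_recursion s ns ss fs m l ->
  let kappaN := nu_minus (hankel s (nidx ns N)) in
  let kN := nu_minus (hankel_plus s (nidx ns N - 1)) in
  ((exists f, moment_solution (Posz kappa) (Posz k) s f) <->
     (kappaN <= kappa)%N /\ (kN <= k)%N) /\
  (forall f : R[i] -> option R[i],
     moment_solution (Posz kappa) (Posz k) s f <->
     exists tau : R[i] -> option R[i],
       [/\ nevanlinna2 (Posz kappa - Posz kappaN) (Posz k - Posz kN) tau,
           nontangential_o_z (fun z => sphere_inv (tau z)) &
           forall z, nonreal z ->
             f z = moebius
               (evalC (Qplus m l (2 * N - 1)) z) (evalC (Qplus m l (2 * N - 2)) z)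
               (evalC (Pplus m l (2 * N - 1)) z) (evalC (Pplus m l (2 * N - 2)) z)
               (tau z)]).
Proof.
move=> N0 eN so hns szs reg hrec /=; subst N.
split; first exact: (solvability N0 so hns szs hrec reg).
by move=> f; exact: (parametrization N0 so hns szs hrec reg).
Qed.
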